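(* Let $\tau\in L^{1}_{loc}(\mathbb{R})$ vanish on $(-\infty,0)$, have convergent (improper) Laplace transform $\mathcal{L}\{\tau;s\}=\int_0^\infty\tau(x)e^{-sx}\,\mathrm{d}x$ for $\Re e\, s>0$, and be boundedly decreasing. Then $\tau$ is boundedly oscillating if and only if there is a function $G(s)$ analytic on the intersection of $\Re e\, s>0$ with a complex neighborhood of $s=0$ such that both $\mathcal{L}\{\tau;s\}-G(s)/s$ and $G(s)$ admit pseudomeasure boundary behavior at $s=0$. Furthermore, in that case, for sufficiently small $\lambda>0$ there is $g\in L^\infty(\mathbb{R})$ whose Fourier transform satisfies $\hat g(t)=\lim_{\sigma\to0^+}G(\sigma+it)$ in $\mathcal{D}'(-\lambda,\lambda)$, and $\tau(x)=\int_0^x g(y)\,\mathrm{d}y+O(1)$ as $x\to\infty$.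
   Context: A real-valued function $\tau$ is boundedly decreasing if there is $\delta>0$ with $\liminf_{x\to\infty}\inf_{h\in[0,\delta]}(\tau(x+h)-\tau(x))>-\infty$ (for complex-valued functions: real and imaginary parts are). A function $\tau$ is boundedly oscillating if there is $\delta>0$ with $\limsup_{x\to\infty}\sup_{h\in[0,\delta]}|\tau(x+h)-\tau(x)|<\infty$. The Fourier transform is $\hat\varphi(t)=\int e^{-itx}\varphi(x)\,\mathrm{d}x$, extended to tempered distributions by duality. A tempered distribution $f$ is a pseudomeasure if $\hat f\in L^\infty(\mathbb{R})$. An analytic function $F$ defined on $\{\Re e\, s>0\}$ near $0$ has pseudomeasure boundary behavior at $s=0$ if there is an open interval $U\ni0$ such that $F(\sigma+it)$ converges in $\mathcal{D}'(U)$ as $\sigma\to0^+$ to a distribution that coincides, near each point of $U$, with a pseudomeasure. *)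

(* Defs.v *)
From HB Require Import structures.
From mathcomp Require Import all_boot all_order all_algebra.
From mathcomp Require Import all_classical all_reals all_analysis.
From mathcomp Require Export complex.
Export numFieldNormedType.Exports.

Set Implicit Arguments.
Unset Strict Implicit.
Unset Printing Implicit Defensive.

Import Order.TTheory GRing.Theory Num.Theory.
Local Open Scope classical_set_scope.
Local Open Scope ring_scope.
Local Open Scope complex_scope.

Section Defs.
Variable R : realType.

Local Notation mu := (@lebesgue_measure R).
Local Notation C := (R[i]).

Definition cexp (z : C) : C :=
  (expR (complex.Re z) * cos (complex.Im z)) +i* (expR (complex.Re z) * sin (complex.Im z)).

Definition cint (D : set R) (f : R -> C) : C :=
  (Rintegral mu D (fun x => complex.Re (f x))) +i* (Rintegral mu D (fun x => complex.Im (f x))).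

Definition loc_integrable (f : R -> C) : Prop :=
  measurable_fun setT (fun x => complex.Re (f x)) /\
  measurable_fun setT (fun x => complex.Im (f x)) /\
  forall a b : R, mu.-integrable `[a, b] (fun x => ((complex.Re (f x))%:E)) /\
                  mu.-integrable `[a, b] (fun x => ((complex.Im (f x))%:E)).

Definition Linfty (g : R -> C) : Prop :=
  measurable_fun setT (fun x => complex.Re (g x)) /\
  measurable_fun setT (fun x => complex.Im (g x)) /\
  exists M : R, {ae mu, forall x, `|g x| <= M%:C}.

Definition laplace_partial (tau : R -> C) (s : C) (T : R) : C :=
  cint `[0, T] (fun x => tau x * cexp (- (s * x%:C))).

Definition laplace (tau : R -> C) (s : C) : C :=
  lim ((laplace_partial tau s : R -> C^o) @ +oo).

Definition laplace_converges (tau : R -> C) : Prop :=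
  forall s : C, 0 < complex.Re s -> cvg ((laplace_partial tau s : R -> C^o) @ +oo).

Definition bdd_decreasing_real (u : R -> R) : Prop :=
  exists2 delta : R, 0 < delta &
    exists M : R, \forall x \near +oo,
      forall h : R, 0 <= h <= delta -> - M <= u (x + h) - u x.

Definition bdd_decreasing (tau : R -> C) : Prop :=
  bdd_decreasing_real (fun x => complex.Re (tau x)) /\
  bdd_decreasing_real (fun x => complex.Im (tau x)).

Definition bdd_oscillating (tau : R -> C) : Prop :=
  exists2 delta : R, 0 < delta &
    exists M : R, \forall x \near +oo,
      forall h : R, 0 <= h <= delta -> `|tau (x + h) - tau x| <= M%:C.

Definition rderive_n (n : nat) (u : R -> R) : R -> R := iter n (fun v : R -> R => derive1 v) u.

Definition smooth_real (u : R -> R) : Prop :=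
  forall (n : nat) (x : R), derivable (rderive_n n u) x 1.

Definition smooth (phi : R -> C) : Prop :=
  smooth_real (fun x => complex.Re (phi x)) /\ smooth_real (fun x => complex.Im (phi x)).

Definition test_fun (a b : R) (phi : R -> C) : Prop :=
  smooth phi /\
  exists c d : R, [/\ a < c, d < b & forall x, x < c \/ d < x -> phi x = 0].

Definition schwartz (phi : R -> C) : Prop :=
  smooth phi /\
  forall k n : nat, exists K : R, forall x : R,
    `|x ^+ k * rderive_n n (fun y => complex.Re (phi y)) x| <= K /\
    `|x ^+ k * rderive_n n (fun y => complex.Im (phi y)) x| <= K.

Definition fourier (phi : R -> C) (t : R) : C :=
  cint setT (fun x => cexp (- (0 +i* (t * x))) * phi x).

(* tempered distributions: linear functionals on the Schwartz space that are
   continuous w.r.t. the standard family of seminorms *)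
Definition tempered (f : (R -> C) -> C) : Prop :=
  [/\ (forall phi psi, schwartz phi -> schwartz psi ->
         f (fun x => phi x + psi x) = f phi + f psi),
      (forall (c : C) phi, schwartz phi -> f (fun x => c * phi x) = c * f phi) &
      exists (K : R) (N : nat), forall phi, schwartz phi ->
        forall M : R,
          (forall k n : nat, (k <= N)%N -> (n <= N)%N -> forall x : R,
             `|x ^+ k * rderive_n n (fun y => complex.Re (phi y)) x| <= M /\
             `|x ^+ k * rderive_n n (fun y => complex.Im (phi y)) x| <= M) ->
          `|f phi| <= (K * M)%:C].

(* pseudomeasure: tempered distribution f whose Fourier transform (defined by
   duality, <f^, phi> = <f, phi^>) is an L^infty function h *)
Definition pseudomeasure (f : (R -> C) -> C) : Prop :=
  tempered f /\
  exists h : R -> C, Linfty h /\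
    forall phi, schwartz phi -> f (fourier phi) = cint setT (fun x => h x * phi x).

Definition bdry_limit (F : C -> C) (a b : R) (T : (R -> C) -> C) : Prop :=
  forall phi, test_fun a b phi ->
    ((fun sigma : R => cint setT (fun t => F (sigma +i* t) * phi t)) : R -> C^o)
      @ 0^'+ --> (T phi : C^o).

Definition pm_boundary (F : C -> C) : Prop :=
  exists a b : R, a < 0 < b /\
  exists T : (R -> C) -> C, bdry_limit F a b T /\
    forall t0 : R, a < t0 < b ->
      exists c d : R, [/\ a <= c, c < t0, t0 < d & d <= b] /\
      exists f, pseudomeasure f /\
        forall phi, test_fun c d phi -> T phi = f phi.

Definition analytic_near0 (G : C -> C) (r : R) : Prop :=
  forall z : C, 0 < complex.Re z -> complex.Re z ^+ 2 + complex.Im z ^+ 2 < r ^+ 2 ->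
    derivable (G : C^o -> C^o) z 1.

End Defs.

(* Main.v *)
(* Put Q = L{tau} - G/s, so that s L{tau} = s Q + G, and let q^ and g^ be the boundary values
   of Q and G near 0, with q and g bounded. Fix a test function chi near 0 whose Fourier
   transform kappa is nonnegative and positive at 0. Testing the identity against chi times the
   transform of the indicator of [a, b] shows that, as sigma -> 0+,
     int e^(-sigma x) tau(x) (sigma (kappa * 1_[a,b])(x) + kappa(x - b) - kappa(x - a)) dx
   tends to <q, kappa(. - b) - kappa(. - a)> + <g, kappa * 1_[a,b]>, which is bounded in terms of
   b - a alone. For b = a + h this is an average of the increments tau(x + h) - tau(x), which
   bounded decrease makes nonnegative up to a constant; as kappa is bounded below near 0, each
   increment is bounded above, so tau oscillates boundedly and grows at most linearly. The limit
   may then be taken under the integral, and for [a, b] = [0, y] it reads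
     int tau(x) kappa(x - y) dx = <g, kappa * 1_[0,y]> + O(1),
   where the two sides are J tau(y) + O(1) and J int_0^y g + O(1) with J = int kappa > 0.
   Conversely, if |tau(x + h) - tau(x)| stays bounded for 0 <= h <= d, take for G the Laplace
   transform of (tau(x) - tau(x - d))/d: then G/s is the transform of the mean of tau over
   [x - d, x], which stays within a bounded distance of tau, so that both functions in question
   are Laplace transforms of functions that are bounded off a compact set. *)

Require Import Defs.
From HB Require Import structures.
From mathcomp Require Import all_boot all_order all_algebra.
From mathcomp Require Import all_classical all_reals all_analysis.
From mathcomp Require Import measurable_realfun complex.
From mathcomp Require Import ring lra.
Import numFieldNormedType.Exports.
Import Order.TTheory GRing.Theory Num.Theory.
Import ComplexField.Normc.
Set Implicit Arguments.
Unset Strict Implicit.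
Unset Printing Implicit Defensive.
Local Open Scope classical_set_scope.
Local Open Scope ring_scope.
Local Open Scope complex_scope.

(** The obstacle is that nothing is known at the outset about the growth of tau, so the term sigma
    (kappa * 1_[a,b]) of the tested identity cannot be dropped: its integral against e^(-sigma x)
    tau(x) might be of the size of the other terms. It is kept and estimated. As a superposition of
    kernels kappa(x - v) with v in [y, y + h], it is bounded below, by bounded decrease, by (1 - e)
    N - O(1), where e = e^(-sigma h) and N is the integral of e^(-sigma x) tau(x) kappa(x - y). The
    two other terms give e A - N up to O(1), with A the analogue of N for tau(x + h). The sum is e
    (A - N): the possibly large N cancels exactly and the mean of the increments is left. Only after
    that is linear growth available and the sigma term negligible. Bounded decrease also acts
    earlier: it makes the improper Laplace integral absolutely convergent, so that Fubini applies
    when the transform is paired with a test function. Being a condition on real functions, it is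
    used for the real and imaginary parts separately, which the identity permits because kappa is
    real. *)

Local Notation Re := complex.Re.
Local Notation Im := complex.Im.

(** * Complex numbers in real coordinates *)

Section ComplexNorm.
Variable R : realType.
Implicit Types z w : R[i].

Lemma norm_normc z : `|z| = (normc z)%:C.
Proof. by rewrite normc_def; case: z. Qed.

Lemma normc_ge0 z : 0 <= normc z.
Proof. by case: z => a b; rewrite /= sqrtr_ge0. Qed.

Lemma ReD z w : Re (z + w) = Re z + Re w. Proof. case: z => a b; case: w => c d. by []. Qed.
Lemma ImD z w : Im (z + w) = Im z + Im w. Proof. by case: z => a b; case: w => c d. Qed.
Lemma ReN z : Re (- z) = - Re z. Proof. by case: z. Qed.
Lemma ImN z : Im (- z) = - Im z. Proof. by case: z. Qed.
Lemma ReB z w : Re (z - w) = Re z - Re w. Proof. by rewrite ReD ReN. Qed.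
Lemma ImB z w : Im (z - w) = Im z - Im w. Proof. by rewrite ImD ImN. Qed.
Lemma ReM z w : Re (z * w) = Re z * Re w - Im z * Im w.
Proof. by case: z => a b; case: w => c d. Qed.
Lemma ImM z w : Im (z * w) = Re z * Im w + Im z * Re w.
Proof. by case: z => a b; case: w => c d. Qed.

Lemma Re_realM (x : R) z : Re (x%:C * z) = x * Re z.
Proof. by case: z => a b /=; rewrite mul0r subr0. Qed.
Lemma Im_realM (x : R) z : Im (x%:C * z) = x * Im z.
Proof. by case: z => a b /=; rewrite mul0r addr0. Qed.

Lemma complexP z w : Re z = Re w -> Im z = Im w -> z = w.
Proof. by case: z => a b; case: w => c d /= -> ->. Qed.

Lemma Re_le_normc z : `|Re z| <= normc z.
Proof.
case: z => a b /=; rewrite -sqrtr_sqr ler_wsqrtr// lerDl sqr_ge0//.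
Qed.

Lemma Im_le_normc z : `|Im z| <= normc z.
Proof.
case: z => a b /=; rewrite -sqrtr_sqr ler_wsqrtr// lerDr sqr_ge0//.
Qed.

Lemma ler_normcD z w : normc (z + w) <= normc z + normc w.
Proof. by have := ler_normD z w; rewrite !norm_normc -rmorphD lecR. Qed.

Lemma normcN z : normc (- z) = normc z.
Proof. by apply: complexI; rewrite -!norm_normc normrN. Qed.

Lemma ler_normcB z w : normc (z - w) <= normc z + normc w.
Proof. by rewrite -(normcN w) ler_normcD. Qed.

Lemma normc_real (x : R) : normc x%:C = `|x|.
Proof. by rewrite /= expr0n/= addr0 sqrtr_sqr. Qed.

Lemma normc_imag (y : R) : normc (0 +i* y) = `|y|.
Proof. by rewrite /normc expr0n/= add0r sqrtr_sqr. Qed.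

Lemma normc_le_ReIm z : normc z <= `|Re z| + `|Im z|.
Proof.
have {1}-> : z = (Re z)%:C + 'i * (Im z)%:C by rewrite -complexE.
apply: (le_trans (ler_normcD _ _)); rewrite normcM !normc_real.
have -> : normc ('i : R[i]) = 1 by rewrite /= expr0n/= expr1n add0r sqrtr1.
by rewrite mul1r.
Qed.

Lemma cexpD z w : cexp (z + w) = cexp z * cexp w.
Proof.
apply: complexP; rewrite /cexp ?ReM ?ImM /= ?ReD ?ImD expRD.
  by rewrite cosD; ring.
by rewrite sinD; ring.
Qed.

Lemma cexp0 : cexp (0 : R[i]) = 1.
Proof. by rewrite /cexp /= expR0 cos0 sin0 !mul1r. Qed.

Lemma normc_cexp z : normc (cexp z) = expR (Re z).
Proof.
rewrite /cexp /= !exprMn -mulrDr cos2Dsin2 mulr1 sqrtr_sqr ger0_norm// expR_ge0.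
Qed.

Lemma cexp_real (x : R) : cexp x%:C = (expR x)%:C.
Proof. by rewrite /cexp /= cos0 sin0 mulr1 mulr0. Qed.

Lemma cexp_split (s : R[i]) : cexp s = (expR (Re s))%:C * cexp (0 +i* Im s).
Proof.
rewrite -cexp_real -cexpD; congr cexp.
by case: s => a b; apply: complexP; rewrite ?ReD ?ImD/= ?addr0 ?add0r.
Qed.

(** The norm of [R[i]^o] takes its values in [R[i]], so each epsilon is a complex number; being
    positive, it is real. Most complex limits below are computed through this reduction. *)
Lemma cvg_complexP (T : Type) (F : set_system T) (FF : Filter F)
    (f : T -> R[i]) (l : R[i]) :
  ((f : T -> R[i]^o) @ F --> (l : R[i]^o)) <->
  (Re (f x) @[x --> F] --> Re l) /\ (Im (f x) @[x --> F] --> Im l).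
Proof.
split=> [fl|[fl1 fl2]].
  split; apply/cvgrPdist_lt => e e0; move/cvgrPdist_lt : fl => /(_ e%:C);
  rewrite ltcR => /(_ e0); apply: filterS => x /=; rewrite -ltcR.
    by apply: le_lt_trans; rewrite -ReB norm_normc lecR Re_le_normc.
  by apply: le_lt_trans; rewrite -ImB norm_normc lecR Im_le_normc.
apply/cvgrPdist_lt => e.
rewrite ltcE/= => /andP[/eqP ime e0].
have e2 : 0 < Re e / 2 by rewrite divr_gt0.
have -> : e = (Re e)%:C by apply: complexP.
move/cvgrPdist_lt : fl1 => /(_ _ e2) fl1; move/cvgrPdist_lt : fl2 => /(_ _ e2) fl2.
near=> x.
rewrite /= norm_normc ltcR (le_lt_trans (normc_le_ReIm _))// ReB ImB [ltRHS]splitr ltrD//.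
  by near: x.
by near: x.
Unshelve. all: by end_near. Qed.

End ComplexNorm.

(** * Measurability of complex-valued functions *)

Section ComplexMeasurable.
Context {R : realType} d {T : measurableType d}.
Implicit Types f g : T -> R[i].

Definition cmeasurable f :=
  measurable_fun setT (fun x => Re (f x)) /\ measurable_fun setT (fun x => Im (f x)).

Lemma cmeasurable_cst (c : R[i]) : cmeasurable (fun=> c).
Proof. by split; exact: measurable_cst. Qed.

Lemma cmeasurable_real (u : T -> R) :
  measurable_fun setT u -> cmeasurable (fun x => (u x)%:C).
Proof. by move=> mu; split => //=; exact: measurable_cst. Qed.

Lemma cmeasurable_ReIm (u v : T -> R) :
  measurable_fun setT u -> measurable_fun setT v -> cmeasurable (fun x => u x +i* v x).
Proof. by []. Qed.

Lemma cmeasurableD f g : cmeasurable f -> cmeasurable g ->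
  cmeasurable (fun x => f x + g x).
Proof.
move=> [f1 f2] [g1 g2]; split.
  by under eq_fun do rewrite ReD; exact: measurable_funD.
by under eq_fun do rewrite ImD; exact: measurable_funD.
Qed.

Lemma cmeasurableN f : cmeasurable f -> cmeasurable (fun x => - f x).
Proof.
move=> [f1 f2]; split.
  by under eq_fun do rewrite ReN; exact: measurableT_comp.
by under eq_fun do rewrite ImN; exact: measurableT_comp.
Qed.

Lemma cmeasurableB f g : cmeasurable f -> cmeasurable g ->
  cmeasurable (fun x => f x - g x).
Proof. by move=> mf mg; apply: cmeasurableD => //; exact: cmeasurableN. Qed.

Lemma cmeasurableM f g : cmeasurable f -> cmeasurable g ->
  cmeasurable (fun x => f x * g x).
Proof.
move=> [f1 f2] [g1 g2]; split.
  under eq_fun do rewrite ReM.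
  by apply: measurable_funB; exact: measurable_funM.
under eq_fun do rewrite ImM.
by apply: measurable_funD; exact: measurable_funM.
Qed.

Lemma cmeasurable_cexp f : cmeasurable f -> cmeasurable (fun x => cexp (f x)).
Proof.
move=> [f1 f2]; split; apply: measurable_funM.
- exact: measurableT_comp.
- by apply: measurableT_comp => //; apply: continuous_measurable_fun; exact: continuous_cos.
- exact: measurableT_comp.
- by apply: measurableT_comp => //; apply: continuous_measurable_fun; exact: continuous_sin.
Qed.

Lemma measurable_normc f : cmeasurable f -> measurable_fun setT (fun x => normc (f x)).
Proof.
move=> [f1 f2].
rewrite (_ : (fun x => _) = (fun x => Num.sqrt (Re (f x) ^+ 2 + Im (f x) ^+ 2))).
  apply: measurableT_comp => //.
    by apply: continuous_measurable_fun; exact: sqrt_continuous.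
  by apply: measurable_funD; apply: measurable_funX.
by apply/funext => x; case: (f x).
Qed.

Lemma cmeasurable_if (b : T -> bool) f g : measurable_fun setT b ->
  cmeasurable f -> cmeasurable g -> cmeasurable (fun x => if b x then f x else g x).
Proof.
move=> mb [f1 f2] [g1 g2]; split.
  rewrite (_ : (fun x => _) = (fun x => if b x then Re (f x) else Re (g x))).
    apply: measurable_fun_ifT => //.
  by apply/funext => x; case: (b x).
rewrite (_ : (fun x => _) = (fun x => if b x then Im (f x) else Im (g x))).
  apply: measurable_fun_ifT => //.
by apply/funext => x; case: (b x).
Qed.

End ComplexMeasurable.

Lemma cmeasurable_comp {R : realType} d d' {T : measurableType d}
    {U : measurableType d'} (f : U -> R[i]) (h : T -> U) :
  cmeasurable f -> measurable_fun setT h -> cmeasurable (fun x => f (h x)).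
Proof.
move=> [f1 f2] mh; split.
  exact: (measurableT_comp f1).
exact: (measurableT_comp f2).
Qed.

(** * Integration on the real line *)

Section RealIntegrals.
Variable R : realType.
Local Notation mu := (@lebesgue_measure R).
Local Notation RT := (measurableTypeR R).
Implicit Types u v w : R -> R.

Definition rintegrable u := mu.-integrable setT (EFin \o u).

Lemma rintegrable_measurable u : rintegrable u -> measurable_fun setT u.
Proof. by move/integrableP => [/measurable_EFinP]. Qed.

Lemma rintegrable_le u v : measurable_fun setT u -> rintegrable v ->
  (forall x, `|u x| <= v x) -> rintegrable u.
Proof.
move=> mu' iv uv; apply: le_integrable iv => //; first exact/measurable_EFinP.
by move=> x _ /=; rewrite lee_fin (le_trans (uv x))// ler_norm.
Qed.

Lemma rintegrable_eq u v : u =1 v -> rintegrable u -> rintegrable v.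
Proof. by move=> /funext ->. Qed.

Lemma rintegrable0 : rintegrable (fun=> 0).
Proof. exact: integrable0. Qed.

Lemma rintegrableD u v : rintegrable u -> rintegrable v ->
  rintegrable (fun x => u x + v x).
Proof. by move=> iu iv; apply: (integrableD measurableT iu iv). Qed.

Lemma rintegrableN u : rintegrable u -> rintegrable (fun x => - u x).
Proof. by move=> iu; apply: (integrableN iu). Qed.

Lemma rintegrableB u v : rintegrable u -> rintegrable v ->
  rintegrable (fun x => u x - v x).
Proof. by move=> iu iv; apply: rintegrableD => //; exact: rintegrableN. Qed.

Lemma rintegrableZ (k : R) u : rintegrable u -> rintegrable (fun x => k * u x).
Proof. by move=> iu; apply: (integrableZl measurableT k iu). Qed.

Lemma rintegrable_norm u : rintegrable u -> rintegrable (fun x => `|u x|).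
Proof. by move=> iu; exact: (integrable_abse iu). Qed.

Lemma rintegrable_itv (a b : R) : rintegrable (\1_(`[a, b]%classic) : R -> R).
Proof. exact: (integrable_indic_itv a b true false). Qed.

Lemma integral_itv_indic (a b : R) : a <= b ->
  \int[mu]_x (\1_(`[a, b]%classic) x : R) = b - a.
Proof.
move=> ab; rewrite /Rintegral integral_indic//= setIT lebesgue_measure_itv/= lte_fin.
case: ifPn => //; rewrite -leNgt => ba.
by rewrite (_ : a = b) ?subrr//; apply/eqP; rewrite eq_le ab ba.
Qed.

Lemma rint_ge0 u : (forall x, 0 <= u x) -> 0 <= \int[mu]_x u x.
Proof. by move=> u0; apply: Rintegral_ge0. Qed.

Lemma rint_le u v : rintegrable u -> rintegrable v -> (forall x, u x <= v x) ->
  \int[mu]_x u x <= \int[mu]_x v x.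
Proof. by move=> iu iv uv; apply: le_Rintegral. Qed.

Lemma rintZ (k : R) u : rintegrable u ->
  \int[mu]_x (k * u x) = k * \int[mu]_x u x.
Proof. by move=> iu; rewrite RintegralZl. Qed.

Lemma rintD u v : rintegrable u -> rintegrable v ->
  \int[mu]_x (u x + v x) = \int[mu]_x u x + \int[mu]_x v x.
Proof. by move=> iu iv; rewrite RintegralD. Qed.

Lemma rintN u : rintegrable u -> \int[mu]_x (- u x) = - \int[mu]_x u x.
Proof.
move=> iu; under eq_Rintegral do rewrite -mulN1r.
by rewrite rintZ// mulN1r.
Qed.

Lemma rint_norm_le u v : measurable_fun setT u -> rintegrable v ->
  (forall x, `|u x| <= v x) -> `|\int[mu]_x u x| <= \int[mu]_x v x.
Proof.
move=> mu' iv uv; have iu := rintegrable_le mu' iv uv.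
apply: (le_trans (le_normr_Rintegral measurableT iu)).
by apply: rint_le => //; exact: rintegrable_norm.
Qed.

(* The domination is required for all sigma > 0 so that every sequence tending to 0+ qualifies. *)
Lemma rint_dominated_right (f : R -> R -> R) (l g : R -> R) :
  (forall s, 0 < s -> measurable_fun setT (f s)) ->
  (forall x, f s x @[s --> 0^'+] --> l x) ->
  rintegrable g ->
  (forall s x, 0 < s -> `|f s x| <= g x) ->
  \int[mu]_x f s x @[s --> 0^'+] --> \int[mu]_x l x.
Proof.
move=> mf fl ig fg; apply/cvg_at_rightP => t [t0 tcvg].
have ml : measurable_fun setT l.
  apply: (@measurable_fun_cvg _ _ _ setT (fun n => f (t n))) => [n|x _].
    exact: mf.
  by have /cvg_at_rightP := fl x; apply.
have [] := @dominated_convergence _ _ _ mu setT measurableT (fun n x => (f (t n) x)%:E)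
   (EFin \o l) (EFin \o g).
- by move=> n; apply/measurable_EFinP; exact: mf.
- exact/measurable_EFinP.
- apply: aeW => x _; apply: cvg_EFin; first exact: nearW.
  by have /cvg_at_rightP := fl x; apply.
- by [].
- by apply: aeW => x n _; rewrite lee_fin; exact: fg.
move=> il _ cv; rewrite /Rintegral; apply: fine_cvg.
rewrite fineK//; exact: integrable_fin_num il.
Qed.

Lemma rint_dominated_seq (f : nat -> R -> R) (l g : R -> R) :
  (forall n, measurable_fun setT (f n)) ->
  (forall x, f n x @[n --> \oo] --> l x) ->
  rintegrable g ->
  (forall n x, `|f n x| <= g x) ->
  rintegrable l /\ \int[mu]_x f n x @[n --> \oo] --> \int[mu]_x l x.
Proof.
move=> mf fl ig fg.
have ml : measurable_fun setT l by apply: (measurable_fun_cvg mf) => x _.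
have [] := @dominated_convergence _ _ _ mu setT measurableT (fun n x => (f n x)%:E)
   (EFin \o l) (EFin \o g).
- by move=> n; apply/measurable_EFinP; exact: mf.
- exact/measurable_EFinP.
- by apply: aeW => x _; apply: cvg_EFin; first exact: nearW; exact: fl.
- by [].
- by apply: aeW => x n _; rewrite lee_fin; exact: fg.
move=> il _ cv; split => //; rewrite /Rintegral; apply: fine_cvg.
rewrite fineK//; exact: integrable_fin_num il.
Qed.

(** Domination by a product of two integrable functions gives integrability on the plane by Tonelli.
    Integrability of the inner integral is returned too, since the value of an [Rintegral] alone
    says nothing about convergence. *)
Lemma rint_fubini (F : R -> R -> R) (a b : R -> R) :
  measurable_fun setT (fun p : RT * RT => F p.1 p.2) ->
  rintegrable a -> rintegrable b ->
  (forall x y, `|F x y| <= a x * b y) ->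
  rintegrable (fun x => \int[mu]_y F x y) /\
  \int[mu]_x (\int[mu]_y F x y) = \int[mu]_y (\int[mu]_x F x y).
Proof.
move=> mF ia ib Fab.
have mF1 x : measurable_fun setT (F x).
  exact: (measurableT_comp (f := fun p : RT * RT => F p.1 p.2) (g := pair x) mF (pair1_measurable x)).
have mF2 y : measurable_fun setT (F ^~ y).
  exact: (measurableT_comp (f := fun p : RT * RT => F p.1 p.2) (g := pair^~ y) mF (pair2_measurable y)).
have iF1 x : rintegrable (F x).
  exact: (rintegrable_le (mF1 x) (rintegrableZ (a x) ib)).
have iF2 y : rintegrable (F ^~ y).
  apply: (rintegrable_le (mF2 y) (rintegrableZ (b y) ia)) => x.
  by rewrite mulrC.
have iF : (mu \x mu)%E.-integrable setT (fun p : RT * RT => (F p.1 p.2)%:E).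
  apply/integrable12ltyP => /=; first exact/measurable_EFinP.
  have /integrableP[_] := rintegrable_norm ia.
  have /integrableP[_] := rintegrable_norm ib.
  set B := (X in (X < +oo)%E -> _); set A := (X in (X < +oo)%E -> _) => Boo Aoo.
  apply: (@le_lt_trans _ _ (\int[mu]_x ((`|a x|)%:E * B))%E).
    apply: ge0_le_integral => //.
    - by move=> x _; exact: integral_ge0.
    - apply: (@measurable_fun_fubini_tonelli_F _ _ _ _ _ _ (fun p : RT * RT => (`|F p.1 p.2|)%:E)) => //.
      by apply/measurable_EFinP; exact: measurableT_comp.
    - apply: emeasurable_funM; last exact: measurable_cst.
      by apply/measurable_EFinP; exact: rintegrable_measurable (rintegrable_norm ia).
    - move=> x _.
      rewrite -ge0_integralZl//=; last first.
        do 2 apply/measurableT_comp => //.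
        by apply/measurableT_comp => //; exact: rintegrable_measurable.
      apply: ge0_le_integral => //.
      - by apply/measurable_EFinP; apply: measurableT_comp => //; exact: mF1.
      - apply: emeasurable_funM; first exact: measurable_cst.
        apply/measurable_EFinP; do 2 apply: measurableT_comp => //.
        exact: rintegrable_measurable.
      - move=> y _; rewrite -EFinM lee_fin (le_trans (Fab x y))//.
        by rewrite normr_id -normrM ler_norm.
  rewrite ge0_integralZr//; last first.
  - by apply: integral_ge0.
  - by apply/measurable_EFinP; exact: rintegrable_measurable (rintegrable_norm ia).
  rewrite -ge0_fin_numE; last first.
    by rewrite mule_ge0//; apply: integral_ge0.
  rewrite fin_numM//; last by rewrite ge0_fin_numE//; apply: integral_ge0.
  rewrite ge0_fin_numE; last by apply: integral_ge0.
  rewrite (le_lt_trans _ Aoo)// /A le_eqVlt; apply/orP; left; apply/eqP.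
  by apply: eq_integral => x _ /=; rewrite normr_id.
have E1 x : (\int[mu]_y F x y)%:E = (\int[mu]_y (F x y)%:E)%E.
  by rewrite /Rintegral fineK//; exact: integrable_fin_num (iF1 x).
have E2 y : (\int[mu]_x F x y)%:E = (\int[mu]_x (F x y)%:E)%E.
  by rewrite /Rintegral fineK//; exact: integrable_fin_num (iF2 y).
split.
  rewrite /rintegrable (_ : _ \o _ = fun x => (\int[mu]_y (F x y)%:E)%E); last first.
    by apply/funext => x /=; rewrite E1.
  exact: (integrable_fubini_F iF).
rewrite {1}[in LHS]/Rintegral; under eq_integral do rewrite E1.
rewrite {1}[in RHS]/Rintegral; under [in RHS]eq_integral do rewrite E2.
by congr fine; rewrite (Fubini iF).
Qed.

Lemma shift_measurable (a : R) : measurable_fun setT (fun x : RT => (x + a : RT)).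
Proof. by apply: measurable_funD => //; exact: measurable_cst. Qed.

Lemma opp_measurable : measurable_fun setT (fun x : RT => (- x : RT)).
Proof. by apply: (measurable_funN); exact: measurable_id. Qed.

(** Lebesgue measure is determined by its values on half-open intervals, and a translation carries
    these to half-open intervals of the same length. *)
Lemma lebesgue_measure_shift (a : R) (A : set R) : measurable A ->
  pushforward mu (fun x : RT => (x + a : RT)) A = mu A.
Proof.
move=> mA; apply/esym.
pose f := mfun_Sub (mem_set (shift_measurable a)) : {mfun RT >-> RT}.
apply: (lebesgue_measure_unique (mu := pushforward mu f)) => // _ [[c b]] _ <-.
have E : (fun x : RT => (x + a : RT)) @^-1` `]c, b]%classic = `]c - a, b - a]%classic.
  by apply/seteqP; split => x /=; rewrite !in_itv/= ltrBlDr lerBrDr.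
transitivity (mu (`]c - a, b - a]%classic : set R)); last by rewrite -E.
rewrite !lebesgue_measure_itv/= !lte_fin ltrD2r.
by case: ifP => // _; rewrite -!EFinB; congr EFin; ring.
Qed.

Lemma rintegrable_shift (a : R) u : rintegrable u -> rintegrable (fun x => u (x + a)).
Proof.
move=> iu; have mu' := rintegrable_measurable iu.
apply/integrableP; split.
  by apply/measurable_EFinP; apply: (measurableT_comp mu'); exact: shift_measurable.
have /integrableP[_] := iu; apply: le_lt_trans.
rewrite le_eqVlt; apply/orP; left; apply/eqP; apply/esym.
rewrite -(@ge0_integral_pushforward _ _ _ _ _ _ (shift_measurable a) mu setT
   (fun x => `|(u x)%:E|%E))//.
  by apply: eq_measure_integral => [|? B mB _]; [exact: shift_measurable|exact/esym/lebesgue_measure_shift].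
by apply: measurableT_comp => //; exact/measurable_EFinP.
Qed.

Lemma rint_shift (a : R) u : rintegrable u -> \int[mu]_x u (x + a) = \int[mu]_x u x.
Proof.
move=> iu; have mu' := rintegrable_measurable iu.
rewrite /Rintegral; congr fine.
have := @integral_pushforward _ _ _ _ _ _ (shift_measurable a) mu setT (EFin \o u).
move=> <-//.
- by apply: eq_measure_integral => [|? B mB _]; [exact: shift_measurable|exact: lebesgue_measure_shift].
- exact/measurable_EFinP.
- exact: (rintegrable_shift a iu).
Qed.

Lemma rintegrable_opp u : rintegrable u -> rintegrable (fun x => u (- x)).
Proof.
move=> iu; have mu' := rintegrable_measurable iu.
apply/integrableP; split.
  by apply/measurable_EFinP; apply: (measurableT_comp mu'); exact: opp_measurable.
have /integrableP[_] := iu; apply: le_lt_trans.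
rewrite le_eqVlt; apply/orP; left; apply/eqP; apply/esym.
rewrite -(@ge0_integral_pushforward _ _ _ _ _ _ opp_measurable mu setT
   (fun x => `|(u x)%:E|%E))//.
  by apply: eq_measure_integral => [|? B mB _]; [exact: opp_measurable|exact/esym/lebesgue_measureN].
by apply: measurableT_comp => //; exact/measurable_EFinP.
Qed.

Lemma rint_opp u : rintegrable u -> \int[mu]_x u (- x) = \int[mu]_x u x.
Proof.
move=> iu; have mu' := rintegrable_measurable iu.
rewrite /Rintegral; congr fine.
have := @integral_pushforward _ _ _ _ _ _ opp_measurable mu setT (EFin \o u).
move=> <-//.
- by apply: eq_measure_integral => [|? B mB _]; [exact: opp_measurable|exact: lebesgue_measureN].
- exact/measurable_EFinP.
- exact: (rintegrable_opp iu).
Qed.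

End RealIntegrals.

(** * Integrals of complex-valued functions *)

Section ComplexIntegral.
Variable R : realType.
Local Notation mu := (@lebesgue_measure R).
Local Notation RT := (measurableTypeR R).
Implicit Types f g : R -> R[i].

Definition cintegrable f :=
  rintegrable (fun x => Re (f x)) /\ rintegrable (fun x => Im (f x)).

Lemma Re_cint f : Re (cint setT f) = \int[mu]_x Re (f x). Proof. by []. Qed.
Lemma Im_cint f : Im (cint setT f) = \int[mu]_x Im (f x). Proof. by []. Qed.

Lemma cint_indic (D : set R) f : cint D f = cint setT (fun x => (\1_D x)%:C * f x).
Proof.
rewrite /cint !(Rintegral_mkcond mu D).
by congr (_ +i* _); apply: eq_Rintegral => x _; rewrite ?Re_realM ?Im_realM
  patchE indicE; case: (x \in D); rewrite ?mul1r ?mul0r.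
Qed.

Lemma eq_cint f g : f =1 g -> cint setT f = cint setT g.
Proof. by move=> /funext ->. Qed.

Lemma cintegrable_measurable f : cintegrable f -> @cmeasurable R _ RT f.
Proof. by move=> [f1 f2]; split; exact: rintegrable_measurable. Qed.

Lemma cintegrable_le f (u : R -> R) : @cmeasurable R _ RT f -> rintegrable u ->
  (forall x, normc (f x) <= u x) -> cintegrable f.
Proof.
move=> [mf1 mf2] iu fu; split; apply: rintegrable_le iu _ => // x;
  apply: le_trans (fu x); [exact: Re_le_normc | exact: Im_le_normc].
Qed.

Lemma cintegrable_normc f : cintegrable f -> rintegrable (fun x => normc (f x)).
Proof.
move=> [f1 f2]; have mf := cintegrable_measurable (conj f1 f2).
apply: (@rintegrable_le _ _ (fun x => `|Re (f x)| + `|Im (f x)|)).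
- exact: measurable_normc.
- by apply: rintegrableD; exact: rintegrable_norm.
- by move=> x; rewrite ger0_norm ?normc_ge0// normc_le_ReIm.
Qed.

Lemma cintegrable_eq f g : f =1 g -> cintegrable f -> cintegrable g.
Proof. by move=> /funext ->. Qed.

Lemma cintegrable_real (u : R -> R) : rintegrable u -> cintegrable (fun x => (u x)%:C).
Proof. by move=> iu; split => //=; exact: rintegrable0. Qed.

Lemma cintegrableD f g : cintegrable f -> cintegrable g ->
  cintegrable (fun x => f x + g x).
Proof.
move=> [f1 f2] [g1 g2]; split.
  by apply: (rintegrable_eq _ (rintegrableD f1 g1)) => x; rewrite ReD.
by apply: (rintegrable_eq _ (rintegrableD f2 g2)) => x; rewrite ImD.
Qed.

Lemma cintegrableZ (c : R[i]) f : cintegrable f -> cintegrable (fun x => c * f x).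
Proof.
move=> [f1 f2]; split.
  apply: (rintegrable_eq _ (rintegrableB (rintegrableZ (Re c) f1) (rintegrableZ (Im c) f2))).
  by move=> x; rewrite ReM.
apply: (rintegrable_eq _ (rintegrableD (rintegrableZ (Re c) f2) (rintegrableZ (Im c) f1))).
by move=> x; rewrite ImM.
Qed.

Lemma cintegrableN f : cintegrable f -> cintegrable (fun x => - f x).
Proof.
move=> [f1 f2]; split.
  by apply: (rintegrable_eq _ (rintegrableN f1)) => x; rewrite ReN.
by apply: (rintegrable_eq _ (rintegrableN f2)) => x; rewrite ImN.
Qed.

Lemma cintegrableB f g : cintegrable f -> cintegrable g ->
  cintegrable (fun x => f x - g x).
Proof. by move=> i1 i2; apply: cintegrableD => //; exact: cintegrableN. Qed.

Lemma cintegrable_bddM f g (M : R) : @cmeasurable R _ RT g -> (forall x, normc (g x) <= M) ->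
  cintegrable f -> cintegrable (fun x => g x * f x).
Proof.
move=> mg gM i_f; apply: (@cintegrable_le _ (fun x => M * normc (f x))).
- by apply: cmeasurableM => //; exact: cintegrable_measurable.
- by apply: rintegrableZ; exact: cintegrable_normc.
- by move=> x; rewrite normcM ler_wpM2r ?normc_ge0.
Qed.

Lemma cintD f g : cintegrable f -> cintegrable g ->
  cint setT (fun x => f x + g x) = cint setT f + cint setT g.
Proof.
move=> [f1 f2] [g1 g2]; apply: complexP; rewrite ?ReD ?ImD !(Re_cint, Im_cint).
  by under eq_Rintegral do rewrite ReD; rewrite rintD.
by under eq_Rintegral do rewrite ImD; rewrite rintD.
Qed.

Lemma cintZ (c : R[i]) f : cintegrable f ->
  cint setT (fun x => c * f x) = c * cint setT f.
Proof.
move=> [f1 f2]; apply: complexP; rewrite ?ReM ?ImM !(Re_cint, Im_cint).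
  under eq_Rintegral do rewrite ReM -mulNr.
  by rewrite rintD ?rintZ ?mulNr//; exact: rintegrableZ.
under eq_Rintegral do rewrite ImM.
by rewrite rintD ?rintZ//; exact: rintegrableZ.
Qed.

Lemma cintN f : cintegrable f -> cint setT (fun x => - f x) = - cint setT f.
Proof.
move=> i_f; rewrite -mulN1r -cintZ//; apply: eq_cint => x; by rewrite mulN1r.
Qed.

Lemma cintB f g : cintegrable f -> cintegrable g ->
  cint setT (fun x => f x - g x) = cint setT f - cint setT g.
Proof.
by move=> i1 i2; rewrite cintD ?cintN//; exact: cintegrableN.
Qed.

Lemma cint_real (u : R -> R) : cint setT (fun x => (u x)%:C) = (\int[mu]_x u x)%:C.
Proof.
by apply: complexP; rewrite ?Re_cint ?Im_cint //= /Rintegral integral0.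
Qed.

(* The factor 2 spares the rotation argument behind the sharp inequality. *)
Lemma normc_cint_le f (u : R -> R) : @cmeasurable R _ RT f -> rintegrable u ->
  (forall x, normc (f x) <= u x) -> normc (cint setT f) <= 2 * \int[mu]_x u x.
Proof.
move=> [mf1 mf2] iu fu; apply: (le_trans (normc_le_ReIm _)).
rewrite mulr2n mulrDl mul1r lerD// (Re_cint, Im_cint) rint_norm_le// => x;
  apply: le_trans (fu x); [exact: Re_le_normc | exact: Im_le_normc].
Qed.

Lemma cint_dominated_right (f : R -> R -> R[i]) (l : R -> R[i]) (g : R -> R) :
  (forall s, 0 < s -> @cmeasurable R _ RT (f s)) ->
  (forall x, (f ^~ x : R -> R[i]^o) @ 0^'+ --> (l x : R[i]^o)) ->
  rintegrable g ->
  (forall s x, 0 < s -> normc (f s x) <= g x) ->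
  ((fun s => cint setT (f s)) : R -> R[i]^o) @ 0^'+ --> (cint setT l : R[i]^o).
Proof.
move=> mf fl ig fg; apply/cvg_complexP; split; apply: rint_dominated_right ig _.
- by move=> s /mf[].
- by move=> x; have /cvg_complexP[] := fl x.
- by move=> s x s0; apply: le_trans (fg s x s0); exact: Re_le_normc.
- by move=> s /mf[].
- by move=> x; have /cvg_complexP[] := fl x.
- by move=> s x s0; apply: le_trans (fg s x s0); exact: Im_le_normc.
Qed.

Lemma cint_fubini (F : R -> R -> R[i]) (a b : R -> R) :
  @cmeasurable R _ (RT * RT)%type (fun p => F p.1 p.2) ->
  rintegrable a -> rintegrable b ->
  (forall x y, normc (F x y) <= a x * b y) ->
  cintegrable (fun x => cint setT (F x)) /\
  cint setT (fun x => cint setT (F x)) = cint setT (fun y => cint setT (F ^~ y)).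
Proof.
move=> [mF1 mF2] ia ib Fab.
have [i1 e1] := rint_fubini mF1 ia ib
  (fun x y => le_trans (Re_le_normc _) (Fab x y)).
have [i2 e2] := rint_fubini mF2 ia ib
  (fun x y => le_trans (Im_le_normc _) (Fab x y)).
split; first by split.
by apply: complexP; [exact: e1|exact: e2].
Qed.

Lemma cintegrable_shift (a : R) f : cintegrable f -> cintegrable (fun x => f (x + a)).
Proof.
move=> [i1 i2]; split; [exact: (rintegrable_shift a i1) | exact: (rintegrable_shift a i2)].
Qed.

Lemma cint_shift (a : R) f : cintegrable f -> cint setT (fun x => f (x + a)) = cint setT f.
Proof.
move=> [i1 i2]; apply: complexP; rewrite ?Re_cint ?Im_cint;
  [exact: (rint_shift a i1) | exact: (rint_shift a i2)].
Qed.

Lemma cintegrable_opp f : cintegrable f -> cintegrable (fun x => f (- x)).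
Proof.
move=> [i1 i2]; split; [exact: (rintegrable_opp i1) | exact: (rintegrable_opp i2)].
Qed.

Lemma cint_opp f : cintegrable f -> cint setT (fun x => f (- x)) = cint setT f.
Proof.
move=> [i1 i2]; apply: complexP; rewrite ?Re_cint ?Im_cint;
  [exact: (rint_opp i1) | exact: (rint_opp i2)].
Qed.

Lemma cint_aeeq f g : @cmeasurable R _ RT f -> @cmeasurable R _ RT g ->
  {ae mu, forall x, f x = g x} -> cint setT f = cint setT g.
Proof.
move=> [f1 f2] [g1 g2] [N [mN N0 Nfg]]; apply: complexP; rewrite ?Re_cint ?Im_cint /Rintegral;
  congr fine; apply: ae_eq_integral => //; try exact/measurable_EFinP;
  by exists N; split => //; apply: subset_trans Nfg => x /= h fgx; apply: h; rewrite fgx.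
Qed.

(** The standard majorant of the development: decay of order two is expressed as a multiple of this
    function. By symmetry its integral is twice the known one over the half-line. *)
Lemma rintegrable_oneDsqrV : rintegrable (fun x : R => (1 + x ^+ 2)^-1).
Proof.
have mo : measurable_fun setT (fun x : RT => (1 + x ^+ 2)^-1).
  by apply: continuous_measurable_fun; exact: continuous_oneDsqrV.
apply/integrableP; split; first exact/measurable_EFinP.
have E : (\int[mu]_x ((1 + x ^+ 2)^-1)%:E = 2 * \int[mu]_(x in [set x | (0 <= x)%R]) ((1 + x ^+ 2)^-1)%:E)%E.
  apply: (@ge0_symfun_integralT R (fun x => (1 + x ^+ 2)^-1)).
  - by move=> x; rewrite invr_ge0 addr_ge0// sqr_ge0.
  - exact: continuous_oneDsqrV.
  - by move=> x /=; rewrite sqrrN.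
rewrite (eq_integral (fun x : RT => ((1 + x ^+ 2)^-1)%:E)); last first.
  by move=> x _ /=; rewrite ger0_norm// invr_ge0 addr_ge0// sqr_ge0.
rewrite E.
have -> : [set x : R | 0 <= x] = `[0, +oo[%classic.
  by apply/seteqP; split => x /=; rewrite in_itv/= andbT.
have := integral0y_oneDsqr R; rewrite /oneDsqr => ->.
by rewrite -EFinM ltry.
Qed.

Lemma measurable_indic_itv (a b : R) : measurable_fun setT (\1_(`[a, b]%classic : set RT) : RT -> R).
Proof. exact: measurable_indic. Qed.

End ComplexIntegral.

(** * Smooth functions *)

Section SmoothReal.
Variable R : realType.
Implicit Types (u v : R -> R) (n : nat).

Lemma is_derive_derivable u (x d : R) : is_derive x 1 u d -> derivable u x 1.
Proof. by case. Qed.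

Lemma is_derive_derive1 u (x d : R) : is_derive x 1 u d -> derive1 u x = d.
Proof. by move=> h; rewrite derive1E; exact: derive_val. Qed.

Lemma derivable_is_derive u (x : R) : derivable u x 1 -> is_derive x 1 u (derive1 u x).
Proof. by move=> h; rewrite derive1E; exact: DeriveDef. Qed.

Lemma is_derive_eq1 u (x d d' : R) : is_derive x 1 u d -> d = d' -> is_derive x 1 u d'.
Proof. by move=> h <-. Qed.

Lemma is_derive_fD u v (x du dv : R) : is_derive x 1 u du -> is_derive x 1 v dv ->
  is_derive x 1 (fun y => u y + v y) (du + dv).
Proof. by move=> hu hv; exact: (is_deriveD hu hv). Qed.

Lemma is_derive_fM u v (x du dv : R) : is_derive x 1 u du -> is_derive x 1 v dv ->
  is_derive x 1 (fun y => u y * v y) (du * v x + u x * dv).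
Proof.
by move=> hu hv; apply: (is_derive_eq1 (is_deriveM hu hv)); rewrite addrC mulrC.
Qed.

Lemma is_derive_fZ u (k x du : R) : is_derive x 1 u du ->
  is_derive x 1 (fun y => k * u y) (k * du).
Proof. by move=> hu; exact: (is_deriveZ k hu). Qed.

Lemma is_derive_fN u (x du : R) : is_derive x 1 u du ->
  is_derive x 1 (fun y => - u y) (- du).
Proof. by move=> hu; exact: (is_deriveN hu). Qed.

(** Regularity is recorded by recursion on the first derivative and includes all lower orders, so
    that the product rule feeds an induction: the derivative of a product is a sum of products of
    functions of the lower order. Level n stands for n + 1 derivatives. *)
Fixpoint n_derivable n u : Prop :=
  match n with
  | 0 => forall x : R, derivable u x 1
  | m.+1 => (forall x : R, derivable u x 1) /\ n_derivable m (derive1 u)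
  end.

Lemma n_derivable1 n u : n_derivable n u -> forall x : R, derivable u x 1.
Proof. by case: n => [|n] //= []. Qed.

Lemma n_derivableW n u : n_derivable n.+1 u -> n_derivable n u.
Proof. by elim: n u => [|n IH] u /= [] // du [? ?]; split => //; apply: IH. Qed.

Lemma rderive_nS n u : rderive_n n.+1 u = rderive_n n (derive1 u).
Proof. by rewrite /rderive_n iterSr. Qed.

Lemma smooth_realP u : smooth_real u <-> forall n, n_derivable n u.
Proof.
split=> [su n|du n x].
  elim: n u su => [|n IH] u su; first exact: (su 0%N).
  split; first exact: (su 0%N).
  by apply: IH => k x; have := su k.+1 x; rewrite rderive_nS.
elim: n u du => [|n IH] u du; first exact: (du 0%N).
by rewrite rderive_nS; apply: IH => k; have [] := du k.+1.
Qed.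

Lemma smooth_real_derivable u : smooth_real u -> forall x : R, derivable u x 1.
Proof. by move/(_ 0%N). Qed.

Lemma smooth_real_derive1 u : smooth_real u -> smooth_real (derive1 u).
Proof. by move=> su n x; have := su n.+1 x; rewrite rderive_nS. Qed.

Lemma smooth_real_continuous u : smooth_real u -> continuous u.
Proof.
move=> su x; apply: differentiable_continuous; apply/derivable1_diffP.
exact: smooth_real_derivable.
Qed.

(** Each differentiation stays inside the class [P], so a family given in closed form (constants,
    affine substitutions, Fourier transforms) is smooth once it is stable under one derivative. *)
Lemma smooth_real_ind (P : (R -> R) -> Prop) :
  (forall u, P u -> (forall x : R, derivable u x 1) /\ P (derive1 u)) ->
  forall u, P u -> smooth_real u.
Proof.
move=> HP u Pu n x; elim: n u Pu x => [|n IH] u Pu x; first by have [] := HP u Pu.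
by rewrite rderive_nS; apply: IH; have [] := HP u Pu.
Qed.

Lemma smooth_real_cst (c : R) : smooth_real (fun=> c).
Proof.
apply: (@smooth_real_ind (fun u => exists c : R, u = fun=> c)); last by exists c.
move=> u [k ->]; split; first by move=> x; exact: derivable_cst.
exists 0; apply/funext => x; rewrite derive1E; exact: derive_cst.
Qed.

Lemma smooth_real_id : smooth_real (fun x : R => x).
Proof.
case=> [|n] x; first exact: derivable_id.
rewrite rderive_nS (_ : derive1 _ = (fun=> 1 : R)); first exact: smooth_real_cst.
by apply/funext => y; rewrite derive1E; exact: derive_id.
Qed.

Lemma n_derivableD n u v : n_derivable n u -> n_derivable n v ->
  n_derivable n (fun x => u x + v x).
Proof.
elim: n u v => [|n IH] u v.
  by move=> du dv x; exact: derivableD.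
move=> [du Du] [dv Dv]; split; first by move=> x; exact: derivableD.
rewrite (_ : derive1 _ = fun x => derive1 u x + derive1 v x); first exact: IH.
by apply/funext => x; rewrite !derive1E; exact: deriveD.
Qed.

Lemma n_derivableM n u v : n_derivable n u -> n_derivable n v ->
  n_derivable n (fun x => u x * v x).
Proof.
elim: n u v => [|n IH] u v.
  by move=> du dv x; exact: derivableM.
move=> Du Dv; have du := n_derivable1 Du; have dv := n_derivable1 Dv.
split; first by move=> x; exact: derivableM.
rewrite (_ : derive1 _ = fun x => u x * derive1 v x + v x * derive1 u x).
  apply: n_derivableD; apply: IH.
  - exact: n_derivableW.
  - by case: Dv.
  - exact: n_derivableW.
  - by case: Du.
by apply/funext => x; rewrite !derive1E; exact: deriveM.
Qed.

Lemma smooth_realD u v : smooth_real u -> smooth_real v -> smooth_real (fun x => u x + v x).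
Proof. by move=> /smooth_realP su /smooth_realP sv; apply/smooth_realP => n; exact: n_derivableD. Qed.

Lemma smooth_realM u v : smooth_real u -> smooth_real v -> smooth_real (fun x => u x * v x).
Proof. by move=> /smooth_realP su /smooth_realP sv; apply/smooth_realP => n; exact: n_derivableM. Qed.

Lemma smooth_realN u : smooth_real u -> smooth_real (fun x => - u x).
Proof.
move=> su; rewrite (_ : (fun x => _) = fun x => (-1) * u x).
  by apply: smooth_realM; [exact: smooth_real_cst|exact: su].
by apply/funext => x; rewrite mulN1r.
Qed.

Lemma smooth_realB u v : smooth_real u -> smooth_real v -> smooth_real (fun x => u x - v x).
Proof. by move=> su sv; apply: smooth_realD; [exact: su|exact: smooth_realN]. Qed.

Lemma is_derive_affine u (a b x d : R) : is_derive (a * x + b) 1 u d ->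
  is_derive x 1 (fun y => u (a * y + b)) (a * d).
Proof.
move=> h.
have h1 : is_derive x 1 (fun y : R => a * y + b) a.
  rewrite (_ : (fun y => _) = (a \*: id) + cst b); last by [].
  by apply: is_derive_eq; rewrite addr0 /GRing.scale/= mulr1.
have := @is_derive1_comp R u (fun y => a * y + b) x d a h h1.
by rewrite mulrC.
Qed.

Lemma smooth_real_affine u (a b : R) : smooth_real u -> smooth_real (fun x => u (a * x + b)).
Proof.
(* The chain rule produces a factor a at each order; the free scalar k absorbs it and makes the
   family stable under differentiation. *)
move=> su; suff H : forall k : R, smooth_real (fun x => k * u (a * x + b)).
  by have := H 1; under eq_fun do rewrite mul1r.
move=> k; apply: (@smooth_real_ind (fun v => exists k w, smooth_real w /\ v = fun x => k * w (a * x + b))); last by exists k, u.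
move=> v [k' [w [sw ->]]].
have D (x : R) : is_derive x 1 (fun x : R => k' * w (a * x + b)) (k' * (a * derive1 w (a * x + b))).
  have := @is_derive_affine w a b x _ (derivable_is_derive (smooth_real_derivable sw (x := a * x + b))).
  exact: is_derive_fZ.
split; first by move=> x; exact: is_derive_derivable (D x).
exists (k' * a), (derive1 w); split; first exact: smooth_real_derive1.
by apply/funext => x; rewrite (is_derive_derive1 (D x)) mulrA.
Qed.

Lemma smooth_real_opp u : smooth_real u -> smooth_real (fun x => u (- x)).
Proof.
move=> su; have h := smooth_real_affine (a := -1) (b := 0) su; rewrite (_ : (fun x => _) = fun x => u (-1 * x + 0))//.
by apply/funext => x; rewrite addr0 mulN1r.
Qed.

End SmoothReal.

Section SmoothComplex.
Variable R : realType.
Local Notation RT := (measurableTypeR R).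
Implicit Types f g : R -> R[i].

Definition cderive f (x : R) : R[i] :=
  (derive1 (fun y => Re (f y)) x) +i* (derive1 (fun y => Im (f y)) x).

Lemma smooth_cderive f : smooth f -> smooth (cderive f).
Proof. by move=> [s1 s2]; split; [exact: smooth_real_derive1 s1|exact: smooth_real_derive1 s2]. Qed.

Lemma smooth_cst (c : R[i]) : smooth (fun=> c).
Proof. by split; exact: smooth_real_cst. Qed.

Lemma smooth_real_complex (u : R -> R) : smooth_real u -> smooth (fun x => (u x)%:C).
Proof. by move=> su; split; [exact: su|exact: smooth_real_cst]. Qed.

Lemma smoothM f g : smooth f -> smooth g -> smooth (fun x => f x * g x).
Proof.
move=> [f1 f2] [g1 g2]; split.
  under eq_fun do rewrite ReM.
  by apply: smooth_realB; exact: smooth_realM.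
under eq_fun do rewrite ImM.
by apply: smooth_realD; exact: smooth_realM.
Qed.

Lemma smooth_opp f : smooth f -> smooth (fun x => f (- x)).
Proof. by move=> [s1 s2]; split; [exact: smooth_real_opp s1 | exact: smooth_real_opp s2]. Qed.

Lemma smooth_cmeasurable f : smooth f -> @cmeasurable R _ RT f.
Proof. by move=> [s1 s2]; split; apply: continuous_measurable_fun; [exact: smooth_real_continuous s1|exact: smooth_real_continuous s2]. Qed.

End SmoothComplex.

(** * Schwartz functions and compactly supported test functions *)

Section SchwartzTest.
Variable R : realType.
Local Notation RT := (measurableTypeR R).
Implicit Types phi psi : R -> R[i].

Lemma schwartz_cderive phi : schwartz phi -> schwartz (cderive phi).
Proof.
move=> [sphi bphi]; split; first exact: smooth_cderive.
by move=> k n; have [K HK] := bphi k n.+1; exists K => x; have := HK x; rewrite !rderive_nS.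
Qed.

Lemma derive1_zero_open (u : R -> R) (a b x : R) : a < x < b ->
  (forall y, a < y < b -> u y = 0) -> derive1 u x = 0.
Proof.
move=> /andP[ax xb] u0; rewrite derive1E.
have -> : 'D_1 u x = 'D_1 (fun=> 0 : R) x; last exact: derive_cst.
apply: near_eq_derive.
near=> y; apply: u0; apply/andP; split.
  by near: y; exact: lt_nbhsr.
by near: y; exact: lt_nbhsl.
Unshelve. all: by end_near. Qed.

Lemma derive1_outside (u : R -> R) (c d : R) : (forall x, x < c \/ d < x -> u x = 0) ->
  forall x, x < c \/ d < x -> derive1 u x = 0.
Proof.
move=> u0 x [xc|dx].
  apply: (@derive1_zero_open _ (x - 1) c) => [|y /andP[_ yc]]; last by apply: u0; left.
  by rewrite xc ltrBlDr ltrDl ltr01.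
apply: (@derive1_zero_open _ d (x + 1)) => [|y /andP[dy _]]; last by apply: u0; right.
by rewrite dx ltrDl ltr01.
Qed.

Lemma rderive_n_outside (u : R -> R) (c d : R) n : (forall x, x < c \/ d < x -> u x = 0) ->
  forall x, x < c \/ d < x -> rderive_n n u x = 0.
Proof.
elim: n u => [//|n IH] u u0; rewrite rderive_nS; apply: IH; exact: derive1_outside.
Qed.

Lemma test_fun_W (a b a' b' : R) phi : a' <= a -> b <= b' -> test_fun a b phi -> test_fun a' b' phi.
Proof.
move=> aa bb [sphi [c [d [ac db p0]]]]; split => //; exists c, d; split => //.
  exact: le_lt_trans ac.
exact: lt_le_trans bb.
Qed.

Lemma test_fun_cderive (a b : R) phi : test_fun a b phi -> test_fun a b (cderive phi).
Proof.
move=> [sphi [c [d [ac db p0]]]]; split; first exact: smooth_cderive.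
exists c, d; split => // x xcd; rewrite /cderive.
by rewrite !(derive1_outside (c := c) (d := d))// => y /p0 ->.
Qed.

Lemma test_funM (a b : R) phi psi : test_fun a b phi -> smooth psi ->
  test_fun a b (fun x => psi x * phi x).
Proof.
move=> [sphi [c [d [ac db p0]]]] spsi; split; first exact: smoothM.
by exists c, d; split => // x /p0 ->; rewrite mulr0.
Qed.

Lemma test_fun_opp (a b : R) phi : test_fun a b phi -> test_fun (- b) (- a) (fun x => phi (- x)).
Proof.
move=> [sphi [c [d [ac db p0]]]]; split; first exact: smooth_opp.
exists (- d), (- c); split; rewrite ?ltrN2// => x [xd|cx]; apply: p0.
  by right; rewrite ltrNr.
by left; rewrite ltrNl.
Qed.

Lemma continuous_outside_bounded (u : R -> R) (c d : R) : continuous u ->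
  (forall x, x < c \/ d < x -> u x = 0) -> exists K, forall x, `|u x| <= K.
Proof.
move=> cu u0; have [cd|dc] := leP c d; last first.
  exists 0 => x; rewrite u0 ?normr0//.
  by have [xc|cx] := ltP x c; [left|right; exact: lt_le_trans cx].
have cnu : {within `[c, d], continuous (fun x => `|u x|)}.
  apply: continuous_subspaceT => x; apply: continuous_comp; first exact: cu.
  exact: norm_continuous.
have [m _ Hm] := EVT_max cd cnu.
exists `|u m| => x.
have [xc|cx] := ltP x c; first by rewrite u0 ?normr0//; left.
have [dx|xd] := ltP d x; first by rewrite u0 ?normr0//; right.
by apply: Hm; rewrite in_itv/= cx.
Qed.

Lemma smooth_real_rderive_n (u : R -> R) n : smooth_real u -> smooth_real (rderive_n n u).
Proof.
elim: n u => [//|n IH] u su; rewrite rderive_nS; apply: IH; exact: smooth_real_derive1.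
Qed.

Lemma smooth_realX k : smooth_real (fun x : R => x ^+ k).
Proof.
elim: k => [|k IH]; first exact: smooth_real_cst.
under eq_fun do rewrite exprS.
by apply: smooth_realM; [exact: smooth_real_id|exact: IH].
Qed.

Lemma test_fun_schwartz (a b : R) phi : test_fun a b phi -> schwartz phi.
Proof.
move=> [sphi [c [d [ac db p0]]]]; split => // k n.
have B (u : R -> R) : smooth_real u -> (forall x, x < c \/ d < x -> u x = 0) ->
    exists K, forall x, `|x ^+ k * rderive_n n u x| <= K.
  move=> su u0; apply: (@continuous_outside_bounded _ c d).
    apply: smooth_real_continuous; apply: smooth_realM; first exact: smooth_realX.
    exact: smooth_real_rderive_n.
  by move=> x xcd; rewrite (rderive_n_outside n u0 xcd) mulr0.
have [K1 H1] := B _ sphi.1 (fun x h => congr1 (@complex.Re R) (p0 x h)).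
have [K2 H2] := B _ sphi.2 (fun x h => congr1 (@complex.Im R) (p0 x h)).
exists (Num.max K1 K2) => x; split; [apply: le_trans (H1 x) _|apply: le_trans (H2 x) _].
  by rewrite le_max lexx.
by rewrite le_max lexx orbT.
Qed.

End SchwartzTest.

(** * Calculus for complex-valued functions of a real variable *)

Section ComplexDerivative.
Variable R : realType.
Local Notation mu := (@lebesgue_measure R).
Local Notation RT := (measurableTypeR R).
Implicit Types f g F : R -> R[i].

Definition cis_derive f (x : R) (d : R[i]) :=
  is_derive x 1 (fun y => Re (f y)) (Re d) /\ is_derive x 1 (fun y => Im (f y)) (Im d).

Definition ccontinuous f := continuous (fun x => Re (f x)) /\ continuous (fun x => Im (f x)).

Lemma cis_derive_eq f x d d' : cis_derive f x d -> d = d' -> cis_derive f x d'.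
Proof. by move=> h <-. Qed.

Lemma cis_deriveM f g x df dg : cis_derive f x df -> cis_derive g x dg ->
  cis_derive (fun y => f y * g y) x (df * g x + f x * dg).
Proof.
move=> [f1 f2] [g1 g2]; split.
  under eq_fun do rewrite ReM.
  apply: (is_derive_eq1 (is_derive_fD (is_derive_fM f1 g1) (is_derive_fN (is_derive_fM f2 g2)))).
  by rewrite ReD !ReM; ring.
under eq_fun do rewrite ImM.
apply: (is_derive_eq1 (is_derive_fD (is_derive_fM f1 g2) (is_derive_fM f2 g1))).
by rewrite ImD !ImM; ring.
Qed.

Lemma cis_derive_cst (c : R[i]) x : cis_derive (fun=> c) x 0.
Proof. by split; exact: is_derive_cst. Qed.

Lemma cis_deriveZ (c : R[i]) f x df : cis_derive f x df ->
  cis_derive (fun y => c * f y) x (c * df).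
Proof.
move=> h; apply: (cis_derive_eq (cis_deriveM (cis_derive_cst c x) h)).
by rewrite mul0r add0r.
Qed.

Lemma cis_derive_cexp (z : R[i]) (x : R) :
  cis_derive (fun y => cexp (z * y%:C)) x (z * cexp (z * x%:C)).
Proof.
case: z => a b.
have E (y : R) : cexp ((a +i* b) * y%:C) =
    (expR (a * y + 0) * cos (b * y + 0)) +i* (expR (a * y + 0) * sin (b * y + 0)).
  by rewrite /cexp ReM ImM /= !mulr0 subr0 add0r !addr0.
have de := @is_derive_affine _ expR a 0 x _ (is_derive_expR (a * x + 0)).
have dc := @is_derive_affine _ cos b 0 x _ (is_derive_cos (b * x + 0)).
have ds := @is_derive_affine _ sin b 0 x _ (is_derive_sin (b * x + 0)).
split.
  under eq_fun do rewrite E /=.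
  apply: (is_derive_eq1 (is_derive_fM de dc)).
  by rewrite E ReM /=; ring.
under eq_fun do rewrite E /=.
apply: (is_derive_eq1 (is_derive_fM de ds)).
by rewrite E ImM /=; ring.
Qed.

Lemma smooth_cis_derive f x : smooth f -> cis_derive f x (cderive f x).
Proof.
by move=> [s1 s2]; split; apply: derivable_is_derive; [exact: smooth_real_derivable s1 _|exact: smooth_real_derivable s2 _].
Qed.

Lemma smooth_ccontinuous f : smooth f -> ccontinuous f.
Proof. by move=> [s1 s2]; split; [exact: smooth_real_continuous s1|exact: smooth_real_continuous s2]. Qed.

Lemma cis_derive_ccontinuous f (d : R -> R[i]) : (forall x : R, cis_derive f x (d x)) -> ccontinuous f.
Proof.
move=> h; split => x; apply: differentiable_continuous; apply/derivable1_diffP;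
  by have [d1 d2] := h x; first [exact: is_derive_derivable d1 | exact: is_derive_derivable d2].
Qed.

Lemma ccontinuous_cmeasurable f : ccontinuous f -> @cmeasurable R _ RT f.
Proof. by move=> [c1 c2]; split; exact: continuous_measurable_fun. Qed.

Lemma ccontinuousM f g : ccontinuous f -> ccontinuous g -> ccontinuous (fun x => f x * g x).
Proof.
move=> [f1 f2] [g1 g2]; split => x.
  under eq_fun do rewrite ReM.
  by apply: cvgB; apply: cvgM; [exact: f1|exact: g1|exact: f2|exact: g2].
under eq_fun do rewrite ImM.
by apply: cvgD; apply: cvgM; [exact: f1|exact: g2|exact: f2|exact: g1].
Qed.

Lemma ccontinuousD f g : ccontinuous f -> ccontinuous g -> ccontinuous (fun x => f x + g x).
Proof.
move=> [f1 f2] [g1 g2]; split => x.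
  by under eq_fun do rewrite ReD; apply: cvgD; [exact: f1|exact: g1].
by under eq_fun do rewrite ImD; apply: cvgD; [exact: f2|exact: g2].
Qed.

Lemma ccontinuous_cst (c : R[i]) : ccontinuous (fun=> c).
Proof. by split => x; exact: cvg_cst. Qed.

Lemma ccontinuous_cexp (z : R[i]) : ccontinuous (fun x => cexp (z * x%:C)).
Proof. exact: cis_derive_ccontinuous (cis_derive_cexp z). Qed.

Lemma continuous_FTC (F f : R -> R) (a b : R) : a <= b -> continuous f ->
  (forall x : R, is_derive x 1 F (f x)) -> \int[mu]_(x in `[a, b]) f x = F b - F a.
Proof.
move=> ab cf dF.
have cF : continuous F.
  move=> x; apply: differentiable_continuous; apply/derivable1_diffP.
  exact: is_derive_derivable (dF x).
move: ab; rewrite le_eqVlt => /predU1P[<-|ab].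
  by rewrite set_itv1 Rintegral_set1 subrr.
rewrite /Rintegral (@continuous_FTC2 _ _ F)//.
- exact: continuous_subspaceT.
- split.
  + by move=> x _; exact: is_derive_derivable (dF x).
  + by apply: cvg_at_right_filter; exact: cF.
  + by apply: cvg_at_left_filter; exact: cF.
- by move=> x _; exact: is_derive_derive1.
Qed.

Lemma ccontinuous_FTC F f (a b : R) : a <= b -> ccontinuous f ->
  (forall x : R, cis_derive F x (f x)) -> cint `[a, b] f = F b - F a.
Proof.
move=> ab [c1 c2] dF; apply: complexP; rewrite ?ReB ?ImB /=;
  apply: (@continuous_FTC (fun x => _ (F x))) => // x; by have [] := dF x.
Qed.

Lemma rintegrable_itv_continuous (u : R -> R) (a b : R) : continuous u ->
  rintegrable (fun x => \1_(`[a, b]%classic) x * u x).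
Proof.
move=> cu.
have i1 : mu.-integrable `[a, b] (EFin \o u).
  apply: continuous_compact_integrable; first exact: segment_compact.
  exact: continuous_subspaceT.
have := (@integrable_mkcond _ RT R mu `[a, b]%classic (EFin \o u) (measurable_itv _)).1 i1.
rewrite /rintegrable; congr (integrable _ _ _); apply/funext => x /=.
by rewrite patchE indicE; case: (x \in _); rewrite ?mul1r ?mul0r.
Qed.

Lemma cint_itv_cexp (s : R[i]) (a b : R) : a <= b -> s != 0 ->
  cint `[a, b] (fun v => cexp (- (s * v%:C))) =
  (cexp (- (s * a%:C)) - cexp (- (s * b%:C))) / s.
Proof.
move=> ab s0; rewrite (@ccontinuous_FTC (fun v => - s^-1 * cexp (- s * v%:C))).
- by rewrite !mulNr; field.
- by [].
- by under eq_fun do rewrite -mulNr; exact: ccontinuous_cexp.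
- move=> x; apply: (cis_derive_eq (cis_deriveZ (- s^-1) (cis_derive_cexp (- s) x))).
  by rewrite mulrA mulNr mulrN opprK mulVf// mul1r mulNr.
Qed.

Lemma cvg_inv_oneDsqr (K : R) : (fun n : nat => K / (1 + n%:R ^+ 2)) @ \oo --> (0 : R).
Proof.
apply/cvgrPdist_lt => e e0; near=> n.
rewrite sub0r normrN normrM normfV (ger0_norm (_ : 0 <= 1 + n%:R ^+ 2)) ?addr_ge0 ?sqr_ge0//.
rewrite ltr_pdivrMr ?ltr_pwDl ?sqr_ge0//.
have n1 : 1 <= n%:R :> R by rewrite ler1n; near: n; exists 1%N.
have nK : `|K| / e < n%:R by near: n; exact: nbhs_infty_gtr.
rewrite -ltr_pdivrMl// mulrC (lt_le_trans nK)//.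
nra.
Unshelve. all: by end_near. Qed.

(** The integrals over [-n, n] equal F(n) - F(-n), which the decay of [F] sends to 0, and they
    converge to the whole integral by domination. This serves as integration by parts without
    boundary terms. *)
Lemma rint_derive_eq0 (F f : R -> R) (K : R) : continuous f -> rintegrable f ->
  (forall x : R, is_derive x 1 F (f x)) -> (forall x, `|F x| <= K / (1 + x ^+ 2)) ->
  \int[mu]_x f x = 0.
Proof.
move=> cf i_f dF FK.
have [n|x||n x|_ h] := @rint_dominated_seq R (fun n x => \1_(`[- n%:R, n%:R]%classic) x * f x) f
  (fun x => `|f x|).
- apply: measurable_funM; first exact: measurable_indic.
  exact: rintegrable_measurable.
- apply: (@cvg_trans _ ((fun=> f x) @ \oo)); last exact: cvg_cst.
  apply: near_eq_cvg; near=> n; rewrite indicE mem_set ?mul1r//= in_itv/= -ler_norml.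
  by near: n; exact: nbhs_infty_ger.
- exact: rintegrable_norm.
- rewrite normrM ler_piMl// indicE; case: (_ \in _); by rewrite ?normr1 ?normr0.
have h0 : \int[mu]_x (\1_(`[- n%:R, n%:R]%classic) x * f x) @[n --> \oo] --> (0 : R).
  apply: (@squeeze_cvgr _ _ _ _ (fun n => - ((2 * K) / (1 + n%:R ^+ 2))) (fun n => (2 * K) / (1 + n%:R ^+ 2))).
  - apply: nearW => n.
    have -> : \int[mu]_x (\1_(`[- n%:R, n%:R]%classic) x * f x) = F n%:R - F (- n%:R).
      rewrite -(@continuous_FTC F f)//; last by rewrite (@le_trans _ _ 0)// oppr_le0.
      rewrite (Rintegral_mkcond mu `[- n%:R, n%:R]); apply: eq_Rintegral => x _.
      by rewrite patchE indicE; case: (_ \in _); rewrite ?mul1r ?mul0r.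
    rewrite -ler_norml (le_trans (ler_normB _ _))// mulr2n mulrDl mul1r mulrDl lerD//.
    by rewrite (le_trans (FK _))// sqrrN.
  - by rewrite -oppr0; apply: cvgN; exact: cvg_inv_oneDsqr.
  - exact: cvg_inv_oneDsqr.
exact: (cvg_unique _ h h0).
Unshelve. all: by end_near. Qed.

Lemma cint_derive_eq0 F f (K : R) : ccontinuous f -> cintegrable f ->
  (forall x : R, cis_derive F x (f x)) -> (forall x, normc (F x) <= K / (1 + x ^+ 2)) ->
  cint setT f = 0.
Proof.
move=> [c1 c2] [i1 i2] dF FK; apply: complexP; rewrite ?Re_cint ?Im_cint /=.
  apply: (@rint_derive_eq0 (fun x => Re (F x)) _ K) => // x; first by have [] := dF x.
  exact: le_trans (Re_le_normc _) (FK x).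
apply: (@rint_derive_eq0 (fun x => Im (F x)) _ K) => // x; first by have [] := dF x.
exact: le_trans (Im_le_normc _) (FK x).
Qed.

(** For y = e x one has exp(y) = exp(y/2)^2 >= (1 + y/2)^2 >= 1 + y^2/4, and the product of 1 +
    y^2/4 with 1 + 4/e^2 is 1 + x^2 plus two nonnegative terms. *)
Lemma expRN_le (e x : R) : 0 < e -> 0 <= x ->
  expR (- (e * x)) <= (1 + 4 / e ^+ 2) / (1 + x ^+ 2).
Proof.
move=> e0 x0; rewrite expRN ler_pdivlMr ?ltr_pwDl ?sqr_ge0// mulrC.
rewrite ler_pdivrMr ?expR_gt0//.
have ex0 : 0 <= e * x by rewrite mulr_ge0// ltW.
have h : 1 + (e * x) ^+ 2 / 4 <= expR (e * x).
  have -> : e * x = (e * x / 2) + (e * x / 2) by lra.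
  rewrite expRD -expr2.
  have h1 := expR_ge1Dx (e * x / 2).
  have h2 : (1 + e * x / 2) ^+ 2 <= expR (e * x / 2) ^+ 2.
    by rewrite ler_pXn2r// ?nnegrE ?expR_ge0// addr_ge0// divr_ge0.
  by apply: le_trans h2; nra.
apply: (@le_trans _ _ ((1 + 4 / e ^+ 2) * (1 + (e * x) ^+ 2 / 4))); last first.
  by rewrite ler_pM2l// addr_gt0// divr_gt0// exprn_gt0.
have -> : (1 + 4 / e ^+ 2) * (1 + (e * x) ^+ 2 / 4) =
  1 + x ^+ 2 + 4 / e ^+ 2 + (e * x) ^+ 2 / 4 by field; rewrite gt_eqF.
by rewrite -addrA lerDl addr_ge0// divr_ge0// sqr_ge0.
Qed.

End ComplexDerivative.

(** * The Fourier transform *)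

Section Fourier.
Variable R : realType.
Local Notation mu := (@lebesgue_measure R).
Local Notation RT := (measurableTypeR R).
Implicit Types f g phi : R -> R[i].

Definition fkernel (t x : R) : R[i] := cexp (- (0 +i* (t * x))).

Lemma fkernelE t x : fkernel t x = cexp ((0 +i* (- t)) * x%:C).
Proof.
by congr cexp; apply: complexP; rewrite ?ReN ?ImN ?ReM ?ImM /=; ring.
Qed.

Lemma fkernelC t x : fkernel t x = fkernel x t.
Proof. by rewrite /fkernel mulrC. Qed.

Lemma fkernelD t x y : fkernel t (x + y) = fkernel t x * fkernel t y.
Proof.
rewrite /fkernel -cexpD; congr cexp.
by apply: complexP; rewrite ?ReD ?ImD ?ReN ?ImN /=; ring.
Qed.

Lemma fkernel_opp t x : fkernel (- t) x = fkernel t (- x).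
Proof. by rewrite /fkernel mulNr mulrN. Qed.

Lemma fkernel0 t : fkernel t 0 = 1.
Proof. by rewrite fkernelE mulr0 cexp0. Qed.

Lemma normc_fkernel t x : normc (fkernel t x) = 1.
Proof. by rewrite fkernelE normc_cexp ReM /= mul0r mulr0 subrr expR0. Qed.

Lemma ccontinuous_fkernel t : ccontinuous (fkernel t).
Proof.
rewrite (_ : fkernel t = fun x => cexp ((0 +i* (- t)) * x%:C)).
  exact: ccontinuous_cexp.
by apply/funext => x; rewrite fkernelE.
Qed.

Lemma cmeasurable_fkernel t : @cmeasurable R _ RT (fkernel t).
Proof. exact: ccontinuous_cmeasurable (ccontinuous_fkernel t). Qed.

Lemma cmeasurable_fkernel2 : @cmeasurable R _ (RT * RT)%type (fun p => fkernel p.1 p.2).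
Proof.
apply: cmeasurable_cexp; apply: cmeasurableN; apply: cmeasurable_ReIm.
  exact: measurable_cst.
by apply: measurable_funM; [exact: measurable_fst|exact: measurable_snd].
Qed.

Lemma fourierE f t : fourier f t = cint setT (fun x => fkernel t x * f x).
Proof. by []. Qed.

Lemma cintegrable_fourier f t : cintegrable f -> cintegrable (fun x => fkernel t x * f x).
Proof.
apply: (@cintegrable_bddM _ f (fkernel t) 1); first exact: cmeasurable_fkernel.
by move=> x; rewrite normc_fkernel.
Qed.

Lemma normc_fourier_le f (u : R -> R) t : @cmeasurable R _ RT f -> rintegrable u ->
  (forall x, normc (f x) <= u x) -> normc (fourier f t) <= 2 * \int[mu]_x u x.
Proof.
move=> mf iu fu; apply: normc_cint_le => //.
  by apply: cmeasurableM => //; exact: cmeasurable_fkernel.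
by move=> x; rewrite normcM normc_fkernel mul1r.
Qed.

Lemma fourierD f g t : cintegrable f -> cintegrable g ->
  fourier (fun x => f x + g x) t = fourier f t + fourier g t.
Proof.
move=> i_f ig; rewrite !fourierE -cintD; [|exact: cintegrable_fourier..].
by apply: eq_cint => x; rewrite mulrDr.
Qed.

Lemma fourierZ c f t : cintegrable f -> fourier (fun x => c * f x) t = c * fourier f t.
Proof.
move=> i_f; rewrite !fourierE -cintZ; last exact: cintegrable_fourier.
by apply: eq_cint => x; rewrite mulrCA.
Qed.

Lemma fourier_opp f t : cintegrable f -> fourier (fun x => f (- x)) t = fourier f (- t).
Proof.
move=> i_f; rewrite !fourierE -[RHS]cint_opp; last exact: cintegrable_fourier.
by apply: eq_cint => x; rewrite fkernel_opp opprK.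
Qed.

Lemma fourier_modulate f (y t : R) :
  fourier (fun x => fkernel (- y) x * f x) t = fourier f (t - y).
Proof.
apply: eq_cint => x; rewrite mulrA; congr (_ * _).
by rewrite -[LHS]/(fkernel t x * fkernel (- y) x) fkernelC (fkernelC (- y)) -fkernelD fkernelC.
Qed.

(** Fubini with the majorant |f(x)| |g(y)|; the kernel is symmetric, so the roles exchange. This
    multiplication formula is what later moves a transform onto the test function. *)
Lemma fourier_swap f g : cintegrable f -> cintegrable g ->
  cintegrable (fun x => f x * fourier g x) /\
  cint setT (fun x => f x * fourier g x) = cint setT (fun x => fourier f x * g x).
Proof.
move=> i_f ig.
have [||||h1 h2] := @cint_fubini R (fun x y => f x * (fkernel x y * g y))
  (fun x => normc (f x)) (fun y => normc (g y)).
- apply: cmeasurableM.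
    by apply: (@cmeasurable_comp _ _ _ _ RT f fst) => //; exact: cintegrable_measurable.
  apply: cmeasurableM; first exact: cmeasurable_fkernel2.
  by apply: (@cmeasurable_comp _ _ _ _ RT g snd) => //; exact: cintegrable_measurable.
- exact: cintegrable_normc.
- exact: cintegrable_normc.
- by move=> x y; rewrite !normcM normc_fkernel mul1r.
have E x : cint setT (fun y => f x * (fkernel x y * g y)) = f x * fourier g x.
  by rewrite (cintZ (f x) (cintegrable_fourier x ig)) -fourierE.
split; first by apply: (cintegrable_eq E h1).
rewrite -(eq_cint E) h2; apply: eq_cint => y.
rewrite [RHS]mulrC fourierE -(cintZ (g y) (cintegrable_fourier y i_f)).
apply: eq_cint => x.
by rewrite (fkernelC x y) [LHS]mulrA [LHS]mulrC (mulrC (f x)).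
Qed.

(** Integrability of all moments is stable under multiplication by x, hence under differentiation of
    the transform. The class contains the Schwartz functions and also indicators of bounded
    intervals, whose transforms must be smooth as well. *)
Definition rapid f := @cmeasurable R _ RT f /\
  forall n : nat, rintegrable (fun x => `|x| ^+ n * normc (f x)).

Lemma rapid_cintegrable f : rapid f -> cintegrable f.
Proof.
move=> [mf rf]; apply: cintegrable_le (rf 0%N) _ => // x.
by rewrite expr0 mul1r.
Qed.

Lemma rapid_mulI f : rapid f -> rapid (fun x => (0 +i* (- x)) * f x).
Proof.
move=> [mf rf]; split.
  by apply: cmeasurableM => //; apply: cmeasurable_ReIm => //; exact: opp_measurable.
move=> n; apply: (rintegrable_eq _ (rf n.+1)) => x.
rewrite normcM exprS normc_imag normrN.
by rewrite mulrCA mulrA.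
Qed.

Lemma rapidZ c f : rapid f -> rapid (fun x => c * f x).
Proof.
move=> [mf rf]; split; first by apply: cmeasurableM => //; exact: cmeasurable_cst.
by move=> n; apply: (rintegrable_eq _ (rintegrableZ (normc c) (rf n))) => x; rewrite normcM mulrCA.
Qed.

(** Differentiation under the integral sign for a real integrand, with majorant |x| |f(x)|. The
    imaginary part will follow from Im z = Re (-i z), that is, from this lemma for -i f. *)
Lemma is_derive_Re_fourier f (t : R) : rapid f ->
  is_derive t 1 (fun s => Re (fourier f s)) (Re (fourier (fun x => (0 +i* (- x)) * f x) t)).
Proof.
move=> rf; have rf' := rapid_mulI rf.
have iff := rapid_cintegrable rf; have iff' := rapid_cintegrable rf'.
pose h (s x : R) := Re (fkernel s x * f x).
have dh (s x : R) : is_derive s 1 (h ^~ x) (Re (fkernel s x * ((0 +i* (- x)) * f x))).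
  have := cis_deriveM (cis_derive_cexp (0 +i* (- x)) s) (cis_derive_cst (f x) s).
  rewrite mulr0 addr0 -mulrA mulrCA -fkernelE fkernelC => -[+ _].
  by under eq_fun do rewrite -fkernelE fkernelC.
have tI : `]t - 1, t + 1[%classic t by rewrite /= in_itv/= ltrDl ltrBlDr ltrDl ltr01.
have H1 (s : R) : `]t - 1, t + 1[%classic s -> mu.-integrable setT (EFin \o h s).
  by move=> _; have [] := cintegrable_fourier s iff.
have H2 (s x : R) : `]t - 1, t + 1[%classic s -> [set: RT] x -> derivable (h ^~ x) s 1.
  by move=> _ _; exact: is_derive_derivable (dh s x).
have H3 (x : RT) : 0 <= `|x| ^+ 1 * normc (f x) by rewrite mulr_ge0// normc_ge0.
have H4 (s x : R) : `]t - 1, t + 1[%classic s -> [set: RT] x ->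
    `|partial1of2 h s x| <= `|x| ^+ 1 * normc (f x).
  move=> _ _; rewrite /partial1of2 (is_derive_derive1 (dh s x)).
  apply: (le_trans (Re_le_normc _)); rewrite !normcM normc_fkernel mul1r ler_wpM2r ?normc_ge0//.
  by rewrite normc_imag normrN.
have D := @derivable_under_integral R _ RT mu h setT measurableT t _ _ tI H1 H2 _ H3 (rf.2 1%N) H4.
have E := @differentiation_under_integral R _ RT mu h setT measurableT t _ _ tI H1 H2 _ H3 (rf.2 1%N) H4.
apply: DeriveDef; first exact: D.
rewrite -derive1E E; apply: eq_Rintegral => x _.
by rewrite /partial1of2 (is_derive_derive1 (dh t x)).
Qed.

Lemma cis_derive_fourier f t : rapid f ->
  cis_derive (fourier f) t (fourier (fun x => (0 +i* (- x)) * f x) t).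
Proof.
move=> rf; split; first exact: is_derive_Re_fourier.
have E g s : cintegrable g -> Im (fourier g s) = Re (fourier (fun x => - 'i * g x) s).
  by move=> ig; rewrite fourierZ// ReM /=; ring.
have H := is_derive_Re_fourier t (rapidZ (- 'i) rf).
rewrite E; last exact/rapid_cintegrable/rapid_mulI.
under eq_fun do rewrite (E _ _ (rapid_cintegrable rf)).
apply: (is_derive_eq1 H); congr (Re (fourier _ t)); apply/funext => x.
by rewrite mulrCA.
Qed.

Lemma smooth_fourier f : rapid f -> smooth (fourier f).
Proof.
move=> rf.
(* The scalar c selects the real part (c = 1) or the imaginary part (c = -i). The class is stable
   under differentiation, which replaces g by -i x g. *)
have S : forall u, (exists g c, rapid g /\ u = fun t => Re (c * fourier g t)) -> smooth_real u.
  apply: smooth_real_ind => _ [g [c [rg ->]]].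
  have d t := cis_deriveZ c (cis_derive_fourier t rg).
  split; first by move=> t; exact: is_derive_derivable (d t).1.
  exists (fun x => (0 +i* (- x)) * g x), c; split; first exact: rapid_mulI.
  by apply/funext => t; rewrite (is_derive_derive1 (d t).1).
split; apply: S.
  by exists f, 1; split => //; apply/funext => t; rewrite mul1r.
by exists f, (- 'i); split => //; apply/funext => t; rewrite ReM /=; ring.
Qed.

Lemma cderive_fourier f : rapid f -> cderive (fourier f) = fourier (fun x => (0 +i* (- x)) * f x).
Proof.
move=> rf; apply/funext => t; have [d1 d2] := cis_derive_fourier t rf.
by apply: complexP; rewrite /cderive/=; [rewrite (is_derive_derive1 d1)|rewrite (is_derive_derive1 d2)].
Qed.

Lemma normc_le2 (z : R[i]) (M : R) : `|Re z| <= M -> `|Im z| <= M -> normc z <= 2 * M.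
Proof. by move=> h1 h2; rewrite (le_trans (normc_le_ReIm z))// mulr2n mulrDl mul1r lerD. Qed.

(** The seminorms of weights k and k + 2 together bound (1 + x^2) |x|^k |phi(x)|; the factor 2 comes
    from passing from the two real parts to the modulus. *)
Lemma schwartz_bound phi k : schwartz phi ->
  exists K, forall x, `|x| ^+ k * normc (phi x) <= K / (1 + x ^+ 2).
Proof.
move=> [_ b]; have [K1 H1] := b k 0%N; have [K2 H2] := b k.+2 0%N.
exists (2 * K1 + 2 * K2) => x.
have B (j : nat) (L : R) : `|x ^+ j * Re (phi x)| <= L -> `|x ^+ j * Im (phi x)| <= L ->
    `|x| ^+ j * normc (phi x) <= 2 * L.
  move=> h1 h2; have := @normc_le2 ((x ^+ j)%:C * phi x) L.
  by rewrite Re_realM Im_realM normcM normc_real normrX; apply.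
rewrite ler_pdivlMr ?ltr_pwDl ?sqr_ge0// mulrDr mulr1 lerD//.
  by have [h1 h2] := H1 x; exact: B.
have [h1 h2] := H2 x; rewrite mulrAC -[x ^+ 2]real_normK ?num_real// -exprD addn2.
exact: B.
Qed.

Lemma schwartz_rapid phi : schwartz phi -> rapid phi.
Proof.
move=> sp; split; first exact: smooth_cmeasurable sp.1.
move=> n; have [K HK] := schwartz_bound n sp.
apply: (@rintegrable_le _ _ (fun x => K * (1 + x ^+ 2)^-1)).
- apply: measurable_funM.
    by apply: measurable_funX; apply: continuous_measurable_fun; exact: norm_continuous.
  by apply: measurable_normc; exact: smooth_cmeasurable sp.1.
- by apply: rintegrableZ; exact: rintegrable_oneDsqrV.
- by move=> x; rewrite ger0_norm ?mulr_ge0 ?normc_ge0.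
Qed.

Lemma schwartz_cintegrable phi : schwartz phi -> cintegrable phi.
Proof. by move/schwartz_rapid/rapid_cintegrable. Qed.

(** The derivative of e^(-itx) phi(x) integrates to 0 over the line, and the product rule splits it
    into the two transforms. *)
Lemma fourier_cderive phi t : schwartz phi ->
  fourier (cderive phi) t = (0 +i* t) * fourier phi t.
Proof.
move=> sp; have sp' := schwartz_cderive sp.
have [K HK] := schwartz_bound 0 sp.
have d x : cis_derive (fun x => fkernel t x * phi x) x
    ((0 +i* (- t)) * (fkernel t x * phi x) + fkernel t x * cderive phi x).
  have := cis_deriveM (cis_derive_cexp (0 +i* (- t)) x) (smooth_cis_derive x sp.1).
  rewrite -mulrA -fkernelE.
  rewrite /cis_derive; under eq_fun do rewrite -fkernelE.
  by under [X in _ /\ is_derive _ _ X _ -> _]eq_fun do rewrite -fkernelE.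
have iphi := cintegrable_fourier t (schwartz_cintegrable sp).
have iphi' := cintegrable_fourier t (schwartz_cintegrable sp').
have := cint_derive_eq0 _ _ d.
move=> /(_ K) h; have {}h := h _ _ _; move: h.
rewrite cintD//; last exact: cintegrableZ.
rewrite cintZ// => h.
have {}h : (0 +i* - t) * fourier phi t + fourier (cderive phi) t = 0.
  apply: h.
  - apply: ccontinuousD.
      apply: ccontinuousM; first exact: ccontinuous_cst.
      by apply: ccontinuousM; [exact: ccontinuous_fkernel|exact: smooth_ccontinuous sp.1].
    by apply: ccontinuousM; [exact: ccontinuous_fkernel|exact: smooth_ccontinuous sp'.1].
  - by apply: cintegrableD => //; exact: cintegrableZ.
  - move=> x; rewrite normcM normc_fkernel mul1r.
    by have := HK x; rewrite expr0 mul1r.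
move/eqP: h; rewrite addrC addr_eq0 => /eqP ->; rewrite -mulNr; congr (_ * _).
by apply: complexP; rewrite ?ReN ?ImN /= ?oppr0 ?opprK.
Qed.

Lemma test_fun_mulI (a b : R) phi : test_fun a b phi -> test_fun a b (fun x => (0 +i* (- x)) * phi x).
Proof.
move=> tp; apply: test_funM => //; split => /=; first exact: smooth_real_cst.
by apply: smooth_realN; exact: smooth_real_id.
Qed.

(** Differentiating the transform replaces phi by -i x phi, and multiplying it by the variable
    replaces phi by its derivative up to a unimodular constant. Both operations preserve test
    functions, so every seminorm is bounded by the L^1 norm of one more test function. *)
Lemma test_fun_fourier_schwartz (a b : R) phi : test_fun a b phi -> schwartz (fourier phi).
Proof.
move=> tp; split; first exact/smooth_fourier/schwartz_rapid/(test_fun_schwartz tp).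
move=> k n.
have [psi tpsi E] : exists2 psi, test_fun a b psi & forall x,
    rderive_n n (fun y => Re (fourier phi y)) x = Re (fourier psi x) /\
    rderive_n n (fun y => Im (fourier phi y)) x = Im (fourier psi x).
  elim: n phi tp => [|n IH] phi tp; first by exists phi.
  have [psi tpsi E] := IH _ (test_fun_mulI tp); exists psi => // x.
  have := cderive_fourier (schwartz_rapid (test_fun_schwartz tp)).
  rewrite !rderive_nS => h; have [<- <-] := E x; split; congr rderive_n; apply/funext => y.
    by rewrite -h.
  by rewrite -h.
have [chi tchi Ek] : exists2 chi, test_fun a b chi & forall x,
    `|x| ^+ k * normc (fourier psi x) = normc (fourier chi x).
  elim: k psi tpsi {E} => [|k IH] psi tpsi; first by exists psi => // x; rewrite expr0 mul1r.
  have [chi tchi E] := IH _ (test_fun_cderive tpsi); exists chi => // x.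
  rewrite -E fourier_cderive; last exact: test_fun_schwartz tpsi.
  rewrite normcM exprS normc_imag.
  by rewrite mulrCA mulrA.
have rchi := schwartz_rapid (test_fun_schwartz tchi).
exists (2 * \int[mu]_x normc (chi x)) => x.
have [-> ->] := E x.
have B : `|x| ^+ k * normc (fourier psi x) <= 2 * \int[mu]_x normc (chi x).
  rewrite Ek; apply: normc_fourier_le; first by case: rchi.
    by apply: cintegrable_normc; exact: rapid_cintegrable.
  by [].
by split; rewrite normrM normrX; apply: le_trans B; rewrite ler_wpM2l ?exprn_ge0//;
  [exact: Re_le_normc|exact: Im_le_normc].
Qed.

End Fourier.

(** * Fourier inversion by Abel summation *)

Section FourierInversion.
Variable R : realType.
Local Notation mu := (@lebesgue_measure R).
Local Notation RT := (measurableTypeR R).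
Implicit Types f g phi : R -> R[i].

(** L^1 bounds for phi and its second derivative control the transform and t^2 times the transform.
    The constant stays explicit and linear in [M], because it will be read as continuity of a
    functional in the Schwartz seminorms. *)
Lemma fourier_decay phi (M : R) : schwartz phi ->
  (forall x, normc (phi x) <= M / (1 + x ^+ 2)) ->
  (forall x, normc (cderive (cderive phi) x) <= M / (1 + x ^+ 2)) ->
  forall t, normc (fourier phi t) <= 4 * M * \int[mu]_x (1 + x ^+ 2)^-1 / (1 + t ^+ 2).
Proof.
move=> sp b0 b2 t.
have iM : rintegrable (fun x : R => M * (1 + x ^+ 2)^-1).
  by apply: rintegrableZ; exact: rintegrable_oneDsqrV.
have h0 : normc (fourier phi t) <= 2 * (M * \int[mu]_x (1 + x ^+ 2)^-1).
  rewrite -rintZ; last exact: rintegrable_oneDsqrV.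
  by apply: normc_fourier_le => //; exact: smooth_cmeasurable sp.1.
have h2 : t ^+ 2 * normc (fourier phi t) <= 2 * (M * \int[mu]_x (1 + x ^+ 2)^-1).
  rewrite -rintZ; last exact: rintegrable_oneDsqrV.
  have -> : t ^+ 2 * normc (fourier phi t) = normc (fourier (cderive (cderive phi)) t).
    rewrite fourier_cderive; last exact: schwartz_cderive.
    rewrite fourier_cderive// !normcM normc_imag mulrA; congr (_ * _).
    by rewrite -expr2 real_normK// num_real.
  apply: normc_fourier_le => //; apply: smooth_cmeasurable.
  by do 2 apply: smooth_cderive; exact: sp.1.
rewrite ler_pdivlMr ?ltr_pwDl ?sqr_ge0// mulrDr mulr1 [_ * t ^+ 2]mulrC.
apply: (le_trans (lerD h0 h2)); rewrite le_eqVlt; apply/orP; left; apply/eqP; ring.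
Qed.

Lemma schwartz_fourier_decay phi : schwartz phi ->
  exists K, forall t, normc (fourier phi t) <= K / (1 + t ^+ 2).
Proof.
move=> sp; have sp2 := schwartz_cderive (schwartz_cderive sp).
have [K0 H0] := schwartz_bound 0 sp; have [K2 H2] := schwartz_bound 0 sp2.
exists (4 * Num.max K0 K2 * \int[mu]_x (1 + x ^+ 2)^-1) => t.
apply: fourier_decay => // x; [have := H0 x | have := H2 x]; rewrite expr0 mul1r => /le_trans; apply;
  by rewrite ler_wpM2r ?invr_ge0 ?addr_ge0 ?sqr_ge0// le_max lexx ?orbT.
Qed.

Lemma schwartz_fourier_cintegrable phi : schwartz phi -> cintegrable (fourier phi).
Proof.
move=> sp; have [K HK] := schwartz_fourier_decay sp.
apply: (@cintegrable_le _ _ (fun x => K * (1 + x ^+ 2)^-1)) => //.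
  by apply: smooth_cmeasurable; apply: smooth_fourier; exact: schwartz_rapid.
by apply: rintegrableZ; exact: rintegrable_oneDsqrV.
Qed.

Lemma cint_dominated_seq (f : nat -> R -> R[i]) (l : R -> R[i]) (g : R -> R) :
  (forall n, @cmeasurable R _ RT (f n)) ->
  (forall x, (f ^~ x : nat -> R[i]^o) @ \oo --> (l x : R[i]^o)) ->
  rintegrable g -> (forall n x, normc (f n x) <= g x) ->
  cintegrable l /\
  ((fun n => cint setT (f n)) : nat -> R[i]^o) @ \oo --> (cint setT l : R[i]^o).
Proof.
move=> mf fl ig fg.
have [n|x||n x|i1 c1] := @rint_dominated_seq R (fun n x => Re (f n x)) (fun x => Re (l x)) g.
- by case: (mf n).
- by have /cvg_complexP[] := fl x.
- exact: ig.
- by apply: le_trans (fg n x); exact: Re_le_normc.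
have [n|x||n x|i2 c2] := @rint_dominated_seq R (fun n x => Im (f n x)) (fun x => Im (l x)) g.
- by case: (mf n).
- by have /cvg_complexP[] := fl x.
- exact: ig.
- by apply: le_trans (fg n x); exact: Im_le_normc.
by split; [split | apply/cvg_complexP; split].
Qed.

Lemma measurable_halfline : measurable_fun setT (\1_(`[0, +oo[%classic : set RT) : RT -> R).
Proof. by apply: measurable_indic; exact: measurable_itv. Qed.

Lemma cmeasurable_laplace_kernel (s : R[i]) : @cmeasurable R _ RT (fun x => cexp (- (s * x%:C))).
Proof.
apply: cmeasurable_cexp; apply: cmeasurableN; apply: cmeasurableM; first exact: cmeasurable_cst.
by apply: cmeasurable_real; exact: measurable_id.
Qed.

Lemma normc_laplace_kernel (s : R[i]) (x : R) :
  normc (cexp (- (s * x%:C))) = expR (- (Re s * x)).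
Proof. by rewrite normc_cexp ReN ReM /= mulr0 subr0. Qed.

Lemma cvg_expRN_nat (e : R) : 0 < e -> expR (- (e * n%:R)) @[n --> \oo] --> (0 : R).
Proof.
move=> e0; apply: (@squeeze_cvgr _ _ _ _ (fun=> 0) (fun n : nat => (1 + 4 / e ^+ 2) / (1 + n%:R ^+ 2))).
- by apply: nearW => n; rewrite expR_ge0/= expRN_le.
- exact: cvg_cst.
- exact: cvg_inv_oneDsqr.
Qed.

(** The integrals over [0, n] equal (1 - e^(-s n))/s. Two things rest on this limit: the transform
    of the Abel factor, and the factor 1/z in the transform of a primitive. *)
Lemma laplace_one (s : R[i]) : 0 < Re s ->
  cintegrable (fun x => (\1_(`[0, +oo[%classic) x)%:C * cexp (- (s * x%:C))) /\
  cint setT (fun x => (\1_(`[0, +oo[%classic) x)%:C * cexp (- (s * x%:C))) = s^-1.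
Proof.
move=> s0; set l := (fun x : R => _).
have sn0 : s != 0 by apply/eqP => s00; move: s0; rewrite s00 ltxx.
pose f (n : nat) (x : R) := (\1_(`[0, n%:R]%classic) x)%:C * cexp (- (s * x%:C)).
have [n|x||n x|il cv] := @cint_dominated_seq f l (fun x => (1 + 4 / Re s ^+ 2) * (1 + x ^+ 2)^-1).
- apply: cmeasurableM; last exact: cmeasurable_laplace_kernel.
  by apply: cmeasurable_real; exact: measurable_indic.
- apply: (@cvg_trans _ ((fun=> l x : R[i]^o) @ \oo)); last exact: cvg_cst.
  apply: near_eq_cvg; near=> n; rewrite /l /f; congr (_%:C * _).
  have xn : x <= n%:R.
    by apply: (le_trans (ler_norm _)); near: n; exact: nbhs_infty_ger.
  by rewrite !indicE; congr (nat_of_bool _)%:R; apply/idP/idP; rewrite !inE/= !in_itv/= xn andbT.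
- by apply: rintegrableZ; exact: rintegrable_oneDsqrV.
- rewrite /f normcM normc_laplace_kernel normc_real indicE.
  have [|] := boolP (x \in _); last first.
    move=> _; rewrite normr0 mul0r mulr_ge0 ?invr_ge0 ?addr_ge0 ?sqr_ge0//.
    by rewrite divr_ge0// exprn_ge0// ltW.
  by rewrite inE/= in_itv/= => /andP[x0 _]; rewrite normr1 mul1r expRN_le.
split => //.
have cv2 : ((fun n => cint setT (f n)) : nat -> R[i]^o) @ \oo --> (s^-1 : R[i]^o).
  have E n : cint setT (f n) = (1 - cexp (- (s * n%:R%:C))) / s.
    by rewrite -cint_indic cint_itv_cexp//= mulr0 oppr0 cexp0.
  have Z : ((fun n => cexp (- (s * n%:R%:C))) : nat -> R[i]^o) @ \oo --> (0 : R[i]^o).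
    have N : (fun n : nat => normc (cexp (- (s * n%:R%:C)))) @ \oo --> (0 : R).
      by under eq_fun do rewrite normc_laplace_kernel; exact: cvg_expRN_nat.
    apply/cvg_complexP; split; apply: norm_cvg0;
      apply: (squeeze_cvgr _ (cvg_cst (0 : R)) N); apply: nearW => n; apply/andP;
      split; [exact: normr_ge0|exact: Re_le_normc|exact: normr_ge0|exact: Im_le_normc].
  under eq_fun do rewrite E.
  suff : ((fun n => (1 - cexp (- (s * n%:R%:C))) / s) : nat -> R[i]^o) @ \oo -->
      ((1 - 0) / s : R[i]^o) by rewrite subr0 mul1r.
  apply: (@cvgMl _ _ _ _ (fun n => 1 - cexp (- (s * n%:R%:C)))).
  exact: (cvgB (cvg_cst _) Z).
exact: (cvg_unique _ cv cv2).
Unshelve. all: by end_near. Qed.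

(** The Abel summation factor; [poisson] is its Fourier transform, a constant multiple of the
    Poisson kernel of the half-plane. *)
Definition abel (e t : R) : R := expR (- (e * `|t|)).
Definition poisson (e z : R) : R := 2 * e / (e ^+ 2 + z ^+ 2).

Lemma abel_rintegrable (e : R) : 0 < e -> rintegrable (abel e).
Proof.
move=> e0; apply: (@rintegrable_le _ _ (fun x => (1 + 4 / e ^+ 2) * (1 + x ^+ 2)^-1)).
- apply: continuous_measurable_fun => t.
  apply: (@continuous_comp _ _ _ (fun t : R => - (e * `|t|)) expR); last exact: continuous_expR.
  by apply: cvgN; apply: cvgM; [exact: cvg_cst|exact: norm_continuous].
- by apply: rintegrableZ; exact: rintegrable_oneDsqrV.
- move=> x; rewrite ger0_norm ?expR_ge0//.
  by have := @expRN_le _ e `|x| e0 (normr_ge0 x); rewrite real_normK ?num_real.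
Qed.

(** Splitting at t = 0 gives the Laplace integrals 1/(e + iz) and 1/(e - iz), with sum 2e/(e^2 +
    z^2). Both halves contain the point 0, so the integrands agree only almost everywhere. *)
Lemma fourier_abel (e z : R) : 0 < e -> fourier (fun t => (abel e t)%:C) z = (poisson e z)%:C.
Proof.
move=> e0.
have [i1 h1] := @laplace_one (e +i* z) e0.
have [i2 h2] := @laplace_one (e +i* (- z)) e0.
set F1 := (fun x : R => _ * _) in i1 h1; set F2 := (fun x : R => _ * _) in i2 h2.
have -> : fourier (fun t => (abel e t)%:C) z = cint setT (fun t => F1 t + F2 (- t)).
  apply: cint_aeeq.
  - apply: cmeasurableM; first exact: cmeasurable_fkernel.
    by apply: cmeasurable_real; apply: rintegrable_measurable; exact: abel_rintegrable.
  - by apply: cintegrable_measurable; apply: cintegrableD => //; exact: cintegrable_opp.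
  - exists [set 0]; split; [exact: measurable_set1|exact: lebesgue_measure_set1|].
    move=> t /= h; apply: contrapT => t0; apply: h.
    rewrite /F1 /F2 !indicE -[cexp (- (0 +i* (z * t)))]/(fkernel z t) /abel.
    have E (b v : R) : cexp (- ((e +i* b) * v%:C)) = (expR (- (e * v)))%:C * fkernel b v.
      rewrite cexp_split; congr (_%:C * cexp _); first by rewrite ReN ReM /= mulr0 subr0.
      by apply: complexP; rewrite ?ReN ?ImN ?ImM /= ?oppr0// mulr0 add0r.
    have [tp|tn|te] := ltgtP 0 t; last by exfalso; apply: t0; rewrite te.
    + rewrite mem_set/=; last by rewrite in_itv/= ltW.
      rewrite memNset/=; last by rewrite in_itv/= oppr_ge0 leNgt tp.
      by rewrite mul0r addr0 mul1r E gtr0_norm// mulrC.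
    + rewrite memNset/=; last by rewrite in_itv/= leNgt tn.
      rewrite mem_set/=; last by rewrite in_itv/= oppr_ge0 ltW.
      by rewrite mul0r add0r mul1r E ltr0_norm// mulrC fkernel_opp opprK.
rewrite cintD//; last exact: cintegrable_opp.
rewrite cint_opp// h1 h2.
have d0 : e ^+ 2 + z ^+ 2 != 0 by rewrite gt_eqF// ltr_pwDl ?exprn_gt0 ?sqr_ge0.
apply: complexP; rewrite ?ReD ?ImD /poisson /= sqrrN.
  by field.
by field.
Qed.

Lemma poisson_ge0 (e z : R) : 0 < e -> 0 <= poisson e z.
Proof. by move=> e0; rewrite divr_ge0 ?mulr_ge0 ?addr_ge0 ?sqr_ge0// ltW. Qed.

Lemma poisson_continuous (e : R) : 0 < e -> continuous (poisson e).
Proof.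
move=> e0 z; apply: cvgM; first exact: cvg_cst.
apply: cvgV; first by rewrite gt_eqF// ltr_pwDl ?exprn_gt0 ?sqr_ge0.
by apply: cvgD; [exact: cvg_cst|exact: exprn_continuous].
Qed.

Lemma poisson_scale (e y : R) : 0 < e -> poisson 1 (e^-1 * y) * e^-1 = poisson e y.
Proof.
move=> e0; rewrite /poisson; field.
by rewrite gt_eqF// ?ltr_pwDl ?exprn_gt0 ?sqr_ge0//= gt_eqF// ltr_pwDl ?exprn_gt0 ?sqr_ge0.
Qed.

Lemma poisson_rintegrable (e : R) : 0 < e -> rintegrable (poisson e).
Proof.
move=> e0; apply: (@rintegrable_le _ _ (fun x => (2 * e + 2 / e) * (1 + x ^+ 2)^-1)).
- by apply: continuous_measurable_fun; exact: poisson_continuous.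
- by apply: rintegrableZ; exact: rintegrable_oneDsqrV.
- move=> x; rewrite ger0_norm ?poisson_ge0// /poisson.
  rewrite ler_pdivrMr ?ltr_pwDl ?exprn_gt0 ?sqr_ge0// mulrAC ler_pdivlMr ?ltr_pwDl ?sqr_ge0//.
  have -> : (2 * e + 2 / e) * (e ^+ 2 + x ^+ 2) =
     2 * e * (1 + x ^+ 2) + (2 * e ^+ 3 + 2 * x ^+ 2 / e) by field; rewrite gt_eqF.
  have e0' := ltW e0; rewrite lerDl; apply: addr_ge0.
    by apply: mulr_ge0 => //; exact: exprn_ge0.
  by apply: divr_ge0 => //; apply: mulr_ge0 => //; exact: sqr_ge0.
Qed.

Lemma poisson_substitution_ge0 (u : R -> R) (e : R) : 0 < e -> continuous u ->
  (forall x, 0 <= u x) ->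
  \int[mu]_y (u y * poisson e y) = \int[mu]_w (u (e * w) * poisson 1 w).
Proof.
move=> e0 cu u0; rewrite /Rintegral; congr fine.
pose F (y : R) := e^-1 * y.
have dF (y : R) : is_derive y 1 F e^-1.
  by apply: (is_derive_eq1 (is_derive_fZ _ (is_derive_id _ _))); rewrite mulr1.
have F' : F^`()%classic = cst e^-1 by apply/funext => y; rewrite (is_derive_derive1 (dF y)).
rewrite (@increasing_ge0_integration_by_substitutionT R F (fun w => u (e * w) * poisson 1 w)).
- apply: eq_integral => y _; rewrite F' /= /F; congr EFin.
  rewrite -[RHS]/(u (e * (e^-1 * y)) * poisson 1 (e^-1 * y) * e^-1).
  by rewrite (mulrA e) divff ?gt_eqF// mul1r -mulrA poisson_scale.
- by move=> x y xy; rewrite /F ltr_pM2l ?invr_gt0.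
- by rewrite F'; exact: cst_continuous.
- by rewrite F'; exact: is_cvg_cst.
- by rewrite F'; exact: is_cvg_cst.
- by move=> y; exact: is_derive_derivable (dF y).
- by apply: gt0_cvgMrNy => //; rewrite ?invr_gt0.
- by apply: gt0_cvgMry => //; rewrite ?invr_gt0.
- move=> w; apply: cvgM; last by apply: poisson_continuous.
  apply: (@continuous_comp _ _ _ (fun w => e * w) u); last exact: cu.
  by apply: cvgM; [exact: cvg_cst|exact: cvg_id].
- by move=> w; rewrite mulr_ge0// poisson_ge0.
Qed.

(** Adding the constant [M] reduces a bounded function to the nonnegative case, and the contribution
    of [M] is removed by the same formula for a constant. *)
Lemma poisson_substitution (u : R -> R) (e M : R) : 0 < e -> continuous u ->
  (forall x, `|u x| <= M) ->
  \int[mu]_y (u y * poisson e y) = \int[mu]_w (u (e * w) * poisson 1 w).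
Proof.
move=> e0 cu uM.
have M0 : 0 <= M by apply: le_trans (uM 0).
have cs : continuous (fun w : R => u (e * w)).
  move=> w; apply: (@continuous_comp _ _ _ (fun w => e * w) u); last exact: cu.
  by apply: cvgM; [exact: cvg_cst|exact: cvg_id].
have I (v : R -> R) (a : R) : 0 < a -> continuous v -> (forall x, `|v x| <= M) ->
    rintegrable (fun y => v y * poisson a y).
  move=> a0 cv vM; apply: (rintegrable_le _ (rintegrableZ M (poisson_rintegrable a0))).
    by apply: measurable_funM; apply: continuous_measurable_fun => //; exact: poisson_continuous.
  by move=> x; rewrite normrM (ger0_norm (poisson_ge0 _ a0)) ler_wpM2r// poisson_ge0.
have Ic (a : R) : 0 < a -> rintegrable (fun y => M * poisson a y).
  by move=> a0; apply: rintegrableZ; exact: poisson_rintegrable.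
have h1 : \int[mu]_y ((u y + M) * poisson e y) = \int[mu]_w ((u (e * w) + M) * poisson 1 w).
  apply: (@poisson_substitution_ge0 (fun y => u y + M)) => //.
    by move=> x; apply: cvgD; [exact: cu|exact: cvg_cst].
  by move=> x; rewrite -lerBlDr sub0r; have := uM x; rewrite ler_norml => /andP[].
have h2 : \int[mu]_y (M * poisson e y) = \int[mu]_w (M * poisson 1 w).
  by apply: (@poisson_substitution_ge0 (fun=> M)) => //; exact: cst_continuous.
move: h1; under eq_Rintegral do rewrite mulrDl; under [RHS]eq_Rintegral do rewrite mulrDl.
rewrite rintD; [|exact: I|exact: Ic].
rewrite rintD; [|exact: I|exact: Ic].
by rewrite h2 => /addIr.
Qed.

(* Its value is 2 pi, but only its positivity matters. *)
Definition inversion_constant : R := \int[mu]_x poisson 1 x.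

Lemma inversion_constant_gt0 : 0 < inversion_constant.
Proof.
(* On [0, 1] the kernel 2/(1 + x^2) is at least 1. *)
apply: (@lt_le_trans _ _ (\int[mu]_x (\1_(`[0, 1]%classic) x : R))).
  by rewrite integral_itv_indic// subr0 ltr01.
apply: rint_le; [exact: rintegrable_itv|exact: poisson_rintegrable|] => x.
rewrite indicE; have [|_] := boolP (_ \in _); last exact: poisson_ge0.
rewrite inE/= in_itv/= => /andP[x0 x1].
by rewrite /poisson ler_pdivlMr ?ltr_pwDl ?sqr_ge0 ?exprn_gt0//; nra.
Qed.

(** The regularized integral [A] is evaluated twice. By domination it tends to the double transform;
    by the multiplication formula it is a Poisson integral of [phi], whose kernel concentrates at
    the point -x as s -> 0+. *)
Lemma fourier_inversion phi : schwartz phi -> forall x,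
  fourier (fourier phi) x = inversion_constant%:C * phi (- x).
Proof.
move=> sp x.
have iphi := schwartz_cintegrable sp; have ifphi := schwartz_fourier_cintegrable sp.
have [K HK] := schwartz_bound 0 sp.
have bphi y : normc (phi y) <= K.
  have := HK y; rewrite expr0 mul1r => /le_trans; apply.
  have K0 : 0 <= K.
    have := HK 0; rewrite expr0 mul1r expr0n/= addr0 divr1; apply: le_trans; exact: normc_ge0.
  by rewrite ler_pdivrMr ?ltr_pwDl ?sqr_ge0// ler_peMr// lerDl sqr_ge0.
pose A (s : R) := cint setT (fun t => (abel s t)%:C * (fkernel x t * fourier phi t)).
have A1 : (A : R -> R[i]^o) @ 0^'+ --> (fourier (fourier phi) x : R[i]^o).
  apply: (@cint_dominated_right _ _ _ (fun t => normc (fourier phi t))).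
  - move=> s s0; apply: cmeasurableM.
      by apply: cmeasurable_real; apply: rintegrable_measurable; exact: abel_rintegrable.
    by apply: cmeasurableM; [exact: cmeasurable_fkernel|exact: cintegrable_measurable].
  - move=> t; rewrite -[X in _ --> (X : R[i]^o)]mul1r.
    apply: (@cvgMl _ _ _ _ (fun s => (abel s t)%:C)).
    apply/cvg_complexP; split => /=; last exact: cvg_cst.
    apply: cvg_at_right_filter.
    rewrite -[X in _ --> X](_ : expR (- (0 * `|t|)) = 1); last by rewrite mul0r oppr0 expR0.
    apply: (@continuous_comp _ _ _ (fun s : R => - (s * `|t|)) expR); last exact: continuous_expR.
    by apply: cvgN; apply: cvgM; [exact: cvg_id|exact: cvg_cst].
  - exact: cintegrable_normc.
  - move=> s t s0; rewrite !normcM normc_fkernel mul1r normc_real ler_piMl ?normc_ge0//.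
    by rewrite ger0_norm ?expR_ge0// /abel -expR0 ler_expR oppr_le0 mulr_ge0// ltW.
have A2 s : 0 < s -> A s = cint setT (fun y => (poisson s y)%:C * phi (y - x)).
  move=> s0; have ia := cintegrable_real (abel_rintegrable s0).
  have := fourier_swap (cintegrable_fourier x ia) iphi.
  move=> [_ h].
  transitivity (cint setT (fun t => fkernel x t * (abel s t)%:C * fourier phi t)).
    by apply: eq_cint => t; rewrite mulrCA mulrA.
  rewrite h -(@cint_shift _ (- x)); last first.
    apply: (@cintegrable_le _ _ (fun y => 2 * (\int[mu]_t abel s t) * normc (phi y))).
    - apply: cmeasurableM; last exact: cintegrable_measurable.
      rewrite (_ : fourier _ = fun y => (poisson s (y + x))%:C).
        apply: cmeasurable_real; apply: (measurableT_comp (rintegrable_measurable (poisson_rintegrable s0))).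
        exact: shift_measurable.
      by apply/funext => y; rewrite -fourier_abel// -[y + x]/(y + x) -[x in LHS]opprK fourier_modulate opprK.
    - by apply: rintegrableZ; exact: cintegrable_normc.
    - move=> y; rewrite normcM ler_wpM2r ?normc_ge0//.
      apply: normc_fourier_le; [|exact: abel_rintegrable|].
        by apply: cintegrable_measurable; exact: cintegrable_fourier.
      by move=> t; rewrite normcM normc_fkernel mul1r normc_real ger0_norm ?expR_ge0.
  apply: eq_cint => y; congr (_ * _).
  by rewrite -[x in fkernel x]opprK fourier_modulate opprK subrK fourier_abel.
have A3 : (A : R -> R[i]^o) @ 0^'+ --> (inversion_constant%:C * phi (- x) : R[i]^o).
  have B (u : R -> R) : continuous u -> (forall y, `|u y| <= K) ->
      \int[mu]_y (poisson s y * u (y - x)) @[s --> 0^'+] --> inversion_constant * u (- x).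
    move=> cu uK.
    have cux : continuous (fun y => u (y - x)).
      move=> y; apply: (@continuous_comp _ _ _ (fun y => y - x) u); last exact: cu.
      by apply: cvgB; [exact: cvg_id|exact: cvg_cst].
    apply: (@cvg_trans _ (\int[mu]_w (u (s * w - x) * poisson 1 w) @[s --> 0^'+])).
      apply: near_eq_cvg; near=> s.
      have s0 : 0 < s by near: s; exact: nbhs_right_gt.
      rewrite -(@poisson_substitution (fun y => u (y - x)) s K)//.
      by apply: eq_Rintegral => y _; rewrite mulrC.
    have -> : inversion_constant * u (- x) = \int[mu]_w (u (- x) * poisson 1 w).
      by rewrite (rintZ _ (poisson_rintegrable ltr01)) mulrC.
    apply: (@rint_dominated_right _ _ _ (fun w => K * poisson 1 w)).
    - move=> s s0; apply: measurable_funM; last first.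
        by apply: rintegrable_measurable; exact: poisson_rintegrable.
      apply: continuous_measurable_fun => w.
      apply: (@continuous_comp _ _ _ (fun w => s * w) (fun y => u (y - x))); last exact: cux.
      by apply: cvgM; [exact: cvg_cst|exact: cvg_id].
    - move=> w; apply: cvgMl; apply: cvg_at_right_filter.
      rewrite (_ : u (- x) = u (0 * w - x)); last by rewrite mul0r sub0r.
      apply: (@continuous_comp _ _ _ (fun s : R => s * w) (fun y => u (y - x)) 0); last exact: cux.
      by apply: cvgM; [exact: cvg_id|exact: cvg_cst].
    - by apply: rintegrableZ; exact: poisson_rintegrable.
    - by move=> s w s0; rewrite normrM (ger0_norm (poisson_ge0 _ ltr01)) ler_wpM2r// poisson_ge0.
  have [c1 c2] := smooth_ccontinuous sp.1.
  apply: (@cvg_trans _ ((fun s => cint setT (fun y => (poisson s y)%:C * phi (y - x)) : R[i]^o) @ 0^'+)).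
    by apply: near_eq_cvg; near=> s; rewrite A2//; near: s; exact: nbhs_right_gt.
  apply/cvg_complexP; rewrite Re_realM Im_realM; split.
    under eq_fun do (rewrite Re_cint; under eq_Rintegral do rewrite Re_realM).
    by apply: (@B (fun y => Re (phi y))) => // y; exact: le_trans (Re_le_normc _) (bphi y).
  under eq_fun do (rewrite Im_cint; under eq_Rintegral do rewrite Im_realM).
  by apply: (@B (fun y => Im (phi y))) => // y; exact: le_trans (Im_le_normc _) (bphi y).
exact: (cvg_unique _ A1 A3).
Unshelve. all: by end_near. Qed.

End FourierInversion.

(** * A test function with nonnegative Fourier transform *)

Section BumpFunction.
Variable R : realType.
Implicit Types (k : nat) (x : R).

(** The power k closes the family under differentiation: the derivative of member k is a combination
    of members k + 1 and k + 2. *)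
Definition exp_flat k x : R := if 0 < x then x^-1 ^+ k * expR (- x^-1) else 0.

(** Half of the exponent is spent on the first k powers by induction and half on the last one;
    writing y as 2 (y/2) costs the factor 2^(k + 1). *)
Lemma exprn_expRN_le k : exists C : R, forall y : R, 0 <= y -> y ^+ k * expR (- y) <= C.
Proof.
elim: k => [|k [C HC]].
  by exists 1 => y y0; rewrite expr0 mul1r -expR0 ler_expR oppr_le0.
exists (2 ^+ k.+1 * C) => y y0.
have y2 : 0 <= y / 2 by rewrite divr_ge0.
have h1 := HC _ y2.
have h2 : (y / 2) * expR (- (y / 2)) <= 1.
  rewrite expRN ler_pdivrMr ?expR_gt0// mul1r.
  by apply: le_trans (expR_ge1Dx _); rewrite lerDr.
have -> : y ^+ k.+1 * expR (- y) =
    2 ^+ k.+1 * (((y / 2) ^+ k * expR (- (y / 2))) * ((y / 2) * expR (- (y / 2)))).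
  have -> : expR (- y) = expR (- (y / 2)) * expR (- (y / 2)).
    by rewrite -expRD; congr expR; field.
  have -> : y ^+ k.+1 = 2 ^+ k.+1 * (y / 2) ^+ k.+1 by rewrite -exprMn mulrC divfK.
  by rewrite (exprS (y / 2)); ring.
rewrite ler_pM2l ?exprn_gt0// -[leRHS]mulr1.
apply: ler_pM => //; rewrite ?mulr_ge0 ?exprn_ge0 ?expR_ge0//.
Qed.

Lemma exp_flat_ge0 k x : 0 <= exp_flat k x.
Proof.
by rewrite /exp_flat; case: ifP => // x0; rewrite mulr_ge0 ?expR_ge0// exprn_ge0// invr_ge0 ltW.
Qed.

Lemma exp_flatS k x : exp_flat k x = x * exp_flat k.+1 x.
Proof.
rewrite /exp_flat; case: ifP => [x0|_]; last by rewrite mulr0.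
by rewrite exprS !mulrA divff ?gt_eqF// mul1r.
Qed.

Lemma exp_flat_bounded k : exists C : R, forall x, exp_flat k x <= C.
Proof.
have [C HC] := exprn_expRN_le k; exists (Num.max C 0) => x.
rewrite /exp_flat; case: ifP => [x0|_]; last by rewrite le_max lexx orbT.
by rewrite le_max HC// invr_ge0 ltW.
Qed.

Lemma is_derive_exp_flat k x :
  is_derive x 1 (exp_flat k) (- k%:R * exp_flat k.+1 x + exp_flat k.+2 x).
Proof.
have [x0|x0|<-] := ltgtP 0 x.
- have dinv : is_derive x 1 (fun y : R => y^-1) (- x^-1 ^+ 2).
    have h := @is_deriveV R (fun y => y) x 1 1 (lt0r_neq0 x0) (is_derive_id x 1).
    apply: (is_derive_eq1 h).
    by rewrite /GRing.scale/= mulr1 exprVn.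
  have dexp : is_derive x 1 (fun y : R => expR (- y^-1)) (expR (- x^-1) * x^-1 ^+ 2).
    have h := is_derive_fN dinv; rewrite opprK in h.
    exact: (@is_derive1_comp R expR (fun y => - y^-1) x _ _ (is_derive_expR _) h).
  have dpow : is_derive x 1 (fun y : R => y^-1 ^+ k) (- k%:R * x^-1 ^+ k.+1).
    elim: k => [|k IH].
      by rewrite oppr0 mul0r; under eq_fun do rewrite expr0; exact: is_derive_cst.
    have := is_derive_fM dinv IH; under [X in is_derive _ _ X _ -> _]eq_fun do rewrite -exprS.
    move=> h; apply: (is_derive_eq1 h); rewrite -[in RHS]natr1 !exprS.
    ring.
  have h := is_derive_fM dpow dexp.
  have -> : - k%:R * exp_flat k.+1 x + exp_flat k.+2 x =
      - k%:R * x^-1 ^+ k.+1 * expR (- x^-1) + x^-1 ^+ k * (expR (- x^-1) * x^-1 ^+ 2).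
    by rewrite /exp_flat x0 !exprS; ring.
  apply: (near_eq_is_derive _ h).
  by near=> y; rewrite /exp_flat ifT//; near: y; exact: lt_nbhsr.
- have -> : - k%:R * exp_flat k.+1 x + exp_flat k.+2 x = 0.
    by rewrite /exp_flat ltNge ltW//= mulr0 addr0.
  apply: (near_eq_is_derive _ (is_derive_cst (0 : R) x 1)).
  near=> y; rewrite /exp_flat ifF//; apply/negbTE; rewrite -leNgt ltW//.
  by near: y; exact: lt_nbhsl.
- have -> : - k%:R * exp_flat k.+1 0 + exp_flat k.+2 0 = 0.
    by rewrite /exp_flat ltxx mulr0 addr0.
  have [C HC] := exp_flat_bounded k.+2.
  (* The value at h is h^2 times that of the bounded member k + 2, so the difference quotient at the
     origin is O(h). *)
  have cv : h^-1 *: (exp_flat k (h *: 1 + 0) - exp_flat k 0) @[h --> (0 : R)^'] --> (0 : R).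
    apply/cvgr0Pnorm_le => e e0; near=> h.
    have h0 : h != 0 by near: h; exact: nbhs_dnbhs_neq.
    rewrite /GRing.scale/= mulr1 addr0 [exp_flat k 0]/exp_flat ltxx subr0.
    rewrite exp_flatS exp_flatS !mulrA mulVf// mul1r normrM (ger0_norm (exp_flat_ge0 _ _)).
    have hC : `|h| * (Num.max C 0 + 1) <= e.
      rewrite -ler_pdivlMr ?ltr_wpDl// ?le_max ?lexx ?orbT//.
      near: h; apply: dnbhs0_le; rewrite divr_gt0// ltr_wpDl// le_max lexx orbT//.
    apply: le_trans hC; rewrite ler_wpM2l//.
    by rewrite (le_trans (HC h))// (@le_trans _ _ (Num.max C 0)) ?le_max ?lexx// lerDl.
  apply: DeriveDef; first by apply/cvg_ex; exists 0.
  exact/cvg_lim.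
Unshelve. all: by end_near. Qed.

Lemma smooth_real_exp_flat k : smooth_real (exp_flat k).
Proof.
apply/smooth_realP => n; elim: n k => [|n IH] k.
  by move=> x; exact: is_derive_derivable (is_derive_exp_flat k x).
split; first by move=> x; exact: is_derive_derivable (is_derive_exp_flat k x).
rewrite (_ : derive1 _ = fun x => - k%:R * exp_flat k.+1 x + exp_flat k.+2 x).
  apply: n_derivableD; last exact: IH.
  apply: n_derivableM; last exact: IH.
  by have /smooth_realP := @smooth_real_cst R (- k%:R); apply.
by apply/funext => x; rewrite (is_derive_derive1 (is_derive_exp_flat k x)).
Qed.

(** The arguments are written [1 * x + l] and [-1 * x + l] to match the lemma on smoothness under
    affine substitution. *)
Definition bump (l x : R) : R := exp_flat 0 (1 * x + l) * exp_flat 0 (-1 * x + l).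

Lemma smooth_real_bump l : smooth_real (bump l).
Proof.
apply: (@smooth_realM _ (fun x => exp_flat 0 (1 * x + l)) (fun x => exp_flat 0 (-1 * x + l)));
  apply: smooth_real_affine; exact: smooth_real_exp_flat.
Qed.

Lemma bump_ge0 l x : 0 <= bump l x.
Proof. by rewrite mulr_ge0// exp_flat_ge0. Qed.

Lemma bump_even l x : bump l (- x) = bump l x.
Proof. by rewrite /bump mulrC !mulN1r !mul1r opprK. Qed.

Lemma bump_outside (l x : R) : x < - l \/ l < x -> bump l x = 0.
Proof.
rewrite /bump /exp_flat mul1r mulN1r => -[xl|lx].
  have -> : (0 < x + l) = false by apply/negbTE; rewrite -leNgt; lra.
  by rewrite mul0r.
have -> : (0 < - x + l) = false by apply/negbTE; rewrite -leNgt; lra.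
by rewrite mulr0.
Qed.

Lemma bump0_gt0 (l : R) : 0 < l -> 0 < bump l 0.
Proof.
move=> l0; rewrite /bump /exp_flat !mulr0 add0r l0 expr0 mul1r.
by rewrite mulr_gt0// expR_gt0.
Qed.

Lemma continuous_gt0_near0 (u : R -> R) : continuous u -> 0 < u 0 ->
  exists2 a, 0 < a & forall x, `|x| <= a -> u 0 / 2 <= u x.
Proof.
move=> cu u0; have /cvgrPdist_lt/(_ (u 0 / 2)) := cu 0.
rewrite divr_gt0// => /(_ isT) [d /= d0 Hd].
exists (d / 2); first by rewrite divr_gt0.
move=> x xd; have := Hd x; rewrite /ball_ /= sub0r normrN.
have -> : `|x| < d by rewrite (le_lt_trans xd)// ltr_pdivrMr// ltr_pMr// ltr1n.
by move=> /(_ isT); rewrite ltr_norml => /andP[_]; lra.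
Qed.

End BumpFunction.

Section PositiveKernel.
Variable R : realType.
Local Notation mu := (@lebesgue_measure R).
Local Notation RT := (measurableTypeR R).

Lemma continuous_rint_gt0 (u : R -> R) : continuous u -> rintegrable u ->
  (forall x, 0 <= u x) -> 0 < u 0 -> 0 < \int[mu]_x u x.
Proof.
move=> cu iu u0 u00; have [a a0 Ha] := continuous_gt0_near0 cu u00.
apply: (@lt_le_trans _ _ (\int[mu]_x ((u 0 / 2) * (\1_(`[- a, a]%classic) x)))).
  rewrite rintZ; last exact: rintegrable_itv.
  by rewrite integral_itv_indic; [rewrite mulr_gt0 ?divr_gt0//; lra | lra].
apply: rint_le => //; first by apply: rintegrableZ; exact: rintegrable_itv.
move=> x; rewrite indicE; have [|_] := boolP (_ \in _); last by rewrite mulr0.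
by rewrite inE/= in_itv/= -ler_norml mulr1 => /Ha.
Qed.

Lemma Im_fkernel (t x : R) : Im (fkernel t x) = - sin (t * x).
Proof. by rewrite /fkernel /cexp /= oppr0 expR0 mul1r sinN. Qed.

Lemma schwartz_bounded (phi : R -> R[i]) : schwartz phi ->
  exists2 M : R, 0 <= M & forall x, normc (phi x) <= M.
Proof.
move=> sp; have [K HK] := schwartz_bound 0 sp.
have K0 : 0 <= K.
  by have := HK 0; rewrite expr0 mul1r expr0n/= addr0 divr1; apply: le_trans; exact: normc_ge0.
exists K => // x; have := HK x; rewrite expr0 mul1r => /le_trans; apply.
by rewrite ler_pdivrMr ?ltr_pwDl ?sqr_ge0// ler_peMr// lerDl sqr_ge0.
Qed.

(* eta is an even bump and chi = eta * eta (convolution), so that chi^ = (eta^)^2 >= 0.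
   Smoothness of chi is read off from chi = c^-1 (eta^ eta^)^. *)
Lemma positive_kernel (l : R) : 0 < l ->
  exists (chi : R -> R[i]) (kappa : R -> R),
    [/\ test_fun (- l) l chi,
        (forall x, fourier chi x = (kappa x)%:C),
        (forall x, 0 <= kappa x) &
        exists a c : R, [/\ 0 < a, 0 < c & forall x, `|x| <= a -> c <= kappa x]].
Proof.
(* With half-width l/4 the convolution lives in [-l/2, l/2], strictly inside (-l, l). *)
move=> l0; pose e : R -> R[i] := fun x => (bump (l / 4) x)%:C.
have eev y : e (- y) = e y by rewrite /e bump_even.
have te : test_fun (- (l / 2)) (l / 2) e.
  split; first by apply: smooth_real_complex; exact: smooth_real_bump.
  exists (- (l / 4)), (l / 4); split; [lra|lra|] => x xl.
  by rewrite /e bump_outside.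
have se := test_fun_schwartz te; have ie := schwartz_cintegrable se.
have sfe := test_fun_fourier_schwartz te.
have ife := schwartz_cintegrable sfe.
have fe_real x : fourier e x = (Re (fourier e x))%:C.
  apply: complexP => [//|]; rewrite [RHS]/=.
  have h : fourier e (- x) = fourier e x.
    by rewrite -(fourier_opp x ie); apply: eq_cint => y; rewrite eev.
  have : Im (fourier e (- x)) = - Im (fourier e x).
    rewrite !fourierE !Im_cint -rintN; last by have [] := cintegrable_fourier x ie.
    apply: eq_Rintegral => y _; rewrite !(mulrC (fkernel _ y)) !Im_realM !Im_fkernel.
    by rewrite mulNr sinN mulrN.
  by rewrite h => /eqP; rewrite -addr_eq0 -mulr2n mulrn_eq0/= => /eqP.
pose k x := Re (fourier e x) ^+ 2.
pose c := inversion_constant R; have c0 : c != 0 by rewrite gt_eqF// inversion_constant_gt0.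
(* The argument -(y + t) is the one that Fourier inversion produces; as e is even, the integral is
   the convolution of e with itself at t. *)
pose chi t := cint setT (fun y => e (- (y + t)) * e y).
have [M0 M00 HM0] := schwartz_bounded sfe; have [Me Me0 HMe] := schwartz_bounded se.
have rfe : rapid (fun x => fourier e x * fourier e x).
  have [mf rf] := schwartz_rapid sfe; split; first exact: cmeasurableM.
  move=> n; apply: (rintegrable_le _ (rintegrableZ M0 (rf n))).
    apply: measurable_funM.
      by apply: measurable_funX; apply: continuous_measurable_fun; exact: norm_continuous.
    by apply: measurable_normc; exact: cmeasurableM.
  move=> x; rewrite ger0_norm ?mulr_ge0 ?normc_ge0// normcM mulrCA ler_wpM2r//.
  by rewrite mulr_ge0 ?normc_ge0.
have me : @cmeasurable R _ RT e by exact: cintegrable_measurable.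
have chi_int t : cintegrable (fun y => e (- (y + t)) * e y).
  apply: (@cintegrable_bddM _ e (fun y => e (- (y + t))) Me) => //.
  apply: (@cmeasurable_comp _ _ _ RT RT e (fun y => - (y + t))) => //.
  by apply: measurable_funN; exact: shift_measurable.
have chiE t : fourier (fun x => fourier e x * fourier e x) t = c%:C * chi t.
  transitivity (cint setT (fun x => (fkernel t x * fourier e x) * fourier e x)).
    by apply: eq_cint => x; rewrite mulrA.
  have [_ ->] := fourier_swap (cintegrable_fourier t ife) ie.
  rewrite -(cintZ _ (chi_int t)); apply: eq_cint => y; rewrite mulrA; congr (_ * _).
  by rewrite -[t in fkernel t]opprK fourier_modulate opprK fourier_inversion.
have cC0 : c%:C != 0 :> R[i] by apply: contra c0 => /eqP/complexI ->.
have schi : smooth chi.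
  rewrite (_ : chi = fun t => c%:C^-1 * fourier (fun x => fourier e x * fourier e x) t).
    by apply: smoothM; [exact: smooth_cst|exact: smooth_fourier].
  by apply/funext => t; rewrite chiE mulKf.
have e0 t y : t < - (l / 2) \/ l / 2 < t -> e (- (y + t)) * e y = 0.
  move=> ht; have [h|h] := boolP (`|y| <= l / 4); last first.
    rewrite [e y]/e (@bump_outside _ (l / 4) y) ?mulr0//.
    move: h; rewrite -ltNge ltr_normr => /orP[h|h]; [right => //|left; lra].
  rewrite {1}/e (@bump_outside _ (l / 4) (- (y + t))) ?mul0r//.
  move: h; rewrite ler_norml => /andP[h1 h2]; case: ht => ht; [right|left]; lra.
exists chi, k; split.
- split => //; exists (- (l / 2)), (l / 2); split; [lra|lra|] => t ht.
  rewrite /chi (eq_cint (g := fun=> 0 * 0)); last by move=> y; rewrite mul0r e0.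
  rewrite cintZ ?mul0r//; exact: (cintegrable_real (@rintegrable0 R)).
- move=> x; pose F t y := fkernel x t * (e (- (y + t)) * e y).
  have [||||_ h] := @cint_fubini R F (fun t => Me * \1_(`[- (l / 2), l / 2]%classic) t) (fun y => normc (e y)).
  + apply: cmeasurableM.
      apply: (@cmeasurable_comp _ _ _ _ RT (fkernel x) fst) => //; exact: cmeasurable_fkernel.
    apply: cmeasurableM; last by apply: (@cmeasurable_comp _ _ _ _ RT e snd).
    apply: (@cmeasurable_comp _ _ _ (RT * RT)%type RT e (fun p => - (p.2 + p.1))) => //.
    by apply: measurable_funN; apply: measurable_funD; [exact: measurable_snd|exact: measurable_fst].
  + by apply: rintegrableZ; exact: rintegrable_itv.
  + exact: cintegrable_normc.
  + move=> t y; rewrite /F normcM normc_fkernel mul1r.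
    have [ht|ht] := boolP (t \in (`[- (l / 2), l / 2]%classic : set R)).
      by rewrite indicE ht mulr1 normcM ler_wpM2r ?normc_ge0.
    rewrite e0 ?normc0 ?mulr_ge0 ?normc_ge0//.
    move: ht; rewrite notin_setE/= in_itv/= => /negP; rewrite negb_and -!ltNge => /orP[]; [left|right] => //.
  transitivity (cint setT (fun t => cint setT (F t))).
    by apply: eq_cint => t; rewrite -(cintZ _ (chi_int t)).
  rewrite h.
  transitivity (cint setT (fun y => fourier e x * (fkernel (- x) y * e y))).
    apply: eq_cint => y.
    transitivity (cint setT (fun t => (fkernel x (- y) * e y) * (fkernel x (t + y) * e (t + y)))).
      apply: eq_cint => t; rewrite /F fkernelD -[fkernel x t in LHS]mulr1 -(fkernel0 x) -(subrr y).
      rewrite fkernelD eev [y + t]addrC.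
      set a1 := fkernel x t; set a2 := fkernel x y; set a3 := fkernel x (- y).
      set b1 := e (t + y); set b2 := e y.
      by move: a1 a2 a3 b1 b2 => a1 a2 a3 b1 b2; ring.
    have iex := cintegrable_fourier x ie.
    rewrite cintZ; last exact: (cintegrable_shift y iex).
    by rewrite (cint_shift y iex) -(fourierE e x) [LHS]mulrC fkernel_opp.
  rewrite (cintZ _ (cintegrable_fourier (- x) ie)) -fourierE.
  have -> : fourier e (- x) = fourier e x.
    by rewrite -(fourier_opp x ie); apply: eq_cint => y; rewrite eev.
  by rewrite fe_real -rmorphM /k expr2.
- by move=> x; rewrite /k sqr_ge0.
- have [cR _] := smooth_ccontinuous sfe.1.
  have ck : continuous k.
    move=> x; apply: (@continuous_comp _ _ _ (fun y => Re (fourier e y)) (fun z : R => z ^+ 2)).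
      exact: cR.
    exact: exprn_continuous.
  have k0 : 0 < k 0.
    rewrite exprn_gt0// fourierE Re_cint.
    under eq_Rintegral do rewrite fkernelC fkernel0 mul1r.
    apply: (@continuous_rint_gt0 (bump (l / 4))).
    - by apply: smooth_real_continuous; exact: smooth_real_bump.
    - by case: ie.
    - exact: bump_ge0.
    - by apply: bump0_gt0; rewrite divr_gt0.
  have [a a0 Ha] := continuous_gt0_near0 ck k0.
  by exists a, (k 0 / 2); split => //; rewrite divr_gt0.
Qed.

End PositiveKernel.

(** * Pseudomeasures *)

Section Pseudomeasures.
Variable R : realType.
Local Notation mu := (@lebesgue_measure R).
Local Notation RT := (measurableTypeR R).
Implicit Types (f : (R -> R[i]) -> R[i]) (phi : R -> R[i]).

Lemma Linfty_bounded (h : R -> R[i]) (M : R) :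
  @cmeasurable R _ RT h -> (forall x, normc (h x) <= M) -> Linfty h.
Proof.
move=> [m1 m2] hM; split => //; split => //; exists M.
exists set0; split; [exact: measurable0|by rewrite measure0|].
by move=> x /= H; apply: H; rewrite norm_normc lecR.
Qed.

(** The bound holds everywhere rather than almost everywhere, which makes sums immediate; both kinds
    of pseudomeasure constructed below satisfy it. *)
Definition bounded_pm f := tempered f /\
  exists (h : R -> R[i]) (M : R), [/\ @cmeasurable R _ RT h, (forall x, normc (h x) <= M) &
    forall phi, schwartz phi -> f (fourier phi) = cint setT (fun x => h x * phi x)].

Lemma bounded_pm_pseudomeasure f : bounded_pm f -> pseudomeasure f.
Proof.
move=> [tf [h [M [mh hM hf]]]]; split => //; exists h; split => //.
exact: Linfty_bounded hM.
Qed.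

Lemma bounded_pmD f1 f2 : bounded_pm f1 -> bounded_pm f2 ->
  bounded_pm (fun phi => f1 phi + f2 phi).
Proof.
move=> [[a1 s1 [K1 [N1 b1]]] [h1 [M1 [m1 hM1 e1]]]] [[a2 s2 [K2 [N2 b2]]] [h2 [M2 [m2 hM2 e2]]]].
split; first split.
- by move=> phi psi sp sq; rewrite a1// a2// addrACA.
- by move=> c phi sp; rewrite s1// s2// mulrDr.
- exists (K1 + K2), (maxn N1 N2) => phi sp M HM.
  have h1' : `|f1 phi| <= (K1 * M)%:C.
    by apply: b1 => // k n kN nN; apply: HM; rewrite leq_max ?kN ?nN.
  have h2' : `|f2 phi| <= (K2 * M)%:C.
    by apply: b2 => // k n kN nN; apply: HM; rewrite leq_max ?kN ?nN orbT.
  by rewrite mulrDl rmorphD (le_trans (ler_normD _ _))// lerD.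
- exists (fun x => h1 x + h2 x), (M1 + M2); split; first exact: cmeasurableD.
    by move=> x; rewrite (le_trans (ler_normcD _ _))// lerD.
  move=> phi sp; have ip := schwartz_cintegrable sp.
  rewrite e1// e2// -(cintD (cintegrable_bddM m1 hM1 ip) (cintegrable_bddM m2 hM2 ip)).
  by apply: eq_cint => x; rewrite mulrDl.
Qed.

(** The functional is the Fourier transform of [b], and inversion identifies its own transform with
    a constant multiple of b(-x), again bounded. Seminorms up to order 2 suffice for continuity, as
    they give the transform of phi the decay 1/(1 + t^2). *)
Lemma bounded_pm_fourier (b : R -> R[i]) (M : R) :
  @cmeasurable R _ RT b -> (forall x, normc (b x) <= M) ->
  bounded_pm (fun phi => cint setT (fun x => b x * fourier phi x)).
Proof.
move=> mb bM.
have M0 : 0 <= M by apply: le_trans (bM 0); exact: normc_ge0.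
have I phi : schwartz phi -> cintegrable (fun x => b x * fourier phi x).
  by move=> sp; apply: cintegrable_bddM bM _ => //; exact: schwartz_fourier_cintegrable.
split; first split.
- move=> phi psi sp sq; rewrite -(cintD (I _ sp) (I _ sq)); apply: eq_cint => x.
  by rewrite (fourierD x (schwartz_cintegrable sp) (schwartz_cintegrable sq)) mulrDr.
- move=> c phi sp; rewrite -(cintZ c (I _ sp)); apply: eq_cint => x.
  by rewrite (fourierZ c x (schwartz_cintegrable sp)) mulrCA.
- set J := \int[mu]_x (1 + x ^+ 2)^-1.
  exists (2 * (M * (16 * J) * J)), 2%N => phi sp L HL.
  have B (u : R -> R[i]) : (forall k x, (k <= 2)%N -> `|x ^+ k * Re (u x)| <= L /\ `|x ^+ k * Im (u x)| <= L) ->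
      forall x, normc (u x) <= (4 * L) / (1 + x ^+ 2).
    move=> h x; rewrite ler_pdivlMr ?ltr_pwDl ?sqr_ge0// mulrDr mulr1.
    have [a1 a2] := h 0%N x isT; have [b1 b2] := h 2%N x isT.
    rewrite !expr0 !mul1r in a1 a2; rewrite normrM in b1; rewrite normrM in b2.
    have := lerD (normc_le_ReIm (u x)) (ler_wpM2r (sqr_ge0 x) (normc_le_ReIm (u x))).
    have xx : `|x ^+ 2| = x ^+ 2 by rewrite ger0_norm// sqr_ge0.
    rewrite xx in b1 b2 => /le_trans; apply; rewrite mulrDl.
    rewrite (mulrC `|Re (u x)|) (mulrC `|Im (u x)|); lra.
  have B0 := B phi (fun k x hk => HL k 0%N hk isT x).
  have B2 := B (cderive (cderive phi)) (fun k x hk => HL k 2%N hk isT x).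
  have D := fourier_decay sp B0 B2.
  rewrite norm_normc lecR.
  have := @normc_cint_le R (fun x => b x * fourier phi x)
    (fun t => M * (16 * L * J) * (1 + t ^+ 2)^-1).
  rewrite (rintZ _ (@rintegrable_oneDsqrV R)) -/J => h.
  have {h} h : normc (cint setT (fun x => b x * fourier phi x)) <= 2 * (M * (16 * L * J) * J).
    apply: h.
    + by apply: cintegrable_measurable; exact: I.
    + by apply: rintegrableZ; exact: rintegrable_oneDsqrV.
    + move=> t; rewrite normcM -[leRHS]mulrA; apply: ler_pM; rewrite ?normc_ge0//.
      by have := D t; rewrite mulrA (_ : 4 * 4 = 16)// -natrM.
  by apply: (le_trans h); rewrite le_eqVlt; apply/orP; left; apply/eqP; ring.
- exists (fun x => (inversion_constant R)%:C * b (- x)), (normc (inversion_constant R)%:C * M).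
  have mb' : @cmeasurable R _ RT (fun x => b (- x)).
    by apply: (@cmeasurable_comp _ _ _ RT RT b (fun x => - x)) => //; exact: opp_measurable.
  split.
  + by apply: cmeasurableM => //; exact: cmeasurable_cst.
  + by move=> x; rewrite normcM ler_wpM2l ?normc_ge0.
  + move=> phi sp; have ip := schwartz_cintegrable sp.
    have ib : cintegrable (fun x => b (- x) * phi x).
      by apply: (cintegrable_bddM (M := M) mb' _ ip) => x; exact: bM.
    transitivity (cint setT (fun x => (inversion_constant R)%:C * (b (- x) * phi x))).
      rewrite -(cint_opp (cintegrableZ (inversion_constant R)%:C ib)); apply: eq_cint => x.
      by rewrite (fourier_inversion sp) opprK mulrCA.
    by apply: eq_cint => x; rewrite mulrA.
Qed.

(** The transform of this functional is the transform of the integrable function [k], hence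
    bounded. *)
Lemma bounded_pm_rapid (k : R -> R[i]) : rapid k ->
  bounded_pm (fun phi => cint setT (fun x => k x * phi x)).
Proof.
move=> rk; have ik := rapid_cintegrable rk.
have I phi : schwartz phi -> cintegrable (fun x => k x * phi x).
  move=> sp; have [M M0 HM] := schwartz_bounded sp.
  apply: (cintegrable_eq (f := fun x => phi x * k x)); first by move=> x; rewrite mulrC.
  by apply: cintegrable_bddM HM ik; exact: smooth_cmeasurable sp.1.
split; first split.
- move=> phi psi sp sq; rewrite -(cintD (I _ sp) (I _ sq)); apply: eq_cint => x.
  by rewrite mulrDr.
- move=> c phi sp; rewrite -(cintZ c (I _ sp)); apply: eq_cint => x.
  by rewrite mulrCA.
- exists (4 * \int[mu]_x normc (k x)), 0%N => phi sp L HL.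
  rewrite norm_normc lecR.
  have := @normc_cint_le R (fun x => k x * phi x) (fun t => (2 * L) * normc (k t)).
  rewrite (rintZ _ (cintegrable_normc ik)) => h.
  have {h} h : normc (cint setT (fun x => k x * phi x)) <= 2 * (2 * L * \int[mu]_x normc (k x)).
    apply: h.
    + by apply: cintegrable_measurable; exact: I.
    + by apply: rintegrableZ; exact: cintegrable_normc.
    + move=> t; rewrite normcM mulrC ler_wpM2r ?normc_ge0//.
      have [h1 h2] := HL 0%N 0%N isT isT t; rewrite !expr0 !mul1r in h1 h2.
      exact: normc_le2.
  by apply: (le_trans h); rewrite le_eqVlt; apply/orP; left; apply/eqP; ring.
- exists (fourier k), (2 * \int[mu]_x normc (k x)); split.
  + by apply: smooth_cmeasurable; exact: smooth_fourier.
  + by move=> x; apply: normc_fourier_le; [exact: rk.1|exact: cintegrable_normc|].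
  + by move=> phi sp; have [] := fourier_swap ik (schwartz_cintegrable sp).
Qed.

(* phi = (psi)^ with psi = c^-1 phi^(-x), so f phi = <f^, psi>; the a.e. bound on f^ is
   turned into an everywhere bound by truncation. *)
Lemma pseudomeasure_test f : pseudomeasure f -> exists (g : R -> R[i]) (M : R),
  [/\ @cmeasurable R _ RT g, (forall x, normc (g x) <= M) &
      forall a b phi, test_fun a b phi -> f phi = cint setT (fun x => g x * fourier phi x)].
Proof.
move=> [_ [h [[mh1 [mh2 [M [N [mN N0 NM]]]]] hf]]].
pose h' x := if normc (h x) <= M then h x else 0.
have mh : @cmeasurable R _ RT h by [].
have mh' : @cmeasurable R _ RT h'.
  apply: (@cmeasurable_if _ _ RT (fun x => normc (h x) <= M) h (fun=> 0)) => //.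
  by apply: measurable_fun_ler; [exact: measurable_normc|exact: measurable_cst].
have h'M x : normc (h' x) <= `|M|.
  by rewrite /h'; case: ifP => [/le_trans -> //|_]; rewrite ?ler_norm// normc0.
pose c := (inversion_constant R)%:C.
have c0 : c != 0 by apply/eqP => /complexI h0; have := @inversion_constant_gt0 R; rewrite h0 ltxx.
exists (fun x => c^-1 * h' (- x)), (normc c^-1 * `|M|); split.
- apply: cmeasurableM; first exact: cmeasurable_cst.
  by apply: (@cmeasurable_comp _ _ _ RT RT h' (fun x => - x)) => //; exact: opp_measurable.
- by move=> x; rewrite normcM ler_wpM2l ?normc_ge0.
move=> a b phi tp; have ip := schwartz_cintegrable (test_fun_schwartz tp).
pose chi x := c^-1 * phi (- x).
have tchi : test_fun (- b) (- a) chi.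
  by apply: (@test_funM R (- b) (- a) (fun x => phi (- x)) (fun=> c^-1)); [exact: test_fun_opp|exact: smooth_cst].
have schi := test_fun_fourier_schwartz tchi.
have -> : phi = fourier (fourier chi).
  apply/funext => t; rewrite (fourier_inversion (test_fun_schwartz tchi)) /chi opprK.
  by rewrite mulrA divff// mul1r.
rewrite (hf _ schi).
have mf := cintegrable_measurable (schwartz_cintegrable schi).
rewrite (@cint_aeeq _ _ (fun x => h' x * fourier chi x)).
- have i' : cintegrable (fun x => h' x * fourier chi x).
    by apply: cintegrable_bddM h'M _ => //; exact: schwartz_cintegrable.
  rewrite -(cint_opp i'); apply: eq_cint => x.
  have -> : fourier (fourier (fourier chi)) x = c * fourier chi (- x).
    by rewrite (fourier_inversion schi).
  by rewrite mulrACA mulVf// mul1r.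
- exact: cmeasurableM.
- exact: cmeasurableM.
- exists N; split => // x H; apply: NM => hM; apply: H.
  have {}hM : normc (h x) <= M by move: hM => /=; rewrite norm_normc lecR.
  by rewrite /= /h' hM.
Qed.

(** The pseudomeasure that represents the limit near t0 = 0 does so on some (c, d), and min(-c, d)
    gives a symmetric interval inside it. The boundary limit thereby becomes integration of a
    bounded function against transforms of test functions. *)
Lemma pm_boundary_test (F : R[i] -> R[i]) : pm_boundary F ->
  exists (l : R) (g : R -> R[i]) (M : R),
  [/\ 0 < l, @cmeasurable R _ RT g, (forall x, normc (g x) <= M) &
      bdry_limit F (- l) l (fun phi => cint setT (fun x => g x * fourier phi x))].
Proof.
move=> [a [b [/andP[a0 b0] [T [limT locT]]]]].
have [c [d [[ac c0 d0 db] [f [pf Tf]]]]] : exists c d, [/\ a <= c, c < 0, 0 < d & d <= b] /\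
    exists f, pseudomeasure f /\ forall phi, test_fun c d phi -> T phi = f phi.
  by apply: locT; rewrite a0.
have [g [M [mg gM fg]]] := pseudomeasure_test pf.
exists (Num.min (- c) d), g, M; split => //; first by rewrite lt_min oppr_gt0 c0.
move=> phi tp.
have tcd : test_fun c d phi.
  by apply: test_fun_W tp; [rewrite lerNr ge_min lexx|rewrite ge_min lexx orbT].
rewrite -(fg _ _ _ tcd) -(Tf _ tcd); apply: limT; exact: test_fun_W tcd.
Qed.

End Pseudomeasures.

(** * Laplace transforms *)

Section LaplaceTransform.
Variable R : realType.
Local Notation mu := (@lebesgue_measure R).
Local Notation RT := (measurableTypeR R).

(** Monotone convergence along the intervals [-n, n]; this is how bounded partial integrals will
    become absolute convergence. *)
Lemma rintegrable_monotone (v : R -> R) (K : R) : measurable_fun setT v ->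
  (forall x, 0 <= v x) ->
  (forall n : nat, rintegrable (fun x => \1_(`[- n%:R, n%:R]%classic) x * v x)) ->
  (forall n : nat, \int[mu]_x (\1_(`[- n%:R, n%:R]%classic) x * v x) <= K) ->
  rintegrable v.
Proof.
move=> mv v0 iv vK; apply/integrableP; split; first exact/measurable_EFinP.
pose F (n : nat) : set RT := `[- n%:R, n%:R]%classic.
have F_T : \bigcup_n F n = setT.
  apply/seteqP; split => // x _; exists (Num.truncn `|x|).+1 => //=.
  by rewrite /F /= in_itv/= -ler_norml ltW// truncnS_gt.
have ndF : nondecreasing_seq F.
  move=> m n mn; rewrite subsetEset => x; rewrite /F /= !in_itv/= -!ler_norml => /le_trans; apply.
  by rewrite ler_nat.
have cv := @ge0_nondecreasing_set_cvg_integral _ RT R F (EFin \o v) mu ndF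
  (fun i => measurable_itv _) (fun i => measurable_funTS ((measurable_EFinP _ _).2 mv))
  (fun i x _ => v0 x).
rewrite F_T in cv.
rewrite (eq_integral (fun x : RT => (v x)%:E)); last by move=> x _ /=; rewrite ger0_norm.
apply: (@le_lt_trans _ _ K%:E); last exact: ltry.
rewrite -(cvg_lim _ cv)//; apply: lime_le; first by apply/cvg_ex; eexists; exact: cv.
apply: nearW => n.
have E : (\int[mu]_(x in F n) (EFin \o v) x = (\int[mu]_x (\1_(F n) x * v x))%:E)%E.
  rewrite /Rintegral fineK; last exact: (integrable_fin_num _ (iv n)).
  rewrite (integral_mkcond (F n)); congr (integral _ _ _); apply/funext => x.
  by rewrite /= /patch indicE; case: (_ \in _); rewrite ?mul1r ?mul0r.
by rewrite E lee_fin vK.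
Qed.

(** A displacement h is covered by floor(h/d) + 1 steps of length at most d, each losing at most
    [M]: a bounded loss on short windows becomes a linear loss on arbitrary ones. *)
Lemma bdd_decreasing_window (u : R -> R) : bdd_decreasing_real u ->
  exists d M X : R, [/\ 0 < d, 0 <= M, 0 <= X &
    forall x h, X <= x -> 0 <= h -> u x - M * (1 + h / d) <= u (x + h)].
Proof.
move=> [d d0 [M [X0 [_ HX]]]].
(* A neighbourhood of +oo contains an open ray x > X0; the shift by 1 allows a closed ray, and the
   maximum with 0 puts it in the half-line. *)
exists d, `|M|, (Num.max (X0 + 1) 0); split => //; first by rewrite le_max lexx orbT.
move=> x h xX0 h0; have := xX0; rewrite ge_max => /andP[xX x0].
have step y k : Num.max (X0 + 1) 0 <= y -> 0 <= k <= d -> u y - `|M| <= u (y + k).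
  rewrite ge_max => /andP[yX _] kd; have := HX y _ k kd; rewrite (lt_le_trans _ yX) ?ltrDl// => /(_ isT).
  by have := ler_norm M; lra.
have many (n : nat) k : 0 <= k <= n.+1%:R * d -> u x - `|M| * n.+1%:R <= u (x + k).
  elim: n k => [|n IH] k /andP[k0 kd].
    by rewrite mulr1 step// k0; move: kd; rewrite mul1r.
  have [kn|nk] := leP k (n.+1%:R * d).
    apply: le_trans (IH k _); last by rewrite k0.
    by rewrite lerB// ler_wpM2l// ler_nat.
  have h1 : u x - `|M| * n.+1%:R <= u (x + n.+1%:R * d).
    by apply: IH; rewrite lexx andbT mulr_ge0// ltW.
  have h2 := step (x + n.+1%:R * d) (k - n.+1%:R * d).
  move: kd; rewrite -natr1 mulrDl mul1r => kd.
  rewrite mulrDr mulr1.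
  have {}h2 : u (x + n.+1%:R * d) - `|M| <= u (x + k).
    rewrite (_ : x + k = x + n.+1%:R * d + (k - n.+1%:R * d)); last by ring.
    apply: h2; last by lra.
    have nd : 0 <= n.+1%:R * d by rewrite mulr_ge0// ltW.
    by rewrite ge_max; apply/andP; split; lra.
  lra.
have hd0 : 0 <= h / d by rewrite divr_ge0// ltW.
have /andP[n1 n2] := truncn_itv hd0.
apply: le_trans (many (Num.truncn (h / d)) h _); last first.
  by rewrite h0/= -ler_pdivrMr// ltW.
rewrite lerB// ler_wpM2l// -[X in X <= _]natr1; lra.
Qed.

Lemma rintegrable_itv_loc (w : R -> R) (a b : R) : mu.-integrable `[a, b] (EFin \o w) ->
  rintegrable (fun x => \1_(`[a, b]%classic) x * w x).
Proof.
move=> i1; have := (@integrable_mkcond _ RT R mu `[a, b]%classic (EFin \o w) (measurable_itv _)).1 i1.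
rewrite /rintegrable; congr (integrable _ _ _); apply/funext => x /=.
by rewrite patchE indicE; case: (x \in _); rewrite ?mul1r ?mul0r.
Qed.

Lemma rintegrable_bddM (u g : R -> R) (M : R) : measurable_fun setT g ->
  (forall x, `|g x| <= M) -> rintegrable u -> rintegrable (fun x => g x * u x).
Proof.
move=> mg gM iu; apply: (rintegrable_le _ (rintegrableZ M (rintegrable_norm iu))).
  by apply: measurable_funM => //; exact: rintegrable_measurable.
by move=> x; rewrite normrM ler_wpM2r.
Qed.

Definition halfline : R -> R := \1_(`[0, +oo[%classic : set R).

Lemma halflineE x : halfline x = if 0 <= x then 1 else 0.
Proof.
rewrite /halfline indicE; have -> : (x \in `[0, +oo[%classic) = (0 <= x); last by case: ifP.
by apply/idP/idP; rewrite inE/= in_itv/= andbT.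
Qed.

Lemma measurable_expRN (s : R) : measurable_fun setT (fun x : RT => expR (- (s * x))).
Proof.
apply: continuous_measurable_fun => x.
apply: (@continuous_comp _ _ _ (fun x : R => - (s * x)) expR); last exact: continuous_expR.
by apply: cvgN; apply: cvgM; [exact: cvg_cst|exact: cvg_id].
Qed.

(** Half of the exponential absorbs the linear factor, by e^(s x/2) >= 1 + s x/2, and the other half
    decays like 1/(1 + x^2). *)
Lemma rintegrable_affine_exp (A B s : R) : 0 <= A -> 0 <= B -> 0 < s ->
  rintegrable (fun x => halfline x * ((A + B * x) * expR (- (s * x)))).
Proof.
move=> A0 B0 s0; have s2 : 0 < s / 2 by rewrite divr_gt0.
apply: (@rintegrable_le _ _ (fun x => ((A + 2 * B / s) * (1 + 4 / (s / 2) ^+ 2)) * (1 + x ^+ 2)^-1)).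
- apply: measurable_funM; first exact: measurable_halfline.
  apply: measurable_funM; last exact: measurable_expRN.
  apply: measurable_funD; first exact: measurable_cst.
  by apply: measurable_funM => //; exact: measurable_cst.
- by apply: rintegrableZ; exact: rintegrable_oneDsqrV.
- move=> x; rewrite halflineE; case: ifP => x0; last first.
    rewrite mul0r normr0 !mulr_ge0 ?invr_ge0 ?addr_ge0 ?sqr_ge0 ?divr_ge0 ?mulr_ge0 ?sqr_ge0// ltW//.
  have Bx : 0 <= B * x by rewrite mulr_ge0.
  rewrite mul1r ger0_norm; last by rewrite mulr_ge0 ?expR_ge0 ?addr_ge0.
  rewrite -mulrA; apply: (@le_trans _ _ ((A + 2 * B / s) * expR (- (s / 2 * x)))); last first.
    rewrite ler_wpM2l ?addr_ge0 ?divr_ge0 ?mulr_ge0//; first exact: ltW.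
    exact: expRN_le.
  have -> : expR (- (s * x)) = expR (- (s / 2 * x)) * expR (- (s / 2 * x)).
    by rewrite -expRD; congr expR; field.
  rewrite mulrA ler_wpM2r ?expR_ge0//.
  have E1 := expR_ge1Dx (s / 2 * x).
  have sx : 0 <= s / 2 * x by rewrite mulr_ge0// ltW.
  rewrite expRN ler_pdivrMr ?expR_gt0// mulrDl; apply: lerD.
    by rewrite ler_peMr//; lra.
  have -> : B * x = 2 * B / s * (s / 2 * x) by field; rewrite gt_eqF.
  by rewrite ler_wpM2l//; [rewrite divr_ge0 ?mulr_ge0// ltW|lra].
Qed.

(** Bounded decrease gives w(x) >= -(A + B x) on [X, oo). Adding A + B x makes the integrand
    nonnegative there, and the convergent improper integral bounds the truncated integrals, so
    monotone convergence applies. The added term is integrable against e^(-s x) and can be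
    subtracted again. *)
Lemma laplace_abs_integrable (w : R -> R) : measurable_fun setT w ->
  (forall a b, mu.-integrable `[a, b] (EFin \o w)) ->
  (forall x, x < 0 -> w x = 0) ->
  (forall s, 0 < s ->
     cvg ((fun n : nat => \int[mu]_x (\1_(`[0, n%:R]%classic) x * (expR (- (s * x)) * w x))) @ \oo)) ->
  bdd_decreasing_real w ->
  forall s, 0 < s -> rintegrable (fun x => expR (- (s * x)) * w x).
Proof.
move=> mw lw w0 cw dw s s0.
have [d [M [X [d0 M0 X0 H]]]] := bdd_decreasing_window dw.
(* From w(x) >= w(X) - M (1 + (x - X)/d), where x - X <= x. *)
pose A := `|w X| + M; pose B := M / d.
have A0 : 0 <= A by rewrite addr_ge0.
have B0 : 0 <= B by rewrite divr_ge0// ltW.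
have wlow x : X <= x -> 0 <= w x + (A + B * x).
  move=> Xx; have xX0 : 0 <= x - X by rewrite subr_ge0.
  have := H X (x - X) (lexx _) xX0; rewrite (_ : X + (x - X) = x); last by ring.
  move=> h.
  have h2 : B * (x - X) <= B * x by rewrite ler_wpM2l// gerBl.
  have h3 : M * (1 + (x - X) / d) = M + B * (x - X) by rewrite /B; field; rewrite gt_eqF.
  have := ler_norm (- w X); rewrite normrN /A; lra.
pose ex x := expR (- (s * x)).
have ex0 x : 0 <= ex x by exact: expR_ge0.
have ex1 x : 0 <= x -> ex x <= 1 by move=> x0; rewrite /ex -expR0 ler_expR oppr_le0 mulr_ge0// ltW.
pose p x := halfline x * ((A + B * x) * ex x).
have ip : rintegrable p by exact: rintegrable_affine_exp.
have p0 x : 0 <= p x.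
  rewrite /p halflineE; case: ifP => x0; rewrite ?mul0r// mul1r.
  by rewrite mulr_ge0// addr_ge0// mulr_ge0.
pose q x := \1_(`[0, X]%classic) x * `|w x|.
have iq : rintegrable q.
  have := rintegrable_norm (rintegrable_itv_loc (lw 0 X)).
  by apply: rintegrable_eq => x; rewrite normrM /q indicE; case: (_ \in _); rewrite ?normr1 ?normr0.
have q0 x : 0 <= q x by rewrite /q mulr_ge0// indicE.
pose v x := if X <= x then (w x + (A + B * x)) * ex x else 0.
have mex : measurable_fun setT (ex : RT -> R) by exact: measurable_expRN.
have mv : measurable_fun setT (v : RT -> R).
  apply: measurable_fun_ifT => //; first by apply: measurable_fun_ler; [exact: measurable_cst|exact: measurable_id].
  apply: measurable_funM => //; apply: measurable_funD => //.
  apply: measurable_funD; first exact: measurable_cst.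
  by apply: measurable_funM => //; exact: measurable_cst.
have v0 x : 0 <= v x by rewrite /v; case: ifP => // xX; rewrite mulr_ge0// wlow.
have ie n : rintegrable (fun x => \1_(`[0, n%:R]%classic) x * (ex x * w x)).
  have h : rintegrable (fun x => (\1_(`[0, n%:R]%classic) x * ex x) * (\1_(`[0, n%:R]%classic) x * w x)).
    apply: (@rintegrable_bddM _ _ 1); last exact: rintegrable_itv_loc.
      by apply: measurable_funM => //; exact: measurable_indic.
    move=> x; rewrite indicE; have [|_] := boolP (_ \in _); last by rewrite mul0r normr0.
    by rewrite inE/= in_itv/= => /andP[x0 _]; rewrite mul1r ger0_norm// ex1.
  by apply: rintegrable_eq h => x; rewrite indicE; case: (_ \in _); rewrite ?mul1r ?mul0r.
have vle n x : \1_(`[- n%:R, n%:R]%classic) x * v x <= \1_(`[0, n%:R]%classic) x * (ex x * w x) + (q x + p x).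
  have [xneg|x0] := ltP x 0.
    rewrite /v ifF ?mulr0; last by apply/negbTE; rewrite -ltNge; exact: lt_le_trans X0.
    by rewrite w0// mulr0 mulr0 add0r addr_ge0.
  have -> : \1_(`[- n%:R, n%:R]%classic) x = \1_(`[0, n%:R]%classic) x :> R.
    rewrite !indicE; congr (nat_of_bool _)%:R; apply/idP/idP; rewrite !inE/= !in_itv/= x0//=.
      by move=> /andP[].
    by move=> ->; rewrite andbT (@le_trans _ _ 0)// oppr_le0.
  rewrite indicE; have [hin|_] := boolP (_ \in _); last by rewrite !mul0r add0r addr_ge0.
  have pE : p x = (A + B * x) * ex x by rewrite /p halflineE x0 mul1r.
  rewrite !mul1r /v; case: ifP => [Xx|/negbT].
    by rewrite pE mulrDl (mulrC (w x)) lerD2l lerDr.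
  rewrite -ltNge => xX.
  have -> : q x = `|w x| by rewrite /q indicE mem_set ?mul1r//= in_itv/= x0 ltW.
  have : `|ex x * w x| <= `|w x| by rewrite normrM (ger0_norm (ex0 x)) ler_piMl// ex1.
  by rewrite ler_norml => /andP[h _]; have := p0 x; lra.
have iv : rintegrable v.
  have [K HK] : exists K, forall n, \int[mu]_x (\1_(`[0, n%:R]%classic) x * (ex x * w x)) <= K.
    have := cvg_seq_bounded (cw s s0) => -[K [_ HK]]; exists (K + 1) => n.
    by apply: le_trans (ler_norm _) _; apply: HK => //; rewrite ltrDl.
  have ivn n : rintegrable (fun x => \1_(`[- n%:R, n%:R]%classic) x * v x).
    apply: (@rintegrable_le _ _ (fun x => \1_(`[0, n%:R]%classic) x * (ex x * w x) + (q x + p x))).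
    - by apply: measurable_funM => //; exact: measurable_indic.
    - by apply: rintegrableD => //; exact: rintegrableD.
    - by move=> x; rewrite ger0_norm// mulr_ge0// indicE.
  apply: (@rintegrable_monotone v (K + \int[mu]_x (q x + p x))) => // n.
  apply: (le_trans (rint_le (ivn n) (rintegrableD (ie n) (rintegrableD iq ip)) (vle n))).
  by rewrite rintD//; [rewrite lerD2r|exact: rintegrableD].
apply: (@rintegrable_le _ _ (fun x => v x + (p x + q x))).
- by apply: measurable_funM.
- by do 2 apply: rintegrableD => //.
- move=> x; have [xneg|x0] := ltP x 0; first by rewrite w0// mulr0 normr0 !addr_ge0.
  rewrite normrM (ger0_norm (ex0 x)).
  have pE : p x = (A + B * x) * ex x by rewrite /p halflineE x0 mul1r.
  have [Xx|xX] := leP X x.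
    have wl := wlow x Xx; have AB : 0 <= A + B * x by rewrite addr_ge0// mulr_ge0.
    rewrite /v Xx pE; apply: (@le_trans _ _ (ex x * (w x + (A + B * x) + (A + B * x)))).
      by rewrite ler_wpM2l// ler_norml; apply/andP; split; lra.
    rewrite (_ : ex x * _ = (w x + (A + B * x)) * ex x + (A + B * x) * ex x); last by ring.
    by rewrite lerD2l lerDl.
  have -> : q x = `|w x| by rewrite /q indicE mem_set ?mul1r//= in_itv/= x0 ltW.
  apply: (@le_trans _ _ `|w x|); first by rewrite ler_piMl// ex1.
  by rewrite addrA lerDr addr_ge0.
Qed.

End LaplaceTransform.

(** * Laplace transforms of complex functions, paired with test functions *)

Section ComplexLaplace.
Variable R : realType.
Local Notation mu := (@lebesgue_measure R).
Local Notation RT := (measurableTypeR R).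
Implicit Types u tau : R -> R[i].

(** Absolute convergence at every abscissa, in a form stable under linear combinations, translations
    to the right and primitives. For such functions [laplace] is a Lebesgue integral instead of an
    improper one. *)
Definition laplace_integrable tau :=
  [/\ @cmeasurable R _ RT tau, (forall x, x < 0 -> tau x = 0) &
      forall s, 0 < s -> cintegrable (fun x => (expR (- (s * x)))%:C * tau x)].

Lemma laplace_kernel_split (s : R[i]) (x : R) :
  cexp (- (s * x%:C)) = (expR (- (Re s * x)))%:C * fkernel (Im s) x.
Proof.
rewrite cexp_split; congr (_%:C * cexp _); first by rewrite ReN ReM /= mulr0 subr0.
by apply: complexP; rewrite ?ReN ?ImN ?ImM /= ?oppr0// mulr0 add0r.
Qed.

Lemma laplace_cintegrable tau (s : R[i]) : laplace_integrable tau -> 0 < Re s ->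
  cintegrable (fun x => tau x * cexp (- (s * x%:C))).
Proof.
move=> [mt t0 it] s0; apply: (cintegrable_eq _ (cintegrable_fourier (Im s) (it _ s0))) => x.
by rewrite laplace_kernel_split [RHS]mulrC mulrA (mulrC (fkernel _ _)).
Qed.

Lemma laplace_partial_cvg tau (s : R[i]) : laplace_integrable tau -> 0 < Re s ->
  (laplace_partial tau s : R -> R[i]^o) @ +oo -->
  (cint setT (fun x => tau x * cexp (- (s * x%:C))) : R[i]^o).
Proof.
move=> lt s0; have [mt t0 it] := lt; have ic := laplace_cintegrable lt s0.
have mF : @cmeasurable R _ RT (fun x => tau x * cexp (- (s * x%:C))).
  exact: cintegrable_measurable.
have H (a : R -> R) : rintegrable a -> (forall x, x < 0 -> a x = 0) ->
    \int[mu]_(x in `[0, T]) a x @[T --> +oo] --> \int[mu]_x a x.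
  move=> ia a0; apply/cvg_pinftyP => t tt.
  have E n : \int[mu]_(x in `[0, t n]) a x = \int[mu]_x (\1_(`[0, t n]%classic) x * a x).
    rewrite Rintegral_mkcond; apply: eq_Rintegral => x _.
    by rewrite patchE indicE; case: (_ \in _); rewrite ?mul1r ?mul0r.
  under eq_fun do rewrite E.
  have [n|x||n x|_ //] := @rint_dominated_seq R (fun n x => \1_(`[0, t n]%classic) x * a x) a (fun x => `|a x|).
  - apply: measurable_funM; last exact: rintegrable_measurable.
    exact: measurable_indic.
  - apply: (@cvg_trans _ ((fun=> a x) @ \oo)); last exact: cvg_cst.
    apply: near_eq_cvg; near=> n; rewrite indicE.
    have [xneg|x0] := ltP x 0; first by rewrite a0// mulr0.
    rewrite mem_set ?mul1r//= in_itv/= x0.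
    by near: n; move/cvgryPge : tt; apply.
  - exact: rintegrable_norm.
  - by rewrite normrM ler_piMl// indicE; case: (_ \in _); rewrite ?normr1 ?normr0.
have Z x : x < 0 -> tau x * cexp (- (s * x%:C)) = 0 by move=> /t0 ->; rewrite mul0r.
apply/cvg_complexP; split; apply: H.
- by case: ic.
- by move=> x /Z ->.
- by case: ic.
- by move=> x /Z ->.
Unshelve. all: by end_near. Qed.

Lemma laplaceE tau (s : R[i]) : laplace_integrable tau -> 0 < Re s ->
  laplace tau s = cint setT (fun x => tau x * cexp (- (s * x%:C))).
Proof.
move=> lt s0; have h := laplace_partial_cvg lt s0.
by apply: (cvg_lim (@norm_hausdorff _ (R[i]^o))) h.
Qed.

Lemma laplace_fourier tau (s t : R) : laplace_integrable tau -> 0 < s ->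
  laplace tau (s +i* t) = fourier (fun x => (expR (- (s * x)))%:C * tau x) t.
Proof.
move=> lt s0; rewrite laplaceE//; apply: eq_cint => x.
by rewrite laplace_kernel_split [LHS]mulrC mulrAC [LHS]mulrC mulrA mulrAC -mulrA.
Qed.

(** On the line of abscissa s the Laplace transform is the Fourier transform of e^(-s x) tau(x), and
    the multiplication formula moves that transform onto [phi]. *)
Lemma laplace_test tau (s : R) (phi : R -> R[i]) : laplace_integrable tau -> 0 < s ->
  cintegrable phi ->
  [/\ cintegrable (fun t => laplace tau (s +i* t) * phi t),
      cintegrable (fun x => (expR (- (s * x)))%:C * tau x * fourier phi x) &
      cint setT (fun t => laplace tau (s +i* t) * phi t) =
      cint setT (fun x => (expR (- (s * x)))%:C * tau x * fourier phi x)].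
Proof.
move=> lt s0 iphi; have [_ _ it] := lt; have is' := it s s0.
have [h1 h2] := fourier_swap iphi is'.
have [h3 h4] := fourier_swap is' iphi.
have E t : phi t * fourier (fun x => (expR (- (s * x)))%:C * tau x) t = laplace tau (s +i* t) * phi t.
  by rewrite laplace_fourier// mulrC.
split; [exact: (cintegrable_eq E)|exact: h3|].
rewrite -(eq_cint E) h2; apply: eq_cint => x; by rewrite mulrC.
Qed.

(** At real s the kernel is real, so convergence of the complex partial integrals splits into real
    and imaginary parts, to each of which bounded decrease applies. *)
Lemma laplace_integrableP tau : loc_integrable tau -> (forall x, x < 0 -> tau x = 0) ->
  laplace_converges tau -> bdd_decreasing tau -> laplace_integrable tau.
Proof.
move=> [m1 [m2 li]] t0 lc [d1 d2].
have E (s : R) (x : R) : tau x * cexp (- (s%:C * x%:C)) = (expR (- (s * x)))%:C * tau x.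
  by rewrite -rmorphM -rmorphN cexp_real mulrC.
have C (s : R) : 0 < s -> exists l : R[i],
    (Re (laplace_partial tau s%:C T) @[T --> +oo] --> Re l) /\
    (Im (laplace_partial tau s%:C T) @[T --> +oo] --> Im l).
  move=> s0; have /cvg_ex[l /cvg_complexP h] := lc s%:C s0; by exists l.
split; [by []|by []|] => s s0; split.
  apply: (rintegrable_eq (u := fun x => expR (- (s * x)) * Re (tau x))).
    by move=> x; rewrite Re_realM.
  apply: laplace_abs_integrable => //.
  - by move=> a b; have [] := li a b.
  - by move=> x /t0 ->.
  - move=> e e0; have [l [/cvg_pinftyP h _]] := C e e0.
    have := h _ (@cvgr_idn R) => h'; apply/cvg_ex; exists (Re l).
    apply: cvg_trans h'; apply: near_eq_cvg; apply: nearW => n.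
    rewrite /laplace_partial /cint /= Rintegral_mkcond; apply: eq_Rintegral => x _.
    by rewrite patchE indicE; case: (_ \in _); rewrite ?mul1r ?mul0r// E Re_realM.
apply: (rintegrable_eq (u := fun x => expR (- (s * x)) * Im (tau x))).
  by move=> x; rewrite Im_realM.
apply: laplace_abs_integrable => //.
- by move=> a b; have [] := li a b.
- by move=> x /t0 ->.
- move=> e e0; have [l [_ /cvg_pinftyP h]] := C e e0.
  have := h _ (@cvgr_idn R) => h'; apply/cvg_ex; exists (Im l).
  apply: cvg_trans h'; apply: near_eq_cvg; apply: nearW => n.
  rewrite /laplace_partial /cint /= Rintegral_mkcond; apply: eq_Rintegral => x _.
  by rewrite patchE indicE; case: (_ \in _); rewrite ?mul1r ?mul0r// E Im_realM.
Qed.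

End ComplexLaplace.

(** * The boundary relation *)

Section BoundaryRelation.
Variable R : realType.
Local Notation mu := (@lebesgue_measure R).
Local Notation RT := (measurableTypeR R).
Implicit Types (G : R[i] -> R[i]) (phi : R -> R[i]).

Lemma cintegrable_compact_support (f : R -> R[i]) (c d : R) :
  (forall x, x < c \/ d < x -> f x = 0) ->
  (forall x, c <= x <= d -> {for x, continuous (fun y => Re (f y))} /\
                          {for x, continuous (fun y => Im (f y))}) ->
  cintegrable f.
Proof.
move=> f0 cf.
have H (u : R -> R) : (forall x, x < c \/ d < x -> u x = 0) ->
    (forall x, c <= x <= d -> {for x, continuous u}) -> rintegrable u.
  move=> u0 cu.
  have : mu.-integrable `[c, d] (EFin \o u).
    apply: continuous_compact_integrable; first exact: segment_compact.
    by apply: continuous_in_subspaceT => x; rewrite inE/= in_itv/= => /cu.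
  move/rintegrable_itv_loc; apply: rintegrable_eq => x; rewrite indicE.
  have [_|] := boolP (x \in `[c, d]%classic); first by rewrite mul1r.
  rewrite notin_setE/= in_itv/= => /negP; rewrite negb_and -!ltNge => /orP xcd.
  by rewrite u0 ?mulr0.
split; apply: H => x h.
- by rewrite f0.
- by have [] := cf x h.
- by rewrite f0.
- by have [] := cf x h.
Qed.

(** For 0 < s < r/2 and |t| <= r/2 the point s + it stays in the half-disc of radius r, where [G] is
    continuous; off the support of [phi] the product is 0. *)
Lemma analytic_cintegrable G (r l s : R) phi : analytic_near0 G r -> 0 < r -> l <= r / 2 ->
  test_fun (- l) l phi -> 0 < s < r / 2 ->
  cintegrable (fun t => G (s +i* t) * phi t).
Proof.
move=> aG r0 lr [sp [c [d [lc dl p0]]]] /andP[s0 sr].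
apply: (@cintegrable_compact_support _ c d) => [x /p0 ->|t /andP[ct td]]; first by rewrite mulr0.
have [cp1 cp2] := smooth_ccontinuous sp.
have zr : complex.Re (s +i* t) ^+ 2 + complex.Im (s +i* t) ^+ 2 < r ^+ 2.
  have h1 : s ^+ 2 < (r / 2) ^+ 2 by rewrite ltr_pXn2r// nnegrE ltW//; lra.
  have h2 : t ^+ 2 <= (r / 2) ^+ 2.
    have h3 : `|t| <= r / 2 by rewrite ler_norml; apply/andP; split; lra.
    by rewrite -real_normK ?num_real// ler_pXn2r// nnegrE//; lra.
  have h4 : (r / 2) ^+ 2 + (r / 2) ^+ 2 < r ^+ 2.
    have : 0 < r ^+ 2 by rewrite exprn_gt0.
    by rewrite (_ : (r / 2) ^+ 2 = r ^+ 2 / 4); [lra|field].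
  by apply: lt_trans h4; exact: ltr_leD.
have cG : {for s +i* t, continuous (G : R[i]^o -> R[i]^o)}.
  by apply: differentiable_continuous; apply/derivable1_diffP; exact: aG.
have cpath : ((fun y : R => s +i* y) : R -> R[i]^o) @ t --> (s +i* t : R[i]^o).
  by apply/cvg_complexP => /=; split; [exact: cvg_cst|exact: cvg_id].
have cGt : ((fun y => G (s +i* y)) : R -> R[i]^o) @ t --> (G (s +i* t) : R[i]^o).
  exact: (cvg_comp _ _ cpath cG).
have /cvg_complexP[g1 g2] := cGt.
have S1 : Re (G (s +i* y) * phi y) @[y --> t] --> Re (G (s +i* t) * phi t).
  under eq_fun do rewrite ReM.
  by rewrite ReM; apply: cvgB; apply: cvgM => //; [exact: cp1|exact: cp2].
have S2 : Im (G (s +i* y) * phi y) @[y --> t] --> Im (G (s +i* t) * phi t).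
  under eq_fun do rewrite ImM.
  by rewrite ImM; apply: cvgD; apply: cvgM => //; [exact: cp2|exact: cp1].
by split; [exact: S1|exact: S2].
Qed.

Lemma cvg_right_mul0 (f : R -> R[i]) (l : R[i]) :
  (f : R -> R[i]^o) @ 0^'+ --> (l : R[i]^o) ->
  ((fun s : R => s%:C * f s) : R -> R[i]^o) @ 0^'+ --> (0 : R[i]^o).
Proof.
move/cvg_complexP => [f1 f2].
have i0 : (fun s : R => s) @ 0^'+ --> (0 : R) by apply: cvg_at_right_filter; exact: cvg_id.
apply/cvg_complexP; split.
  under eq_fun do rewrite Re_realM.
  rewrite (_ : Re (0 : R[i]) = 0 * Re l); last by rewrite mul0r.
  exact: (cvgM i0 f1).
under eq_fun do rewrite Im_realM.
rewrite (_ : Im (0 : R[i]) = 0 * Im l); last by rewrite mul0r.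
exact: (cvgM i0 f2).
Qed.

Lemma test_fun_mult (a b : R) phi : test_fun a b phi -> test_fun a b (fun t => (0 +i* t) * phi t).
Proof.
move=> tp; apply: test_funM => //; split => /=; first exact: smooth_real_cst.
exact: smooth_real_id.
Qed.

(* s L{tau} = s Q + G with Q = L{tau} - G/s, tested against phi. *)
Lemma boundary_relation (tau : R -> R[i]) G (r l : R) (q g : R -> R[i]) phi :
  laplace_integrable tau -> analytic_near0 G r -> 0 < r -> l <= r / 2 ->
  bdry_limit (fun s => laplace tau s - G s / s) (- l) l
    (fun chi => cint setT (fun x => q x * fourier chi x)) ->
  bdry_limit G (- l) l (fun chi => cint setT (fun x => g x * fourier chi x)) ->
  test_fun (- l) l phi ->
  ((fun s : R => cint setT (fun x => (expR (- (s * x)))%:C * tau x *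
      (s%:C * fourier phi x + fourier (fun t => (0 +i* t) * phi t) x))) : R -> R[i]^o)
   @ 0^'+ --> (cint setT (fun x => q x * fourier (fun t => (0 +i* t) * phi t) x) +
               cint setT (fun x => g x * fourier phi x) : R[i]^o).
Proof.
move=> lt aG r0 lr limQ limG tp.
have tp' := test_fun_mult tp.
have ip := schwartz_cintegrable (test_fun_schwartz tp).
have ip' := schwartz_cintegrable (test_fun_schwartz tp').
pose Q s := laplace tau s - G s / s.
have key (s : R) : 0 < s < r / 2 ->
  cint setT (fun x => (expR (- (s * x)))%:C * tau x *
      (s%:C * fourier phi x + fourier (fun t => (0 +i* t) * phi t) x)) =
  s%:C * cint setT (fun t => Q (s +i* t) * phi t) +
  cint setT (fun t => Q (s +i* t) * ((0 +i* t) * phi t)) +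
  cint setT (fun t => G (s +i* t) * phi t).
  move=> sr; have s0 : 0 < s by case/andP: sr.
  have [L1 F1 E1] := laplace_test lt s0 ip.
  have [L2 F2 E2] := laplace_test lt s0 ip'.
  have iG := analytic_cintegrable aG r0 lr tp sr.
  have iG' := analytic_cintegrable aG r0 lr tp' sr.
  have sn0 t : (s +i* t) != 0 :> R[i].
    by apply/eqP => -[s00 _]; move: s0; rewrite s00 ltxx.
  have ninv t : normc ((s +i* t)^-1) <= s^-1.
    rewrite normcV lef_pV2 ?posrE//.
      by apply: le_trans (Re_le_normc (s +i* t)); rewrite /= ler_norm.
    by apply: (lt_le_trans s0); apply: le_trans (Re_le_normc (s +i* t)); rewrite /= ler_norm.
  have minv : @cmeasurable R _ RT (fun t => (s +i* t)^-1).
    split.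
      rewrite (_ : (fun t => _) = (fun t => s / (s ^+ 2 + t ^+ 2))); last by [].
      apply: continuous_measurable_fun => t; apply: cvgM; first exact: cvg_cst.
      apply: cvgV; first by rewrite gt_eqF// ltr_pwDl ?exprn_gt0 ?sqr_ge0.
      by apply: cvgD; [exact: cvg_cst|exact: exprn_continuous].
    rewrite (_ : (fun t => _) = (fun t => - t / (s ^+ 2 + t ^+ 2))); last first.
      by apply/funext => t /=; rewrite mulNr.
    apply: continuous_measurable_fun => t; apply: cvgM; first by apply: cvgN; exact: cvg_id.
    apply: cvgV; first by rewrite gt_eqF// ltr_pwDl ?exprn_gt0 ?sqr_ge0.
    by apply: cvgD; [exact: cvg_cst|exact: exprn_continuous].
  have iQ psi : cintegrable (fun t => laplace tau (s +i* t) * psi t) ->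
      cintegrable (fun t => G (s +i* t) * psi t) -> cintegrable (fun t => Q (s +i* t) * psi t).
    move=> h1 h2; have h3 := cintegrable_bddM minv ninv h2.
    apply: (cintegrable_eq _ (cintegrableB h1 h3)) => t.
    by rewrite /Q mulrBl; congr (_ - _); rewrite mulrA (mulrC (_^-1)).
  have iQ1 := iQ _ L1 iG; have iQ2 := iQ _ L2 iG'.
  have -> : cint setT (fun x => (expR (- (s * x)))%:C * tau x *
      (s%:C * fourier phi x + fourier (fun t => (0 +i* t) * phi t) x)) =
    cint setT (fun x => s%:C * ((expR (- (s * x)))%:C * tau x * fourier phi x) +
      (expR (- (s * x)))%:C * tau x * fourier (fun t => (0 +i* t) * phi t) x).
    by apply: eq_cint => x; rewrite mulrDr; congr (_ + _); rewrite mulrCA.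
  rewrite (cintD (cintegrableZ s%:C F1) F2) (cintZ s%:C F1) -E1 -E2.
  rewrite -(cintZ s%:C L1) -(cintD (cintegrableZ s%:C L1) L2).
  rewrite -(cintZ s%:C iQ1) -(cintD (cintegrableZ s%:C iQ1) iQ2).
  rewrite -(cintD (cintegrableD (cintegrableZ s%:C iQ1) iQ2) iG).
  apply: eq_cint => t; rewrite /Q.
  have -> : s%:C = (s +i* t) - (0 +i* t) by apply: complexP; rewrite ?ReB ?ImB /= ?subr0 ?subrr.
  have := sn0 t; move: (s +i* t) (0 +i* t) (laplace tau (s +i* t)) (G (s +i* t)) (phi t) => z y L g0 p z0.
  by field.
(* The integral multiplied by s converges, as [Q] has a boundary limit, so its term vanishes. *)
have lim : ((fun s : R => s%:C * cint setT (fun t => Q (s +i* t) * phi t) +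
  cint setT (fun t => Q (s +i* t) * ((0 +i* t) * phi t)) +
  cint setT (fun t => G (s +i* t) * phi t)) : R -> R[i]^o) @ 0^'+ -->
  (0 + cint setT (fun x => q x * fourier (fun t => (0 +i* t) * phi t) x) +
               cint setT (fun x => g x * fourier phi x) : R[i]^o).
  apply: cvgD; last exact: limG.
  apply: cvgD; last exact: limQ.
  exact: (cvg_right_mul0 (limQ _ tp)).
rewrite add0r in lim; apply: cvg_trans lim; apply: near_eq_cvg; near=> s.
apply/esym/key; apply/andP; split; first by near: s; exact: nbhs_right_gt.
by near: s; apply: nbhs_right_lt; rewrite divr_gt0.
Unshelve. all: by end_near. Qed.

End BoundaryRelation.

(** * The boundary relation tested against a kernel and its translates *)

Section KernelRelation.
Variable R : realType.
Local Notation mu := (@lebesgue_measure R).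
Local Notation RT := (measurableTypeR R).

(** The convolution kappa * 1_[a,b], written as a superposition of translates of [kappa]; this is
    the form in which it is later bounded below. *)
Definition smear (kappa : R -> R) (a b x : R) : R :=
  \int[mu]_v (\1_(`[a, b]%classic) v * kappa (x - v)).

Lemma smear_ge0 kappa a b x : (forall y, 0 <= kappa y) -> 0 <= smear kappa a b x.
Proof. by move=> k0; apply: rint_ge0 => v; rewrite mulr_ge0// indicE. Qed.

Lemma rapid_indic (a b : R) : rapid (fun x => (\1_(`[a, b]%classic) x : R)%:C).
Proof.
split; first by apply: cmeasurable_real; exact: measurable_indic.
move=> n; apply: (rintegrable_eq _ (rintegrable_itv_continuous a b (u := fun x => `|x| ^+ n) _)).
  move=> x; rewrite normc_real indicE mulrC; congr (_ * _).
  by case: (_ \in _); rewrite ?normr1 ?normr0.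
move=> x; apply: (@continuous_comp _ _ _ (fun x : R => `|x|) (fun z : R => z ^+ n)).
  exact: norm_continuous.
exact: exprn_continuous.
Qed.

(** Multiplication by it differentiates the indicator into a difference of point masses. The
    interval is reflected because the test function is transformed once more, which turns [-b, -a]
    back into [a, b]. *)
Lemma fourier_indic_mult (a b t : R) : a <= b ->
  (0 +i* t) * fourier (fun v => (\1_(`[- b, - a]%classic) v : R)%:C) t =
  fkernel (- b) t - fkernel (- a) t.
Proof.
move=> ab; have [->|t0] := eqVneq t 0.
  by rewrite !fkernel0 subrr (_ : 0 +i* 0 = 0 :> R[i])// mul0r.
have it0 : (0 +i* t) != 0 :> R[i] by apply: contra t0 => /eqP[->].
have -> : fourier (fun v => (\1_(`[- b, - a]%classic) v : R)%:C) t =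
    cint `[- b, - a] (fun v => cexp (- ((0 +i* t) * v%:C))).
  rewrite cint_indic; apply: eq_cint => v; rewrite [RHS]mulrC; congr (_ * _).
  by congr cexp; congr (- _); apply: complexP; rewrite ?ReM ?ImM /=; ring.
rewrite cint_itv_cexp ?lerN2// mulrC divfK//.
by congr (_ - _); rewrite fkernelE; congr cexp; apply: complexP;
  rewrite ?ReN ?ImN ?ReM ?ImM /=; ring.
Qed.

Variables (l : R) (chi : R -> R[i]) (kappa : R -> R).
Hypothesis tchi : test_fun (- l) l chi.
Hypothesis chiE : forall x, fourier chi x = (kappa x)%:C.

(** The transform of an indicator is smooth and [chi] supplies the compact support, so this is a
    test function; its own transform is [smear kappa a b]. *)
Definition smear_test (a b : R) (t : R) : R[i] :=
  fourier (fun v => (\1_(`[- b, - a]%classic) v : R)%:C) t * chi t.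

Lemma test_fun_smear a b : test_fun (- l) l (smear_test a b).
Proof. by apply: test_funM => //; apply: smooth_fourier; exact: rapid_indic. Qed.

Lemma fourier_smear_test a b x : fourier (smear_test a b) x = (smear kappa a b x)%:C.
Proof.
have ichi := schwartz_cintegrable (test_fun_schwartz tchi).
have iI := rapid_cintegrable (rapid_indic (- b) (- a)).
transitivity (cint setT (fun t => (fkernel x t * chi t) *
    fourier (fun v => (\1_(`[- b, - a]%classic) v : R)%:C) t)).
  by apply: eq_cint => t; rewrite /smear_test mulrCA [LHS]mulrC.
have [_ ->] := fourier_swap (cintegrable_fourier x ichi) iI.
have E v : fourier (fun t => fkernel x t * chi t) v * (\1_(`[- b, - a]%classic) v : R)%:C =
    (\1_(`[- b, - a]%classic) v * kappa (x + v))%:C.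
  by rewrite -{1}[x]opprK fourier_modulate opprK chiE rmorphM mulrC addrC.
rewrite (eq_cint E) cint_real; congr (_%:C).
rewrite /smear -[LHS]rint_opp.
  apply: eq_Rintegral => v _; congr (_ * _).
  by rewrite !indicE; congr (nat_of_bool _)%:R; apply/idP/idP; rewrite !inE/= !in_itv/= !lerN2 andbC.
have : cintegrable (fun v => fourier (fun t => fkernel x t * chi t) v * (\1_(`[- b, - a]%classic) v : R)%:C).
  apply: (@cintegrable_bddM _ _ _ (2 * \int[mu]_y normc (chi y))) => //.
    by apply: smooth_cmeasurable; apply: smooth_fourier; have [m r] := schwartz_rapid (test_fun_schwartz tchi);
      split; [by apply: cmeasurableM => //; exact: cmeasurable_fkernel|
              move=> n; apply: (rintegrable_eq _ (r n)) => y; rewrite normcM normc_fkernel mul1r].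
  move=> v; apply: normc_fourier_le.
  - by apply: cintegrable_measurable; exact: cintegrable_fourier.
  - exact: cintegrable_normc.
  - by move=> y; rewrite normcM normc_fkernel mul1r.
by move=> [+ _]; apply: rintegrable_eq => v; rewrite E.
Qed.

Lemma fourier_smear_test_mult a b x : a <= b ->
  fourier (fun t => (0 +i* t) * smear_test a b t) x = (kappa (x - b) - kappa (x - a))%:C.
Proof.
move=> ab; have ichi := schwartz_cintegrable (test_fun_schwartz tchi).
have -> : (fun t => (0 +i* t) * smear_test a b t) =
    (fun t => fkernel (- b) t * chi t + - 1 * (fkernel (- a) t * chi t)).
  by apply/funext => t; rewrite /smear_test mulrA fourier_indic_mult// mulrBl mulN1r.
have ib := cintegrable_fourier (- b) ichi; have ia := cintegrable_fourier (- a) ichi.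
rewrite (fourierD x ib (cintegrableZ (-1) ia)) (fourierZ _ x ia) !fourier_modulate !chiE.
by rewrite mulN1r rmorphB.
Qed.

(** Decay of order four leaves (1 + x^2) kappa(x) integrable; the first moment of [kappa] will
    control the comparison with a primitive. *)
Lemma kernel_decay : exists2 C : R, 0 <= C & forall x, `|kappa x| * (1 + x ^+ 2) ^+ 2 <= C.
Proof.
have sk := test_fun_fourier_schwartz tchi.
have [K0 H0] := schwartz_bound 0 sk; have [K2 H2] := schwartz_bound 2 sk.
have H x : `|kappa x| * (1 + x ^+ 2) ^+ 2 <= `|K0| + `|K2|.
  have := H0 x; have := H2 x; rewrite chiE normc_real expr0 mul1r real_normK ?num_real//.
  rewrite !ler_pdivlMr ?ltr_pwDl ?sqr_ge0// => h2 h0.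
  rewrite (_ : _ * _ = `|kappa x| * (1 + x ^+ 2) + x ^+ 2 * `|kappa x| * (1 + x ^+ 2)); last by ring.
  by apply: lerD; [apply: (le_trans h0)|apply: (le_trans h2)]; exact: ler_norm.
by exists (`|K0| + `|K2|).
Qed.

Lemma kernel_continuous : continuous kappa.
Proof.
have [c _] := smooth_ccontinuous (test_fun_fourier_schwartz tchi).1.
by move: c; rewrite (_ : (fun x => Re (fourier chi x)) = kappa)//; apply/funext => x; rewrite chiE.
Qed.

Lemma kernel_relation (tau : R -> R[i]) (G : R[i] -> R[i]) (r : R) (q g : R -> R[i]) (a b : R) :
  laplace_integrable tau -> analytic_near0 G r -> 0 < r -> l <= r / 2 ->
  bdry_limit (fun s => laplace tau s - G s / s) (- l) l
    (fun chi => cint setT (fun x => q x * fourier chi x)) ->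
  bdry_limit G (- l) l (fun chi => cint setT (fun x => g x * fourier chi x)) ->
  a <= b ->
  ((fun s : R => cint setT (fun x => (expR (- (s * x)))%:C * tau x *
      (s * smear kappa a b x + (kappa (x - b) - kappa (x - a)))%:C)) : R -> R[i]^o)
   @ 0^'+ --> (cint setT (fun x => q x * (kappa (x - b) - kappa (x - a))%:C) +
               cint setT (fun x => g x * (smear kappa a b x)%:C) : R[i]^o).
Proof.
move=> lt aG r0 lr limQ limG ab.
have := boundary_relation lt aG r0 lr limQ limG (test_fun_smear a b).
rewrite (eq_cint (g := fun x => q x * (kappa (x - b) - kappa (x - a))%:C)); last first.
  by move=> x; rewrite fourier_smear_test_mult.
rewrite (eq_cint (f := fun x => g x * fourier (smear_test a b) x)
  (g := fun x => g x * (smear kappa a b x)%:C)); last first.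
  by move=> x; rewrite fourier_smear_test.
apply: cvg_trans; apply: near_eq_cvg; apply: nearW => s; apply: eq_cint => x.
by rewrite fourier_smear_test fourier_smear_test_mult// -rmorphM -rmorphD.
Qed.

End KernelRelation.

(** * Bounded oscillation *)

(** Here e is e^(-s h). The leading parts of [I3], [I1] and [I2] are (1 - e) N, e A and N, so I3 +
    I1 - I2 leaves e (A - N), and [N], for which no bound uniform in s is known, cancels exactly.
    The errors are multiples of M J and C. *)
Lemma increase_arith (F : realFieldType) (e M J C sh E A N N' I1 I2 I3 : F) :
  0 <= e -> e <= 1 -> 0 <= M -> 0 <= J -> 0 <= C -> 0 <= sh -> sh <= 1 -> 0 <= E -> E <= J ->
  e * A - C <= I1 -> I2 <= N + C -> (1 - e) * N' - sh * C <= I3 -> N - M * J <= N' ->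
  e * (A - N + M * E) <= I3 + (I1 - I2) + 2 * M * J + 3 * C.
Proof.
move=> e0 e1 M0 J0 C0 sh0 sh1 E0 EJ L1 L2 L3 L4.
have P1 : (1 - e) * (N - M * J) <= (1 - e) * N' by rewrite ler_wpM2l// subr_ge0.
have P2 : e * (M * E) <= M * J.
  apply: (@le_trans _ _ (M * E)); last by rewrite ler_wpM2l.
  by rewrite ler_piMl// mulr_ge0.
have P3 : sh * C <= C by rewrite ler_piMl.
have P4 : 0 <= e * (M * J) by rewrite !mulr_ge0.
nra.
Qed.

Lemma scale_arith (F : fieldType) (s h e n c : F) : s != 0 ->
  (1 - e) * n - s * h * c = s * ((1 - e) / s * n - h * c).
Proof. by move=> s0; field. Qed.

(** * Upper bounds for the increments of a boundedly decreasing function *)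

Section OneSidedIncrease.
Variable R : realType.
Local Notation mu := (@lebesgue_measure R).
Local Notation RT := (measurableTypeR R).

Variables (w kappa : R -> R) (M X h S : R).
Hypothesis w0 : forall x, x < 0 -> w x = 0.
Hypothesis lw : forall a b, mu.-integrable `[a, b] (EFin \o w).
Hypothesis iw : forall s, 0 < s -> rintegrable (fun x => expR (- (s * x)) * w x).
Hypothesis (M0 : 0 <= M) (X0 : 0 <= X) (h0 : 0 < h).
Hypothesis window : forall x v, X <= x -> 0 <= v <= h -> w x - M <= w (x + v).
Hypothesis k0 : forall x, 0 <= kappa x.
Hypothesis kS : forall x, kappa x <= S.
Hypothesis kc : continuous kappa.
Hypothesis ik : rintegrable kappa.
Hypothesis msmear : forall a b, measurable_fun setT (smear kappa a b : RT -> R).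

Let S0 : 0 <= S. Proof. exact: le_trans (k0 0) (kS 0). Qed.
Let J := \int[mu]_x kappa x.
(** Left of [X] nothing is known about increments, and a shift by v <= h carries such points at most
    to X + h. Up to there |w| is integrable, and [C] bounds its whole contribution. *)
Let q x := \1_(`[0, X + h]%classic) x * `|w x|.
Let C := S * \int[mu]_x q x.
Let H1 (x : R) : R := if X <= x then 1 else 0.

Let iq : rintegrable q.
Proof.
have := rintegrable_norm (rintegrable_itv_loc (lw 0 (X + h))).
by apply: rintegrable_eq => x; rewrite normrM /q indicE; case: (_ \in _); rewrite ?normr1 ?normr0.
Qed.

Let q0 x : 0 <= q x. Proof. by rewrite /q mulr_ge0// indicE. Qed.

Let C0 : 0 <= C. Proof. by rewrite mulr_ge0// rint_ge0. Qed.

Let mH1 : measurable_fun setT (H1 : RT -> R).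
Proof.
apply: measurable_fun_ifT => //.
by apply: measurable_fun_ler; [exact: measurable_cst|exact: measurable_id].
Qed.

Let mk (y : R) : measurable_fun setT (fun x : RT => kappa (x - y)).
Proof.
apply: continuous_measurable_fun => x.
by apply: (@continuous_comp _ _ _ (fun x => x - y) kappa); [apply: cvgB; [exact: cvg_id|exact: cvg_cst]|exact: kc].
Qed.

Let iky (y : R) : rintegrable (fun x => kappa (x - y)).
Proof. exact: (rintegrable_shift (- y) ik). Qed.

Let H1k_bdd y x : `|H1 x * kappa (x - y)| <= S.
Proof. by rewrite /H1; case: ifP => _; rewrite ?mul0r ?normr0// mul1r ger0_norm. Qed.

Section FixedSigma.
Variables (s y : R).
Hypothesis s0 : 0 < s.
Let ex x := expR (- (s * x)).
Let U x := ex x * w x.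
Let k x := kappa (x - y).

Let kk0 x : 0 <= k x. Proof. exact: k0. Qed.
Let kkS x : `|k x| <= S. Proof. by rewrite ger0_norm// /k. Qed.
Let ex0 x : 0 <= ex x. Proof. exact: expR_ge0. Qed.
Let ex1 x : 0 <= x -> ex x <= 1.
Proof. by move=> x0; rewrite /ex -expR0 ler_expR oppr_le0 mulr_ge0// ltW. Qed.
Let exD x v : ex (x + v) = ex v * ex x.
Proof. by rewrite /ex -expRD; congr expR; ring. Qed.

Let iU : rintegrable U. Proof. exact: iw. Qed.

Let iUk v : rintegrable (fun x => U (x + v) * k x).
Proof.
apply: (rintegrable_eq (u := fun x => k x * U (x + v))); first by move=> x; rewrite mulrC.
apply: (@rintegrable_bddM _ _ _ S); [exact: mk| |exact: (rintegrable_shift v iU)].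
by move=> x; exact: kkS.
Qed.

Let iHk v : rintegrable (fun x => H1 x * (w (x + v) * ex x * k x)).
Proof.
apply: (rintegrable_eq (u := fun x => (H1 x * k x) * (expR (s * v) * U (x + v)))).
  move=> x; rewrite /U exD /ex.
  have -> : expR (s * v) * (expR (- (s * v)) * expR (- (s * x)) * w (x + v)) =
     (expR (s * v) * expR (- (s * v))) * (expR (- (s * x)) * w (x + v)) by ring.
  by rewrite -expRD subrr expR0; ring.
apply: (@rintegrable_bddM _ _ _ S); [|exact: H1k_bdd|].
  by apply: measurable_funM => //; exact: mk.
exact: rintegrableZ (rintegrable_shift v iU).
Qed.

Let iHek : rintegrable (fun x => H1 x * (ex x * k x)).
Proof.
apply: (rintegrable_le _ (iky y)) => [|x].
  by apply: measurable_funM => //; apply: measurable_funM; [exact: measurable_expRN|exact: mk].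
rewrite /H1; case: ifP => [Xx|_]; last by rewrite mul0r normr0.
rewrite mul1r ger0_norm; last exact: mulr_ge0.
by rewrite -/(k x) ler_piMl// ex1// (le_trans X0).
Qed.

Let Hek_le : \int[mu]_x (H1 x * (ex x * k x)) <= J.
Proof.
rewrite /J -(rint_shift (- y) ik); apply: rint_le; [exact: iHek|exact: iky|] => x.
rewrite -/(k x) /H1; case: ifP => [Xx|_]; last by rewrite mul0r.
by rewrite mul1r ler_piMl// ex1// (le_trans X0).
Qed.

Let Uk_le x : 0 <= x -> `|U x| <= `|w x|.
Proof. by move=> x0; rewrite /U normrM (ger0_norm (ex0 _)) ler_piMl// ex1. Qed.

(** U(x + v) is e^(-s v) e^(-s x) w(x + v). For x >= X the minorant [a] is inserted; for x < X the
    point x + v is either negative, where [w] is 0, or in [0, X + h], where [C] pays for it. *)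
Let lower v (a : R -> R) : 0 <= v <= h -> rintegrable (fun x => H1 x * (a x * ex x * k x)) ->
  (forall x, X <= x -> a x <= w (x + v)) ->
  ex v * (\int[mu]_x (H1 x * (a x * ex x * k x))) - C <= \int[mu]_x (U (x + v) * k x).
Proof.
move=> /andP[v0 vh] ia aw.
rewrite -(rintZ _ ia) /C -(rint_shift v iq) -(rintZ _ (rintegrable_shift v iq)).
have i1 := rintegrableZ (ex v) ia; have i2 := rintegrableZ S (rintegrable_shift v iq).
rewrite -RintegralB//; apply: rint_le => //; first exact: rintegrableB.
move=> x; rewrite /H1; case: ifP => [Xx|/negbT].
  apply: (@le_trans _ _ (ex v * (1 * (a x * ex x * k x)))).
    by rewrite gerBl mulr_ge0.
  rewrite mul1r /U exD -(subr_ge0).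
  rewrite (_ : _ - _ = ex v * ex x * k x * (w (x + v) - a x)); last by ring.
  by apply: mulr_ge0; [rewrite !mulr_ge0|rewrite subr_ge0 aw].
rewrite -ltNge => xX; rewrite mul0r mulr0 sub0r.
have [xv|xv] := ltP (x + v) 0.
  by rewrite /U w0// mulr0 mul0r oppr_le0 mulr_ge0.
have -> : q (x + v) = `|w (x + v)|.
  rewrite /q indicE mem_set ?mul1r//= in_itv/= xv/=; lra.
have : `|U (x + v) * k x| <= S * `|w (x + v)|.
  by rewrite normrM [leLHS]mulrC; apply: ler_pM => //; exact: Uk_le.
by rewrite ler_norml => /andP[].
Qed.

Let N := \int[mu]_x (H1 x * (w x * ex x * k x)).
Let A := \int[mu]_x (H1 x * (w (x + h) * ex x * k x)).

Let iN : rintegrable (fun x => H1 x * (w x * ex x * k x)).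
Proof. by apply: rintegrable_eq (iHk 0) => x; rewrite addr0. Qed.

Let upper : \int[mu]_x (U x * k x) <= N + C.
Proof.
have i0 : rintegrable (fun x => U x * k x).
  by apply: rintegrable_eq (iUk 0) => x; rewrite addr0.
rewrite /C -(rintZ _ iq) -rintD//; last exact: rintegrableZ.
apply: rint_le => //; first by apply: rintegrableD => //; exact: rintegrableZ.
move=> x; rewrite /H1; case: ifP => [Xx|/negbT].
  by rewrite mul1r /U (mulrC (ex x)) lerDl mulr_ge0.
rewrite -ltNge => xX; rewrite mul0r add0r.
have [x0|x0] := ltP x 0; first by rewrite /U w0// mulr0 mul0r mulr_ge0.
have -> : q x = `|w x|.
  rewrite /q indicE mem_set ?mul1r//= in_itv/= x0/=; have := ltW h0; lra.
apply: (le_trans (ler_norm _)); rewrite normrM [leLHS]mulrC.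
by apply: ler_pM => //; exact: Uk_le.
Qed.

Let N' := \int[mu]_x (H1 x * ((w x - M) * ex x * k x)).

Let iN' : rintegrable (fun x => H1 x * ((w x - M) * ex x * k x)).
Proof.
by apply: (rintegrable_eq _ (rintegrableB iN (rintegrableZ M iHek))) => x; ring.
Qed.

Let N'_ge : N - M * J <= N'.
Proof.
have -> : N' = N - M * \int[mu]_x (H1 x * (ex x * k x)).
  rewrite /N /N' -(rintZ _ iHek) -RintegralB; [|by []|exact: iN|exact: rintegrableZ iHek].
  by apply: eq_Rintegral => x _; ring.
by rewrite lerB// ler_wpM2l.
Qed.

(** Multiplied by s, this weight is 1 - e^(-s h), the exact complement of the factor e^(-s h) that a
    shift by h produces; the cancellation of [N] depends on it. *)
Let window_integral : \int[mu]_v (\1_(`[y, y + h]%classic) v * ex (v - y)) = (1 - ex h) / s.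
Proof.
transitivity (\int[mu]_(v in `[y, y + h]) ex (v - y)).
  rewrite [RHS]Rintegral_mkcond; apply: eq_Rintegral => v _.
  by rewrite patchE indicE; case: (_ \in _); rewrite ?mul1r ?mul0r.
have dF (v : R) : is_derive v 1 (fun v => - s^-1 * expR (- s * v + s * y)) (ex (v - y)).
  have := @is_derive_affine _ expR (- s) (s * y) v _ (is_derive_expR _).
  move/(is_derive_fZ (- s^-1)) => d; apply: (is_derive_eq1 d).
  rewrite mulrA mulrNN mulVf ?gt_eqF// mul1r /ex; congr expR; ring.
rewrite (@continuous_FTC _ (fun v => - s^-1 * expR (- s * v + s * y)))//.
- rewrite /ex (_ : - s * y + s * y = 0); last by ring.
  rewrite expR0 (_ : - s * (y + h) + s * y = - (s * h)); last by ring.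
  by field; rewrite gt_eqF.
- by rewrite lerDl ltW.
- move=> v; apply: (@continuous_comp _ _ _ (fun v => - (s * (v - y))) expR); last exact: continuous_expR.
  by apply: cvgN; apply: cvgM; [exact: cvg_cst|apply: cvgB; [exact: cvg_id|exact: cvg_cst]].
Qed.

Let F (v x : R) := \1_(`[y, y + h]%classic) v * (U x * kappa (x - v)).

Let fubiniF : rintegrable (fun v => \int[mu]_x F v x) /\
  \int[mu]_v (\int[mu]_x F v x) = \int[mu]_x (\int[mu]_v F v x).
Proof.
apply: (@rint_fubini _ F (fun v => S * \1_(`[y, y + h]%classic) v) (fun x => `|U x|)).
- apply: measurable_funM.
    exact: (measurableT_comp (@measurable_indic_itv R y (y + h)) measurable_fst).
  apply: measurable_funM.
    exact: (measurableT_comp (rintegrable_measurable iU) measurable_snd).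
  have md : measurable_fun setT (fun p : RT * RT => (p.2 - p.1 : RT)).
    by apply: measurable_funB; [exact: measurable_snd|exact: measurable_fst].
  exact: (measurableT_comp (continuous_measurable_fun kc) md).
- by apply: rintegrableZ; exact: rintegrable_itv.
- exact: rintegrable_norm.
- move=> v x; rewrite /F normrM (normrM (U x)) (ger0_norm (k0 _)).
  rewrite -[leRHS]/((S * \1_(`[y, y + h]%classic) v) * `|U x|) (mulrC S) -[leRHS]mulrA (mulrC S).
  rewrite [X in X * _ <= _]ger0_norm; last by rewrite indicE.
  by apply: ler_wpM2l; [rewrite indicE|apply: ler_wpM2l].
Qed.

(** For each v in [y, y + h] a shift by v - y turns kappa(x - v) into kappa(x - y) and w(x) into w(x
    + v - y) >= w(x) - M. The factors e^(-s (v - y)) then integrate to (1 - e^(-s h))/s. *)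
Let smear_lower : (1 - ex h) * N' - s * h * C <= s * \int[mu]_x (U x * smear kappa y (y + h) x).
Proof.
have [iF eF] := fubiniF.
have E2 x : \int[mu]_v F v x = U x * smear kappa y (y + h) x.
  rewrite /smear -rintZ; first by apply: eq_Rintegral => v _; rewrite /F mulrCA.
  apply: (rintegrable_eq (u := fun v => kappa (x - v) * \1_(`[y, y + h]%classic) v)).
    by move=> v; rewrite mulrC.
  apply: (@rintegrable_bddM _ _ _ S); [| |exact: rintegrable_itv].
    apply: continuous_measurable_fun => v.
    by apply: (@continuous_comp _ _ _ (fun v => x - v) kappa); [apply: cvgB; [exact: cvg_cst|exact: cvg_id]|exact: kc].
  by move=> v; rewrite ger0_norm.
under eq_Rintegral do rewrite -E2.
rewrite -eF.
have iexv : rintegrable (fun v => \1_(`[y, y + h]%classic) v * ex (v - y)).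
  apply: rintegrable_itv_continuous => v.
  apply: (@continuous_comp _ _ _ (fun v => - (s * (v - y))) expR); last exact: continuous_expR.
  by apply: cvgN; apply: cvgM; [exact: cvg_cst|apply: cvgB; [exact: cvg_id|exact: cvg_cst]].
have i1 := rintegrable_itv y (y + h).
have B : (1 - ex h) / s * N' - h * C <= \int[mu]_v (\int[mu]_x F v x).
  have -> : (1 - ex h) / s * N' - h * C =
      \int[mu]_v (N' * (\1_(`[y, y + h]%classic) v * ex (v - y)) + - C * \1_(`[y, y + h]%classic) v).
    rewrite (rintD (rintegrableZ N' iexv) (rintegrableZ (- C) i1)).
    have yh : y <= y + h by rewrite lerDl ltW.
    rewrite (rintZ N' iexv) (rintZ (- C) i1) window_integral (integral_itv_indic yh); ring.
  apply: rint_le; [exact: rintegrableD (rintegrableZ N' iexv) (rintegrableZ (- C) i1)|exact: iF|].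
  move=> v; rewrite /F; have [hv|hv] := boolP (v \in (`[y, y + h]%classic : set R)); last first.
    rewrite indicE (negbTE hv) /= mul0r !mulr0 addr0.
    by under eq_Rintegral do rewrite mul0r; rewrite /Rintegral integral0.
  rewrite indicE hv /= mul1r mulr1; under eq_Rintegral do rewrite mul1r.
  have vy : 0 <= v - y <= h by move: hv; rewrite inE/= in_itv/= subr_ge0 lerBlDl.
  have := @lower (v - y) (fun x => w x - M) vy iN' (fun x Xx => window Xx vy).
  rewrite -/N' mulrC => /le_trans; apply; rewrite le_eqVlt; apply/orP; left; apply/eqP.
  have iUv : rintegrable (fun x => U x * kappa (x - v)).
    apply: (rintegrable_eq (u := fun x => kappa (x - v) * U x)); first by move=> x; rewrite mulrC.
    by apply: (@rintegrable_bddM _ _ _ S); [exact: mk|move=> x; rewrite ger0_norm|].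
  rewrite -(rint_shift (v - y) iUv); apply: eq_Rintegral => x _.
  by rewrite /k; congr (_ * kappa _); ring.
rewrite (scale_arith _ _ _ _ (lt0r_neq0 s0)).
exact: (ler_wpM2l (ltW s0) B).
Qed.

Lemma increase_integrable :
  rintegrable (fun x => H1 x * ((w (x + h) - w x + M) * ex x * k x)).
Proof.
apply: (rintegrable_eq _ (rintegrableD (rintegrableB (iHk h) iN) (rintegrableZ M iHek))) => x.
by ring.
Qed.

(** Lower bounds for the smeared and the shifted integral meet the upper bound for the unshifted
    one. The condition s h <= 1 keeps the error s h C of the smeared term below C as s -> 0+. *)
Lemma weighted_increase_le : s * h <= 1 ->
  ex h * (\int[mu]_x (H1 x * ((w (x + h) - w x + M) * ex x * k x))) <=
  \int[mu]_x (U x * (s * smear kappa y (y + h) x + (kappa (x - (y + h)) - kappa (x - y)))) +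
  2 * M * J + 3 * C.
Proof.
move=> sh; have h01 : 0 <= h <= h by rewrite lexx ltW.
have L1 := @lower h (fun x => w (x + h)) h01 (iHk h) (fun x _ => lexx _).
have L2 := upper; have L3 := smear_lower; have L4 := N'_ge.
have e0 := ex0 h; have e1 := ex1 (ltW h0).
have J0 : 0 <= J by exact: rint_ge0.
have iUy : rintegrable (fun x => U x * k x).
  by apply: rintegrable_eq (iUk 0) => x; rewrite addr0.
have iUh : rintegrable (fun x => U x * kappa (x - (y + h))).
  apply: (rintegrable_eq (u := fun x => kappa (x - (y + h)) * U x)); first by move=> x; rewrite mulrC.
  by apply: (@rintegrable_bddM _ _ _ S); [exact: mk|move=> x; rewrite ger0_norm|].
have EU : \int[mu]_x (U (x + h) * k x) = \int[mu]_x (U x * kappa (x - (y + h))).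
  rewrite -(rint_shift h iUh); apply: eq_Rintegral => x _.
  by rewrite /k; congr (_ * kappa _); ring.
have [iF eF] := fubiniF.
have iUK : rintegrable (fun x => U x * smear kappa y (y + h) x).
  have kx x : `|smear kappa y (y + h) x| <= S * h.
    rewrite ger0_norm; last exact: smear_ge0.
    apply: (le_trans (ler_norm _)).
    apply: (@le_trans _ _ (\int[mu]_v (S * \1_(`[y, y + h]%classic) v))); last first.
      rewrite rintZ; last exact: rintegrable_itv.
      have yh : y <= y + h by rewrite lerDl ltW.
      by rewrite (integral_itv_indic yh) (addrC y) addrK.
    apply: rint_norm_le.
    - apply: measurable_funM; first exact: measurable_indic.
      apply: continuous_measurable_fun => v.
      by apply: (@continuous_comp _ _ _ (fun v => x - v) kappa); [apply: cvgB; [exact: cvg_cst|exact: cvg_id]|exact: kc].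
    - by apply: rintegrableZ; exact: rintegrable_itv.
    - move=> v; rewrite normrM (ger0_norm (k0 _)) [X in X * _ <= _]ger0_norm; last by rewrite indicE.
      by rewrite mulrC; apply: ler_wpM2r => //; rewrite indicE.
  apply: (rintegrable_eq (u := fun x => smear kappa y (y + h) x * U x)); first by move=> x; rewrite mulrC.
  by apply: (@rintegrable_bddM _ _ _ (S * h)); [exact: msmear|exact: kx|exact: iU].
have -> : \int[mu]_x (U x * (s * smear kappa y (y + h) x + (kappa (x - (y + h)) - kappa (x - y)))) =
    s * \int[mu]_x (U x * smear kappa y (y + h) x) +
    (\int[mu]_x (U x * kappa (x - (y + h))) - \int[mu]_x (U x * k x)).
  rewrite -(rintZ _ iUK) -(RintegralB measurableT iUh iUy).
  rewrite -(rintD (rintegrableZ s iUK) (rintegrableB iUh iUy)).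
  by apply: eq_Rintegral => x _; rewrite /k; ring.
have -> : \int[mu]_x (H1 x * ((w (x + h) - w x + M) * ex x * k x)) =
    A - N + M * \int[mu]_x (H1 x * (ex x * k x)).
  rewrite /A /N -(rintZ _ iHek) -(RintegralB measurableT (iHk h) iN).
  rewrite -rintD; [|exact: rintegrableB (iHk h) iN|exact: rintegrableZ].
  by apply: eq_Rintegral => x _; ring.
rewrite -/A EU in L1; rewrite -/N in L2.
have E0 : 0 <= \int[mu]_x (H1 x * (ex x * k x)).
  apply: rint_ge0 => x; rewrite /H1; case: ifP => _; last by rewrite mul0r; exact: lexx.
  by rewrite mul1r; exact: mulr_ge0 (ex0 x) (kk0 x).
exact: (increase_arith e0 e1 M0 J0 C0 (mulr_ge0 (ltW s0) (ltW h0)) sh E0 Hek_le L1 L2 L3 L4).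
Qed.

End FixedSigma.

(** With h = 2a, every x in [y - a, y] satisfies x <= y and y + b <= x + h, both gaps being at most
    h. Two uses of the window give w(y + b) - w(y) - M <= w(x + h) - w(x) + M, and kappa(x - y) >= c
    on that interval of length a, so the weighted mean controls the increment. The bound [D0] does
    not depend on y. *)
Lemma increase_bounded (a c D0 : R) : h = 2 * a -> 0 < a -> 0 < c ->
  (forall x, `|x| <= a -> c <= kappa x) ->
  (forall y, 0 <= y -> exists2 D, D <= D0 &
     \int[mu]_x (expR (- (s * x)) * w x * (s * smear kappa y (y + h) x +
        (kappa (x - (y + h)) - kappa (x - y)))) @[s --> 0^'+] --> D) ->
  exists K, forall y b, X + a <= y -> 0 <= b <= a -> w (y + b) - w y <= K.
Proof.
move=> ha a0 c0 kc0 HD; exists (M + `|D0 + 2 * M * J + 3 * C| / (a * c)) => y b yX /andP[b0 ba].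
have ac0 : 0 < a * c by rewrite mulr_gt0.
have [yX' y0] : X <= y /\ 0 <= y by have := X0; split; lra.
have [D DD0 cD] := HD y y0.
have [Dl DlE] : exists Dl, Dl = w (y + b) - w y - M by exists (w (y + b) - w y - M).
suff : a * c * Dl <= `|D0 + 2 * M * J + 3 * C|.
  by rewrite mulrC -(ler_pdivlMr _ _ ac0) DlE lerBlDl.
have [Dl0|Dl0] := ltP Dl 0.
  by apply: (@le_trans _ _ 0); [rewrite pmulr_rle0// ltW|].
(* The exponent h + y collects e^(-s h) from the weighted estimate and e^(-s y), the least value of
   e^(-s x) on [y - a, y]. *)
have bound : \forall s \near 0^'+, expR (- (s * (h + y))) * (a * c * Dl) <=
   \int[mu]_x (expR (- (s * x)) * w x * (s * smear kappa y (y + h) x +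
        (kappa (x - (y + h)) - kappa (x - y)))) + (2 * M * J + 3 * C).
  near=> s; have s0 : 0 < s by near: s; exact: nbhs_right_gt.
  have sh : s * h <= 1.
    by rewrite -ler_pdivlMr//; near: s; apply: nbhs_right_le; rewrite divr_gt0.
  have := @weighted_increase_le s y s0 sh; rewrite -addrA => /(le_trans _); apply.
  rewrite (_ : - (s * (h + y)) = - (s * h) + - (s * y)); last by ring.
  rewrite expRD -[leLHS]mulrA ler_wpM2l ?expR_ge0//.
  have iB : rintegrable (fun x => H1 x * ((w (x + h) - w x + M) * expR (- (s * x)) * kappa (x - y))).
    exact: increase_integrable.
  apply: (@le_trans _ _ (\int[mu]_x ((expR (- (s * y)) * (c * Dl)) * \1_(`[y - a, y]%classic) x))).
    rewrite rintZ; last exact: rintegrable_itv.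
    rewrite integral_itv_indic; last by rewrite gerBl ltW.
    rewrite (_ : y - (y - a) = a); last by ring.
    by rewrite le_eqVlt; apply/orP; left; apply/eqP; ring.
  apply: rint_le; [by apply: rintegrableZ; exact: rintegrable_itv|exact: iB|] => x.
  have pos : X <= x -> 0 <= w (x + h) - w x + M.
    by move=> Xx; have := @window x h Xx; rewrite lexx ltW// => /(_ isT); lra.
  rewrite indicE; have [|_] := boolP (x \in _); last first.
    rewrite mulr0 /H1; case: ifP => [Xx|_]; rewrite ?mul0r// mul1r.
    by rewrite !mulr_ge0 ?expR_ge0// pos.
  rewrite inE/= in_itv/= mulr1 => /andP[yx xy].
  have Xx : X <= x by lra.
  rewrite /H1 Xx mul1r.
  rewrite [leRHS](_ : _ = expR (- (s * x)) * (kappa (x - y) * (w (x + h) - w x + M))); last by ring.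
  have e1 : expR (- (s * y)) <= expR (- (s * x)) by rewrite ler_expR lerN2 ler_wpM2l// ltW.
  have k1 : c <= kappa (x - y) by apply: kc0; rewrite ler_norml; apply/andP; split; lra.
  have d1 : Dl <= w (x + h) - w x + M.
    have w1 : w (y + b) - M <= w (x + h).
      rewrite (_ : x + h = (y + b) + (x + h - (y + b))); last by ring.
      by apply: window; [|apply/andP; split]; lra.
    have w2 : w x - M <= w y.
      have -> : w y = w (x + (y - x)) by congr w; ring.
      by apply: window => //; apply/andP; split; lra.
    by rewrite DlE; lra.
  apply: ler_pM => //; rewrite ?expR_ge0 ?mulr_ge0 ?(ltW c0)//.
  by apply: ler_pM => //; rewrite ltW.
have l1 : expR (- (s * (h + y))) * (a * c * Dl) @[s --> 0^'+] --> 1 * (a * c * Dl).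
  apply: cvgMl; apply: cvg_at_right_filter.
  rewrite -[X in _ --> X](_ : expR (- (0 * (h + y))) = 1); last by rewrite mul0r oppr0 expR0.
  apply: (@continuous_comp _ _ _ (fun s : R => - (s * (h + y))) expR); last exact: continuous_expR.
  by apply: cvgN; apply: cvgM; [exact: cvg_id|exact: cvg_cst].
have l2 : \int[mu]_x (expR (- (s * x)) * w x * (s * smear kappa y (y + h) x +
        (kappa (x - (y + h)) - kappa (x - y)))) + (2 * M * J + 3 * C) @[s --> 0^'+] -->
      D + (2 * M * J + 3 * C).
  by apply: cvgD; [exact: cD|exact: cvg_cst].
have : 1 * (a * c * Dl) <= D + (2 * M * J + 3 * C) by exact: (ler_cvg_to l1 l2 bound).
rewrite mul1r => /le_trans; apply.
by apply: le_trans (ler_norm _); rewrite addrA lerD2r lerD2r.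
Unshelve. all: by end_near. Qed.

End OneSidedIncrease.

(** * Comparison with a primitive *)

Section KernelEstimates.
Variable R : realType.
Local Notation mu := (@lebesgue_measure R).
Local Notation RT := (measurableTypeR R).

(** Peetre's inequality: decay in x - z is traded for decay in x at the cost of a factor 1 + z^2,
    which turns convolution bounds into the product bounds that Fubini asks for. *)
Lemma peetre (x z : R) : (1 + (x - z) ^+ 2)^-1 <= 2 * (1 + z ^+ 2) * (1 + x ^+ 2)^-1.
Proof.
rewrite ler_pdivlMr ?ltr_pwDl ?sqr_ge0// mulrC ler_pdivrMr ?ltr_pwDl ?sqr_ge0//.
have -> : x = z + (x - z) by ring.
rewrite [z + _ - z](_ : _ = x - z); last by ring.
move: (x - z) => w; have := sqr_ge0 (z - w); have := sqr_ge0 (z * w).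
rewrite exprMn !expr2; nra.
Qed.

Lemma indic_itv01 (a b x : R) : 0 <= (\1_(`[a, b]%classic) x : R) <= 1.
Proof. by rewrite indicE; case: (_ \in _); rewrite /= ?lexx ?ler01. Qed.

Lemma indic_itv_le (y x : R) :
  (\1_(`[0, y]%classic) x : R) <= (1 + y ^+ 2) * (1 + x ^+ 2)^-1.
Proof.
have p : 0 < 1 + x ^+ 2 by rewrite ltr_pwDl ?sqr_ge0.
rewrite indicE; have [|_] := boolP (_ \in _); last first.
  by rewrite mulr_ge0 ?invr_ge0 ?addr_ge0 ?sqr_ge0.
rewrite inE/= in_itv/= => /andP[x0 xy]; rewrite ler_pdivlMr// mul1r lerD2l.
by rewrite ler_pXn2r// nnegrE// (le_trans x0).
Qed.

(** The two indicators can differ only where x lies within |z| of an endpoint of [0, y]. *)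
Lemma indic_itv_shift (y x z : R) : 0 <= y ->
  `|(\1_(`[0, y]%classic) (x - z) : R) - \1_(`[0, y]%classic) x| <=
  (\1_(`[- `|z|, `|z|]%classic) x : R) + \1_(`[y - `|z|, y + `|z|]%classic) x.
Proof.
move=> y0; rewrite !indicE.
have E (a b c : R) : (c \in (`[a, b]%classic : set R)) = (a <= c <= b).
  by apply/idP/idP; rewrite inE/= in_itv.
rewrite !E; have := ler_norm z; have := ler_norm (- z); rewrite normrN; move: `|z| => w zw1 zw2.
have [/andP[a1 a2]|] := boolP (0 <= x - z <= y).
  have [_|] := boolP (0 <= x <= y); first by rewrite subrr normr0 addr_ge0.
  rewrite negb_and -!ltNge => /orP[h|h].
    have -> : (- w <= x <= w) by apply/andP; split; lra.
    by rewrite /= subr0 normr1 lerDl.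
  have -> : (y - w <= x <= y + w) by apply/andP; split; lra.
  by rewrite /= subr0 normr1 lerDr.
have [/andP[a1 a2]|_ _] := boolP (0 <= x <= y); last by rewrite subrr normr0 addr_ge0.
rewrite negb_and -!ltNge => /orP[h|h].
  have -> : (- w <= x <= w) by apply/andP; split; lra.
  by rewrite /= sub0r normrN normr1 lerDl.
have -> : (y - w <= x <= y + w) by apply/andP; split; lra.
by rewrite /= sub0r normrN normr1 lerDr.
Qed.

Variables (kappa : R -> R) (C : R).
Hypothesis k0 : forall x, 0 <= kappa x.
Hypothesis kd : forall x, `|kappa x| * (1 + x ^+ 2) ^+ 2 <= C.
Hypothesis kc : continuous kappa.

Let mk : measurable_fun setT (kappa : RT -> R).
Proof. exact: continuous_measurable_fun. Qed.

Lemma kernel_decay2 x : kappa x * (1 + x ^+ 2) <= C * (1 + x ^+ 2)^-1.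
Proof.
rewrite ler_pdivlMr ?ltr_pwDl ?sqr_ge0// -mulrA -expr2.
by have := kd x; rewrite ger0_norm.
Qed.

Lemma kernel_bounded x : kappa x <= C.
Proof.
have := kd x; rewrite ger0_norm// => /(le_trans _); apply.
by rewrite ler_peMr// exprn_ege1// lerDl sqr_ge0.
Qed.

Lemma kernel_moment_integrable : rintegrable (fun x => (1 + `|x|) * kappa x).
Proof.
apply: (rintegrable_le _ (rintegrableZ (2 * C) (@rintegrable_oneDsqrV R))).
  apply: measurable_funM => //; apply: measurable_funD; first exact: measurable_cst.
  exact: (measurableT_comp (@normr_measurable _ _)).
move=> x; rewrite ger0_norm ?mulr_ge0 ?addr_ge0//.
apply: (@le_trans _ _ (2 * (kappa x * (1 + x ^+ 2)))); last first.
  by rewrite -mulrA ler_wpM2l//; exact: kernel_decay2.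
rewrite (mulrC (kappa x)) mulrA ler_wpM2r// -(real_normK (num_real x)).
by have := sqr_ge0 (`|x| - 1); rewrite !expr2; nra.
Qed.

Lemma kernel_integrable : rintegrable kappa.
Proof.
apply: (rintegrable_le _ kernel_moment_integrable) => // x.
by rewrite ger0_norm// ler_peMl// lerDl.
Qed.

Let J := \int[mu]_x kappa x.
Let K1 := \int[mu]_x ((1 + `|x|) * kappa x).

Lemma smear_conv y x : smear kappa 0 y x = \int[mu]_z (kappa z * \1_(`[0, y]%classic) (x - z)).
Proof.
pose u z := kappa z * \1_(`[0, y]%classic) (x - z).
have mi : measurable_fun setT (fun z : RT => \1_(`[0, y]%classic) (x - z) : R).
  have md : measurable_fun setT (fun z : RT => (x - z : RT)).
    by apply: measurable_funB; [exact: measurable_cst|exact: measurable_id].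
  exact: (measurableT_comp (@measurable_indic_itv R 0 y) md).
have iu : rintegrable u.
  apply: (rintegrable_le _ kernel_integrable); first exact: measurable_funM.
  move=> z; have /andP[i0 i1] := indic_itv01 0 y (x - z).
  by rewrite ger0_norm ?mulr_ge0// ler_piMr.
rewrite /smear -(rint_opp iu) -(rint_shift (- x) (rintegrable_opp iu)).
by apply: eq_Rintegral => v _; rewrite /u opprB subKr mulrC.
Qed.

Section Smear.
Variable y : R.
Hypothesis y0 : 0 <= y.
(** The absolute value of the integrand in z whose integral is the difference between
    [smear kappa 0 y] and J times the indicator of [0, y], at x. *)
Let D z x := kappa z * `|(\1_(`[0, y]%classic) (x - z) : R) - \1_(`[0, y]%classic) x|.

Let mD : measurable_fun setT (fun p : RT * RT => D p.1 p.2).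
Proof.
apply: measurable_funM; first exact: (measurableT_comp mk measurable_fst).
apply: (measurableT_comp (@normr_measurable _ _)).
apply: measurable_funB; last exact: (measurableT_comp (@measurable_indic_itv R 0 y) measurable_snd).
have md : measurable_fun setT (fun p : RT * RT => (p.2 - p.1 : RT)).
  by apply: measurable_funB; [exact: measurable_snd|exact: measurable_fst].
exact: (measurableT_comp (@measurable_indic_itv R 0 y) md).
Qed.

(** A product bound that licenses Fubini. Its dependence on y is harmless: the bound uniform in y is
    found after the order of integration has been exchanged. *)
Let D_le z x : `|D z x| <= C * (1 + z ^+ 2)^-1 * (3 * (1 + y ^+ 2) * (1 + x ^+ 2)^-1).
Proof.
rewrite /D ger0_norm ?mulr_ge0//.
apply: (@le_trans _ _ ((kappa z * (1 + z ^+ 2)) * (3 * (1 + y ^+ 2) * (1 + x ^+ 2)^-1))).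
  rewrite -mulrA ler_wpM2l// (le_trans (ler_normB _ _))//.
  have /andP[i0 i1] := indic_itv01 0 y (x - z); have /andP[j0 j1] := indic_itv01 0 y x.
  rewrite !ger0_norm//.
  have h1 := le_trans (indic_itv_le y (x - z)) (ler_wpM2l (addr_ge0 ler01 (sqr_ge0 y)) (peetre x z)).
  have h2 := indic_itv_le y x.
  have p1 : 0 <= (1 + y ^+ 2) * (1 + x ^+ 2)^-1.
    by rewrite mulr_ge0 ?invr_ge0 ?addr_ge0 ?sqr_ge0.
  have p2 := mulr_ge0 p1 (sqr_ge0 z).
  apply: (le_trans (lerD h1 h2)).
  move: (1 + x ^+ 2)^-1 (1 + y ^+ 2) (z ^+ 2) p1 p2 => a b c p1 p2; nra.
rewrite ler_wpM2r ?kernel_decay2//.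
by rewrite !mulr_ge0 ?invr_ge0 ?addr_ge0 ?sqr_ge0.
Qed.

Let iV (k : R) : rintegrable (fun x : R => k * (1 + x ^+ 2)^-1).
Proof. exact: rintegrableZ (@rintegrable_oneDsqrV R). Qed.

Let fubiniD := @rint_fubini _ D _ _ mD (iV C) (iV (3 * (1 + y ^+ 2))) D_le.

Let e x := \int[mu]_z D z x.

Let ie : rintegrable e.
Proof.
have mD' : measurable_fun setT (fun p : RT * RT => D p.2 p.1).
  have ms : measurable_fun setT (fun p : RT * RT => (p.2, p.1)).
    exact: measurable_fun_pair measurable_snd measurable_fst.
  exact: (measurableT_comp mD ms).
have D_le' x z : `|D z x| <= 3 * (1 + y ^+ 2) * (1 + x ^+ 2)^-1 * (C * (1 + z ^+ 2)^-1).
  by rewrite mulrC; exact: D_le.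
by have [] := @rint_fubini _ (fun x z => D z x) _ _ mD' (iV (3 * (1 + y ^+ 2))) (iV C) D_le'.
Qed.

(** Integrated in x, the two intervals around the endpoints have total length 4 |z|, so the first
    moment of [kappa] bounds the L^1 distance uniformly in y. *)
Let e_le : \int[mu]_x e x <= 4 * K1.
Proof.
have [i1 <-] := fubiniD; have ik := kernel_moment_integrable.
rewrite /K1 -(rintZ _ ik); apply: rint_le; [exact: i1|exact: rintegrableZ ik|] => z.
have ii := rintegrableD (rintegrable_itv (- `|z|) `|z|) (rintegrable_itv (y - `|z|) (y + `|z|)).
apply: (@le_trans _ _ (\int[mu]_x (kappa z * ((\1_(`[- `|z|, `|z|]%classic) x : R) +
    \1_(`[y - `|z|, y + `|z|]%classic) x)))).
  apply: rint_le; [|exact: rintegrableZ ii|]; last first.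
    by move=> x; rewrite /D ler_wpM2l//; exact: indic_itv_shift.
  apply: (rintegrable_le _ (rintegrableZ (kappa z) ii)); last first.
    move=> x; rewrite /D ger0_norm ?mulr_ge0// ler_wpM2l//; exact: indic_itv_shift.
  apply: measurable_funM; first exact: measurable_cst.
  apply: (measurableT_comp (@normr_measurable _ _)).
  apply: measurable_funB; last exact: measurable_indic_itv.
  exact: (measurableT_comp (@measurable_indic_itv R 0 y) (shift_measurable (- z))).
rewrite (rintZ _ ii) (rintD (rintegrable_itv _ _) (rintegrable_itv _ _)).
rewrite !integral_itv_indic; [|by rewrite lerD2l ge0_cp|by rewrite ge0_cp].
rewrite (_ : `|z| - - `|z| + (y + `|z| - (y - `|z|)) = 4 * `|z|); last by ring.
by rewrite mulrCA ler_wpM2l// mulrC ler_wpM2r// lerDr.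
Qed.

Let smear_close x : `|smear kappa 0 y x - J * \1_(`[0, y]%classic) x| <= e x.
Proof.
have /andP[j0 j1] := indic_itv01 0 y x.
have i2 : rintegrable (fun z => \1_(`[0, y]%classic) x * kappa z).
  exact: rintegrableZ kernel_integrable.
have mi : measurable_fun setT (fun z : RT => \1_(`[0, y]%classic) (x - z) : R).
  have md : measurable_fun setT (fun z : RT => (x - z : RT)).
    by apply: measurable_funB; [exact: measurable_cst|exact: measurable_id].
  exact: (measurableT_comp (@measurable_indic_itv R 0 y) md).
have i1 : rintegrable (fun z => kappa z * \1_(`[0, y]%classic) (x - z)).
  apply: (rintegrable_le _ kernel_integrable); first exact: measurable_funM.
  move=> z; have /andP[i0 i1] := indic_itv01 0 y (x - z).
  by rewrite ger0_norm ?mulr_ge0// ler_piMr.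
rewrite smear_conv mulrC /J -(rintZ _ kernel_integrable) -(RintegralB measurableT i1 i2).
have E z : kappa z * \1_(`[0, y]%classic) (x - z) - \1_(`[0, y]%classic) x * kappa z =
  kappa z * ((\1_(`[0, y]%classic) (x - z) : R) - \1_(`[0, y]%classic) x) by ring.
apply: rint_norm_le.
- by apply: rintegrable_measurable; exact: rintegrableB i1 i2.
- apply: (rintegrable_eq _ (rintegrable_norm (rintegrableB i1 i2))) => z.
  by rewrite E normrM (ger0_norm (k0 z)).
- by move=> z; rewrite E normrM (ger0_norm (k0 z)).
Qed.

(** The bounded [g] is integrated against a difference of L^1 norm at most 4 K1; the remaining
    factor 2 is that of [normc_cint_le]. *)
Lemma smear_primitive (g : R -> R[i]) (Mg : R) : @cmeasurable R _ RT g ->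
  (forall x, normc (g x) <= Mg) ->
  normc (cint setT (fun x => g x * (smear kappa 0 y x)%:C) - J%:C * cint `[0, y] g) <=
  8 * Mg * K1.
Proof.
move=> mg gM; have Mg0 : 0 <= Mg := le_trans (normc_ge0 _) (gM 0).
have ig : cintegrable (fun x => g x * (\1_(`[0, y]%classic) x : R)%:C).
  by apply: (cintegrable_bddM mg gM); apply: cintegrable_real; exact: rintegrable_itv.
have is_ : rintegrable (smear kappa 0 y).
  have ie' := rintegrableD ie (rintegrableZ J (rintegrable_itv 0 y)).
  apply: (rintegrable_le _ ie'); last move=> x.
    have mF : measurable_fun setT (fun p : RT * RT => kappa p.2 * \1_(`[0, y]%classic) (p.1 - p.2)).
      apply: measurable_funM; first exact: (measurableT_comp mk measurable_snd).
      have md : measurable_fun setT (fun p : RT * RT => (p.1 - p.2 : RT)).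
        by apply: measurable_funB; [exact: measurable_fst|exact: measurable_snd].
      exact: (measurableT_comp (@measurable_indic_itv R 0 y) md).
    have F_le x z : `|kappa z * \1_(`[0, y]%classic) (x - z)| <=
        2 * (1 + y ^+ 2) * (1 + x ^+ 2)^-1 * (C * (1 + z ^+ 2)^-1).
      have /andP[i0 i1] := indic_itv01 0 y (x - z).
      rewrite ger0_norm ?mulr_ge0//.
      have h1 := le_trans (indic_itv_le y (x - z)) (ler_wpM2l (addr_ge0 ler01 (sqr_ge0 y)) (peetre x z)).
      apply: (le_trans (ler_wpM2l (k0 z) h1)).
      have -> : kappa z * ((1 + y ^+ 2) * (2 * (1 + z ^+ 2) * (1 + x ^+ 2)^-1)) =
        2 * (1 + y ^+ 2) * (1 + x ^+ 2)^-1 * (kappa z * (1 + z ^+ 2)) by ring.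
      by apply: ler_wpM2l (kernel_decay2 z); rewrite !mulr_ge0 ?invr_ge0 ?addr_ge0 ?sqr_ge0.
    have [iF _] := @rint_fubini _ (fun x z => kappa z * \1_(`[0, y]%classic) (x - z)) _ _ mF
      (iV _) (iV _) F_le.
    move: (rintegrable_measurable iF); congr (measurable_fun _ _).
    by apply/funext => x; rewrite smear_conv.
  have := smear_close x; rewrite !ler_norml => /andP[h1 h2]; apply/andP; split; last by rewrite -lerBlDr.
  apply: (le_trans _ (smear_ge0 _ _ _ k0)); rewrite oppr_le0; apply: addr_ge0.
    by apply: rint_ge0 => z; exact: mulr_ge0 (k0 _) (normr_ge0 _).
  by have /andP[j0 _] := indic_itv01 0 y x; apply: mulr_ge0 => //; exact: rint_ge0 k0.
have ism : cintegrable (fun x => g x * (smear kappa 0 y x)%:C).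
  by apply: (cintegrable_bddM mg gM); exact: cintegrable_real is_.
have E : cint `[0, y] g = cint setT (fun x => g x * (\1_(`[0, y]%classic) x : R)%:C).
  by rewrite cint_indic; apply: eq_cint => x; rewrite mulrC.
rewrite E -(cintZ _ ig) -(cintB ism (cintegrableZ _ ig)).
have le1 : 2 * \int[mu]_x (Mg * e x) <= 8 * Mg * K1.
  rewrite (rintZ _ ie) (_ : 8 * Mg * K1 = 2 * (Mg * (4 * K1))); last by ring.
  by rewrite ler_wpM2l// ler_wpM2l.
apply: le_trans le1; apply: normc_cint_le.
- by apply: cintegrable_measurable; exact: cintegrableB ism (cintegrableZ _ ig).
- exact: rintegrableZ ie.
- move=> x; rewrite mulrCA -mulrBr -rmorphM -rmorphB normcM normc_real.
  by apply: ler_pM; [exact: normc_ge0|exact: normr_ge0|exact: gM|exact: smear_close].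
Qed.

End Smear.

(** Linear growth away from y is absorbed by the first moment of [kappa], and the integrable excess
    [q] by the bound [C] on [kappa]; neither estimate depends on y. *)
Lemma mollify_close (tau : R -> R[i]) (q : R -> R) (A y : R) : @cmeasurable R _ RT tau ->
  rintegrable q -> (forall x, 0 <= q x) ->
  (forall x, normc (tau x - tau y) <= q x + A * (1 + `|x - y|)) ->
  cintegrable (fun x => tau x * (kappa (x - y))%:C) /\
  normc (cint setT (fun x => tau x * (kappa (x - y))%:C) - J%:C * tau y) <=
  2 * (C * \int[mu]_x q x + A * K1).
Proof.
move=> mt iq q0 H.
have ik := rintegrable_shift (- y) kernel_integrable.
have ik1 := rintegrable_shift (- y) kernel_moment_integrable.
have ib := rintegrableD (rintegrableZ C iq) (rintegrableZ A ik1).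
have mky : @cmeasurable R _ RT (fun x => (kappa (x - y))%:C).
  by apply: cmeasurable_real; exact: rintegrable_measurable ik.
have b x : normc ((tau x - tau y) * (kappa (x - y))%:C) <=
    C * q x + A * ((1 + `|x - y|) * kappa (x - y)).
  rewrite normcM normc_real (ger0_norm (k0 _)).
  apply: (le_trans (ler_wpM2r (k0 _) (H x))); rewrite mulrDl mulrA lerD2r mulrC.
  by apply: ler_wpM2r; [exact: q0|exact: kernel_bounded].
have i1 : cintegrable (fun x => (tau x - tau y) * (kappa (x - y))%:C).
  apply: (cintegrable_le _ ib b); apply: cmeasurableM mky.
  by apply: cmeasurableB mt _; exact: cmeasurable_cst.
have i2 : cintegrable (fun x => tau y * (kappa (x - y))%:C).
  exact: cintegrableZ (cintegrable_real ik).
have it : cintegrable (fun x => tau x * (kappa (x - y))%:C).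
  by apply: (cintegrable_eq _ (cintegrableD i1 i2)) => x; rewrite -mulrDl subrK.
split; first exact: it.
have -> : J%:C * tau y = cint setT (fun x => tau y * (kappa (x - y))%:C).
  rewrite (cintZ _ (cintegrable_real ik)) mulrC cint_real; congr (_ * _%:C).
  by rewrite (rint_shift (- y) kernel_integrable).
rewrite -(cintB it i2).
have -> : C * \int[mu]_x q x + A * K1 =
    \int[mu]_x (C * q x + A * ((1 + `|x - y|) * kappa (x - y))).
  rewrite (rintD (rintegrableZ C iq) (rintegrableZ A ik1)) (rintZ _ iq) (rintZ _ ik1).
  by rewrite (rint_shift (- y) kernel_moment_integrable).
apply: normc_cint_le; [|exact: ib|].
  by apply: cintegrable_measurable; exact: cintegrableB it i2.
by move=> x; rewrite -mulrBl; exact: b.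
Qed.

End KernelEstimates.

(** * Abel limits under linear growth *)

Section AbelLimit.
Variable R : realType.
Local Notation mu := (@lebesgue_measure R).
Local Notation RT := (measurableTypeR R).

(** On x >= 0 the factor e^(-s x) is at most 1 and left of 0 [tau] vanishes, so |tau psi|
    dominates. *)
Lemma abel_limit (tau psi : R -> R[i]) : @cmeasurable R _ RT tau -> @cmeasurable R _ RT psi ->
  (forall x, x < 0 -> tau x = 0) -> cintegrable (fun x => tau x * psi x) ->
  (forall s, 0 < s -> cintegrable (fun x => (expR (- (s * x)))%:C * tau x * psi x)) /\
  ((fun s : R => cint setT (fun x => (expR (- (s * x)))%:C * tau x * psi x)) : R -> R[i]^o)
    @ 0^'+ --> (cint setT (fun x => tau x * psi x) : R[i]^o).
Proof.
move=> mt mp t0 it.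
have m s : @cmeasurable R _ RT (fun x => (expR (- (s * x)))%:C * tau x * psi x).
  apply: cmeasurableM mp; apply: cmeasurableM mt; apply: cmeasurable_real.
  exact: measurable_expRN.
have b (s x : R) : 0 < s ->
    normc ((expR (- (s * x)))%:C * tau x * psi x) <= normc (tau x * psi x).
  move=> s0; have [x0|x0] := ltP x 0.
    by rewrite (t0 _ x0) mulr0 mul0r.
  rewrite -mulrA normcM normc_real ger0_norm ?expR_ge0//.
  apply: ler_piMl; first exact: normc_ge0.
  by rewrite -expR0 ler_expR oppr_le0 mulr_ge0// ltW.
split=> [s s0|].
  by apply: (cintegrable_le (m s) (cintegrable_normc it)) => x; exact: b.
apply: (cint_dominated_right (g := fun x => normc (tau x * psi x))).
- by move=> s _; exact: m.
- move=> x.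
  have ce : expR (- (s * x)) @[s --> 0^'+] --> (1 : R).
    apply: cvg_at_right_filter; rewrite -[X in _ --> X](_ : expR (- (0 * x)) = 1); last first.
      by rewrite mul0r oppr0 expR0.
    apply: (@continuous_comp _ _ _ (fun s : R => - (s * x)) expR); last exact: continuous_expR.
    by apply: cvgN; apply: cvgM; [exact: cvg_id|exact: cvg_cst].
  apply/cvg_complexP; split.
    under eq_fun do rewrite -mulrA Re_realM.
    suff : expR (- (s * x)) * Re (tau x * psi x) @[s --> 0^'+] --> 1 * Re (tau x * psi x).
      by rewrite mul1r.
    by apply: cvgM; [exact: ce|exact: cvg_cst].
  under eq_fun do rewrite -mulrA Im_realM.
  suff : expR (- (s * x)) * Im (tau x * psi x) @[s --> 0^'+] --> 1 * Im (tau x * psi x).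
    by rewrite mul1r.
  by apply: cvgM; [exact: ce|exact: cvg_cst].
- exact: cintegrable_normc it.
- by move=> s x s0; exact: b.
Qed.

Lemma growth_cintegrable (tau f : R -> R[i]) (q : R -> R) (A : R) : @cmeasurable R _ RT tau ->
  rintegrable q -> (forall x, 0 <= q x) ->
  (forall x, normc (tau x) <= q x + A * (1 + `|x|)) -> schwartz f ->
  cintegrable (fun x => tau x * f x).
Proof.
move=> mt iq q0 H sf; have [B B0 fB] := schwartz_bounded sf; have [mf rf] := schwartz_rapid sf.
have ib := rintegrableD (rintegrableZ B iq) (rintegrableZ A (rintegrableD (rf 0%N) (rf 1%N))).
apply: (cintegrable_le _ ib); first exact: cmeasurableM.
move=> x; rewrite normcM expr0 expr1 mul1r.
apply: (le_trans (ler_wpM2r (normc_ge0 _) (H x))).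
rewrite mulrDl -mulrA (mulrDl 1) mul1r lerD2r mulrC.
by apply: ler_wpM2r; [exact: q0|exact: fB].
Qed.

End AbelLimit.

(** * From one-sided to two-sided control of increments *)

Section RealOscillation.
Variable R : realType.
Local Notation mu := (@lebesgue_measure R).
Local Notation RT := (measurableTypeR R).

(** The premise on [M] and [X] has the shape in which the increase bound is proved: window constants
    of length h come from bounded decrease of [w], and the outcome is bounded decrease of its
    opposite. Both one-sided bounds are then extended to arbitrary displacements with linear
    loss. *)
Lemma two_sided_window (w : R -> R) (h : R) : 0 < h -> bdd_decreasing_real w ->
  (forall M X : R, 0 <= M -> 0 <= X ->
     (forall x v, X <= x -> 0 <= v <= h -> w x - M <= w (x + v)) ->
     bdd_decreasing_real (fun x => - w x)) ->
  exists A X : R, [/\ 0 <= A, 0 <= X &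
    forall x y, X <= x -> X <= y -> `|w x - w y| <= A * (1 + `|x - y|)].
Proof.
move=> hp dw H; have [d [M [X [d0 M0 X0 HX]]]] := bdd_decreasing_window dw.
have dNw : bdd_decreasing_real (fun x => - w x).
  apply: (H (M * (1 + h / d)) X) => //.
    by rewrite mulr_ge0// addr_ge0// divr_ge0// ltW.
  move=> x v Xx /andP[v0 v1]; apply: le_trans (HX x v Xx v0).
  by rewrite lerD2l lerN2 ler_wpM2l// lerD2l ler_pM2r ?invr_gt0.
have [d' [M' [X' [d0' M0' X0' HX']]]] := bdd_decreasing_window dNw.
have [i0 i0'] : 0 < d^-1 /\ 0 < d'^-1 by rewrite !invr_gt0.
(* From 1 + k/d <= (1 + 1/d)(1 + k) for k >= 0. *)
exists (M * (1 + d^-1) + M' * (1 + d'^-1)), (Num.max X X'); split.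
- by rewrite addr_ge0// mulr_ge0// addr_ge0// ltW.
- by rewrite le_max X0.
have key x y : Num.max X X' <= x -> x <= y ->
    `|w x - w y| <= (M * (1 + d^-1) + M' * (1 + d'^-1)) * (1 + (y - x)).
  rewrite ge_max => /andP[Xx Xx'] xy; have h0 : 0 <= y - x by rewrite subr_ge0.
  have := HX x _ Xx h0; have := HX' x _ Xx' h0; rewrite (addrC x) subrK.
  have P a b : 0 <= a -> 0 < b -> a * (1 + (y - x) / b) <= a * (1 + b^-1) * (1 + (y - x)).
    move=> a0 b0; rewrite -mulrA ler_wpM2l//; have : 0 < b^-1 by rewrite invr_gt0.
    move: (y - x) h0 b^-1 => k k0 b' b0'; have := mulr_ge0 k0 (ltW b0'); nra.
  have := P M d M0 d0; have := P M' d' M0' d0'.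
  have := mulr_ge0 (mulr_ge0 M0 (ltW (ltr_pwDl ltr01 (ltW i0)))) (addr_ge0 ler01 h0).
  have := mulr_ge0 (mulr_ge0 M0' (ltW (ltr_pwDl ltr01 (ltW i0')))) (addr_ge0 ler01 h0).
  rewrite (mulrDl (M * (1 + d^-1))) ler_norml.
  move: (M * (1 + d^-1) * (1 + (y - x))) (M' * (1 + d'^-1) * (1 + (y - x)))
    (M * (1 + (y - x) / d)) (M' * (1 + (y - x) / d')) => a b c e ? ? ? ? ? ?.
  by apply/andP; split; lra.
move=> x y xX yX; have [xy|yx] := leP x y.
  by rewrite (distrC x y) (@ger0_norm _ (y - x)) ?subr_ge0//; exact: key.
have yx' := ltW yx; rewrite (distrC (w x)) (@ger0_norm _ (x - y)); last by rewrite subr_ge0.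
exact: key.
Qed.

Lemma bdd_decreasing_oppP (w : R -> R) (a K Y : R) : 0 < a ->
  (forall y b, Y <= y -> 0 <= b <= a -> w (y + b) - w y <= K) ->
  bdd_decreasing_real (fun x => - w x).
Proof.
move=> a0 H; exists a => //; exists K; near=> x => b ba.
have Yx : Y <= x by near: x; apply: nbhs_pinfty_ge; exact: num_real.
by have := H x b Yx ba; lra.
Unshelve. all: by end_near. Qed.

End RealOscillation.

(** * The Tauberian direction *)

Section TauberianArgument.
Variable R : realType.
Local Notation mu := (@lebesgue_measure R).
Local Notation RT := (measurableTypeR R).

Variables (tau : R -> R[i]) (G : R[i] -> R[i]) (r l : R) (chi : R -> R[i]) (kappa : R -> R).
Variables (q g : R -> R[i]) (Mq Mg : R) (a c : R).
Hypothesis ltau : laplace_integrable tau.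
Hypothesis litau : loc_integrable tau.
Hypothesis dtau : bdd_decreasing tau.
Hypothesis aG : analytic_near0 G r.
Hypothesis (r0 : 0 < r) (lr : l <= r / 2).
Hypothesis tchi : test_fun (- l) l chi.
Hypothesis chiE : forall x, fourier chi x = (kappa x)%:C.
Hypothesis k0 : forall x, 0 <= kappa x.
Hypothesis (a0 : 0 < a) (c0 : 0 < c) (kc0 : forall x, `|x| <= a -> c <= kappa x).
Hypothesis (mq : @cmeasurable R _ RT q) (qM : forall x, normc (q x) <= Mq).
Hypothesis (mg : @cmeasurable R _ RT g) (gM : forall x, normc (g x) <= Mg).
Hypothesis limQ : bdry_limit (fun s => laplace tau s - G s / s) (- l) l
    (fun chi => cint setT (fun x => q x * fourier chi x)).
Hypothesis limG : bdry_limit G (- l) l (fun chi => cint setT (fun x => g x * fourier chi x)).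

Let kcont : continuous kappa. Proof. exact: kernel_continuous tchi chiE. Qed.

Let ik : rintegrable kappa.
Proof. by have [C _ kd] := kernel_decay tchi chiE; exact: kernel_integrable k0 kd kcont. Qed.

Let smear_schwartz u v : schwartz (fun x => (smear kappa u v x)%:C).
Proof.
have := test_fun_fourier_schwartz (test_fun_smear tchi u v).
by rewrite (_ : fourier _ = (fun x => (smear kappa u v x)%:C))//;
  apply/funext => x; rewrite (fourier_smear_test tchi chiE).
Qed.

Let diff_schwartz u v : u <= v -> schwartz (fun x => (kappa (x - v) - kappa (x - u))%:C).
Proof.
move=> uv; have := test_fun_fourier_schwartz (test_fun_mult (test_fun_smear tchi u v)).
by rewrite (_ : fourier _ = (fun x => (kappa (x - v) - kappa (x - u))%:C))//;
  apply/funext => x; rewrite (fourier_smear_test_mult tchi chiE).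
Qed.

Let ismear u v : rintegrable (smear kappa u v).
Proof. by have [] := schwartz_cintegrable (smear_schwartz u v). Qed.

Let smear_shift u v x : smear kappa u v x = smear kappa 0 (v - u) (x - u).
Proof.
have [C _ kd] := kernel_decay tchi chiE.
have i1 : rintegrable (fun z => \1_(`[u, v]%classic) z * kappa (x - z)).
  apply: (rintegrable_eq (u := fun z => kappa (x - z) * \1_(`[u, v]%classic) z)).
    by move=> z; rewrite mulrC.
  apply: (@rintegrable_bddM _ _ _ C); [| |exact: rintegrable_itv].
    apply: continuous_measurable_fun => z.
    apply: (@continuous_comp _ _ _ (fun z => x - z) kappa); last exact: kcont.
    by apply: cvgB; [exact: cvg_cst|exact: cvg_id].
  by move=> z; rewrite ger0_norm//; exact: (kernel_bounded k0 kd).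
rewrite /smear -(rint_shift u i1); apply: eq_Rintegral => z _; congr (_ * kappa _); last by ring.
rewrite !indicE; congr (nat_of_bool _)%:R.
by apply/idP/idP; rewrite !inE/= !in_itv/= => /andP[z1 z2]; apply/andP; split; lra.
Qed.

Let diff_bound u v :
  normc (cint setT (fun x => q x * (kappa (x - v) - kappa (x - u))%:C)) <=
  2 * (Mq * (2 * \int[mu]_x kappa x)).
Proof.
have iv := rintegrable_shift (- v) ik; have iu := rintegrable_shift (- u) ik.
rewrite (_ : 2 * (Mq * (2 * \int[mu]_x kappa x)) = 2 * \int[mu]_x (Mq * (kappa (x - v) + kappa (x - u)))); last first.
  rewrite (rintZ _ (rintegrableD iv iu)) (rintD iv iu) (rint_shift (- v) ik) (rint_shift (- u) ik).
  by ring.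
apply: normc_cint_le.
- apply: cmeasurableM mq _; apply: cmeasurable_real.
  by apply: rintegrable_measurable; exact: rintegrableB.
- exact: rintegrableZ (rintegrableD iv iu).
- move=> x; rewrite normcM normc_real; apply: ler_pM; [exact: normc_ge0|exact: normr_ge0|exact: qM|].
  by apply: (le_trans (ler_normB _ _)); rewrite !ger0_norm.
Qed.

(** The smear over [y, y + h] is a translate of the one over [0, h], so its integral does not depend
    on y. This uniformity is what bounds all increments by one constant. *)
Let limit_bound h y : normc (cint setT (fun x => q x * (kappa (x - (y + h)) - kappa (x - y))%:C) +
    cint setT (fun x => g x * (smear kappa y (y + h) x)%:C)) <=
  2 * (Mq * (2 * \int[mu]_x kappa x)) + 2 * (Mg * \int[mu]_x smear kappa 0 h x).
Proof.
apply: (le_trans (ler_normcD _ _)); apply: lerD; first exact: diff_bound.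
have is_ := rintegrable_shift (- y) (ismear 0 h).
rewrite -(rint_shift (- y) (ismear 0 h)) -(rintZ _ is_).
apply: normc_cint_le.
- apply: cmeasurableM mg _; apply: cmeasurable_real; exact: rintegrable_measurable (ismear _ _).
- exact: rintegrableZ is_.
- move=> x; rewrite normcM normc_real smear_shift (addrC y) addrK.
  rewrite (ger0_norm (smear_ge0 _ _ _ k0)).
  by apply: ler_wpM2r; [exact: smear_ge0|exact: gM].
Qed.

(** Bounded decrease is a condition on real functions, so [P] stands for Re or Im. As [kappa] is
    real, [P] passes through the tested identity and yields the real limit that the increase bound
    requires. *)
Let part_oscillation (P : R[i] -> R) :
  (forall z, P z <= normc z) -> P 0 = 0 ->
  (forall (x : R) z, P (x%:C * z) = x * P z) ->
  (forall f, @cmeasurable R _ RT f -> measurable_fun setT (fun x => P (f x))) ->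
  (forall f, cintegrable f -> rintegrable (fun x => P (f x))) ->
  (forall f, P (cint setT f) = \int[mu]_x P (f x)) ->
  (forall (f : R -> R[i]) z, (f : R -> R[i]^o) @ 0^'+ --> (z : R[i]^o) -> P (f s) @[s --> 0^'+] --> P z) ->
  (forall u v, mu.-integrable `[u, v] (fun x => (P (tau x))%:E)) ->
  bdd_decreasing_real (fun x => P (tau x)) ->
  exists A X : R, [/\ 0 <= A, 0 <= X &
    forall x y, X <= x -> X <= y -> `|P (tau x) - P (tau y)| <= A * (1 + `|x - y|)].
Proof.
pose w x := P (tau x); move=> Ple P0 PM Pm Pi Pc Pl lw dw; have [mt t0 it] := ltau.
have [C C0 kd] := kernel_decay tchi chiE.
have h0 : 0 < 2 * a by rewrite mulr_gt0.
apply: (two_sided_window h0 dw) => M X M0 X0 win.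
pose h := 2 * a.
pose D0 := 2 * (Mq * (2 * \int[mu]_x kappa x)) + 2 * (Mg * \int[mu]_x smear kappa 0 h x).
have w0 x : x < 0 -> w x = 0 by move=> x0; rewrite /w t0.
have iw s : 0 < s -> rintegrable (fun x => expR (- (s * x)) * w x).
  by move=> s0; apply: (rintegrable_eq _ (Pi _ (it s s0))) => x; exact: PM.
have lim y : 0 <= y -> exists2 D, D <= D0 &
   \int[mu]_x (expR (- (s * x)) * w x * (s * smear kappa y (y + h) x +
        (kappa (x - (y + h)) - kappa (x - y)))) @[s --> 0^'+] --> D.
  move=> y0; have yh : y <= y + h by rewrite lerDl ltW.
  have lim := kernel_relation tchi chiE ltau aG r0 lr limQ limG yh.
  exists (P (cint setT (fun x => q x * (kappa (x - (y + h)) - kappa (x - y))%:C) +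
      cint setT (fun x => g x * (smear kappa y (y + h) x)%:C))).
    by apply: (le_trans (Ple _)); exact: limit_bound.
  apply: cvg_trans (Pl _ _ lim); apply: near_eq_cvg; apply: nearW => s.
  rewrite Pc; apply: eq_Rintegral => x _.
  by rewrite [X in P X]mulrC PM PM mulrC.
have [K HK] := increase_bounded w0 lw iw M0 X0 h0 win k0 (kernel_bounded k0 kd) kcont ik
  (fun u v => rintegrable_measurable (ismear u v)) erefl a0 c0 kc0 lim.
exact: (bdd_decreasing_oppP a0 HK).
Qed.

Lemma tauberian_oscillation : exists A X : R, [/\ 0 <= A, 0 <= X &
  forall x y, X <= x -> X <= y -> normc (tau x - tau y) <= A * (1 + `|x - y|)].
Proof.
have [m1 [m2 li]] := litau; have [d1 d2] := dtau.
have [A1 [X1 [A10 X10 H1]]] : exists A X : R, [/\ 0 <= A, 0 <= X &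
    forall x y, X <= x -> X <= y -> `|Re (tau x) - Re (tau y)| <= A * (1 + `|x - y|)].
  apply: (part_oscillation (P := @complex.Re R)) => //.
  - by move=> z; apply: (le_trans (ler_norm _)); exact: Re_le_normc.
  - by move=> x z; rewrite Re_realM.
  - by move=> f [].
  - by move=> f [].
  - by move=> f z /cvg_complexP[].
  - by move=> u v; have [] := li u v.
have [A2 [X2 [A20 X20 H2]]] : exists A X : R, [/\ 0 <= A, 0 <= X &
    forall x y, X <= x -> X <= y -> `|Im (tau x) - Im (tau y)| <= A * (1 + `|x - y|)].
  apply: (part_oscillation (P := @complex.Im R)) => //.
  - by move=> z; apply: (le_trans (ler_norm _)); exact: Im_le_normc.
  - by move=> x z; rewrite Im_realM.
  - by move=> f [].
  - by move=> f [].
  - by move=> f z /cvg_complexP[].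
  - by move=> u v; have [] := li u v.
exists (A1 + A2), (Num.max X1 X2); split; first exact: addr_ge0.
  by rewrite le_max X10.
move=> x y; rewrite !ge_max => /andP[x1 x2] /andP[y1 y2].
apply: (le_trans (normc_le_ReIm _)); rewrite ReB ImB mulrDl.
by apply: lerD; [exact: H1|exact: H2].
Qed.

Lemma tauberian_primitive : exists K X : R,
  forall y, X <= y -> normc (tau y - cint `[0, y] g) <= K.
Proof.
have [mt t0 it] := ltau; have [C C0 kd] := kernel_decay tchi chiE.
have [A [X [A0 X0 osc]]] := tauberian_oscillation.
pose q0 x := \1_(`[0, X]%classic) x * normc (tau x).
have iq0 : rintegrable q0.
  have [m1 [m2 li]] := litau; have [l1 l2] := li 0 X.
  have ic : cintegrable (fun x => (\1_(`[0, X]%classic) x : R)%:C * tau x).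
    split; [apply: (rintegrable_eq _ (rintegrable_itv_loc l1))|
            apply: (rintegrable_eq _ (rintegrable_itv_loc l2))] => x.
      by rewrite Re_realM.
    by rewrite Im_realM.
  apply: (rintegrable_eq _ (cintegrable_normc ic)) => x.
  by rewrite normcM normc_real ger0_norm// indicE.
have q00 x : 0 <= q0 x by rewrite mulr_ge0 ?normc_ge0// indicE.
have q0E x : x < X -> normc (tau x) <= q0 x.
  move=> xX; have [x0|x0] := ltP x 0; first by rewrite t0// normc_real normr0 q00.
  by rewrite /q0 indicE mem_set ?mul1r//= in_itv/= x0 ltW.
(* The extra |tau(X)| lets one constant also serve comparisons with points left of [X], where |tau|
   itself is counted in [q0]. *)
pose B := A + normc (tau X).
have AB : A <= B by rewrite lerDl normc_ge0.
have B0 : 0 <= B := le_trans A0 AB.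
have tX y : X <= y -> normc (tau y) <= normc (tau X) + A * (1 + `|y - X|).
  move=> Xy; rewrite -{1}(subrK (tau X) (tau y)) addrC.
  by apply: (le_trans (ler_normcD _ _)); rewrite lerD2l osc.
have close x y : X <= y -> normc (tau x - tau y) <= q0 x + B * (1 + `|x - y|).
  move=> Xy; have p : 0 <= 1 + `|x - y| by rewrite addr_ge0.
  have [Xx|xX] := leP X x.
    apply: (le_trans (osc _ _ Xx Xy)); rewrite -[leLHS]add0r.
    by apply: lerD => //; rewrite ler_wpM2r.
  apply: (le_trans (ler_normcB _ _)); apply: lerD; first exact: q0E.
  apply: (le_trans (tX y Xy)); rewrite /B mulrDl addrC; apply: lerD.
    rewrite ler_wpM2l// lerD2l ger0_norm ?subr_ge0// ler0_norm ?subr_le0; last by lra.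
    by lra.
  by rewrite ler_peMr ?normc_ge0// lerDl.
have growth x : normc (tau x) <= q0 x + B * (1 + `|x|).
  have p : 0 <= 1 + `|x| by rewrite addr_ge0.
  have [Xx|xX] := leP X x; last first.
    by apply: (le_trans (q0E _ xX)); rewrite lerDl mulr_ge0.
  apply: (le_trans (tX x Xx)); rewrite -[leLHS]add0r; apply: lerD => //.
  rewrite /B mulrDl addrC; apply: lerD.
    rewrite ler_wpM2l// lerD2l !ger0_norm ?subr_ge0//; last by rewrite (le_trans X0).
    by rewrite gerBl.
  by rewrite ler_peMr ?normc_ge0// lerDl.
pose J := \int[mu]_x kappa x.
pose K1 := \int[mu]_x ((1 + `|x|) * kappa x).
have J0 : 0 < J.
  apply: continuous_rint_gt0 => //.
  by apply: (lt_le_trans c0); apply: kc0; rewrite normr0 ltW.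
pose c1 := normc (cint setT (fun x => tau x * (kappa (x - 0))%:C)).
pose KK := 2 * (C * \int[mu]_x q0 x + B * K1) + c1 + 2 * (Mq * (2 * J)) + 8 * Mg * K1.
exists (KK / J), X => y Xy; have y0 : 0 <= y := le_trans X0 Xy.
have sm := smear_schwartz 0 y; have sd := diff_schwartz y0.
have i1 := growth_cintegrable mt iq0 q00 growth sm.
have i2 := growth_cintegrable mt iq0 q00 growth sd.
have [I1 L1] := abel_limit mt (smooth_cmeasurable sm.1) t0 i1.
have [I2 L2] := abel_limit mt (smooth_cmeasurable sd.1) t0 i2.
have lim := kernel_relation tchi chiE ltau aG r0 lr limQ limG y0.
(* Linear growth makes [tau] integrable against Schwartz functions, so the smeared integral has a
   finite limit and its factor s sends it to 0. Uniqueness of the limit then gives an identity free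
   of s. *)
have lim' : ((fun s : R => cint setT (fun x => (expR (- (s * x)))%:C * tau x *
      (s * smear kappa 0 y x + (kappa (x - y) - kappa (x - 0)))%:C)) : R -> R[i]^o)
   @ 0^'+ --> (0 + cint setT (fun x => tau x * (kappa (x - y) - kappa (x - 0))%:C) : R[i]^o).
  have Es s : 0 < s -> cint setT (fun x => (expR (- (s * x)))%:C * tau x *
      (s * smear kappa 0 y x + (kappa (x - y) - kappa (x - 0)))%:C) =
    s%:C * cint setT (fun x => (expR (- (s * x)))%:C * tau x * (smear kappa 0 y x)%:C) +
    cint setT (fun x => (expR (- (s * x)))%:C * tau x * (kappa (x - y) - kappa (x - 0))%:C).
    move=> s0; rewrite -(cintZ s%:C (I1 s s0)) -(cintD (cintegrableZ s%:C (I1 s s0)) (I2 s s0)).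
    by apply: eq_cint => x; rewrite rmorphD rmorphM mulrDr mulrCA.
  apply: cvg_trans (cvgD (cvg_right_mul0 L1) L2); apply: near_eq_cvg; near=> s.
  by apply/esym/Es; near: s; exact: nbhs_right_gt.
have E := cvg_unique (@norm_hausdorff _ (R[i]^o)) lim' lim; rewrite add0r in E.
have [iy by_] := mollify_close k0 kd kcont mt iq0 q00 (fun x => close x y Xy).
have E0 : cint setT (fun x => tau x * (kappa (x - 0))%:C) =
  cint setT (fun x => tau x * (kappa (x - y))%:C) -
  cint setT (fun x => tau x * (kappa (x - y) - kappa (x - 0))%:C).
  by rewrite -(cintB iy i2); apply: eq_cint => x; rewrite rmorphB; ring.
have pr := smear_primitive k0 kd kcont y0 mg gM.
have db := diff_bound 0 y.
rewrite ler_pdivlMr// mulrC -{1}(gtr0_norm J0) -normc_real -normcM.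
(* The four terms are the mollification error at y, a constant independent of y, the contribution of
   [q], and the smearing error for [g]; each is bounded uniformly in y. *)
pose a1 := cint setT (fun x => tau x * (kappa (x - y))%:C) - J%:C * tau y.
pose a2 := cint setT (fun x => tau x * (kappa (x - 0))%:C).
pose a3 := cint setT (fun x => q x * (kappa (x - y) - kappa (x - 0))%:C).
pose a4 := cint setT (fun x => g x * (smear kappa 0 y x)%:C) - J%:C * cint `[0, y] g.
have -> : J%:C * (tau y - cint `[0, y] g) = - a1 + a2 + a3 + a4.
  by rewrite /a2 E0 E /a1 /a3 /a4; ring.
do 3 (apply: (le_trans (ler_normcD _ _)); apply: lerD => //).
by rewrite normcN.
Unshelve. all: by end_near. Qed.

End TauberianArgument.

(** * The converse *)

Section LaplaceBoundary.
Variable R : realType.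
Local Notation mu := (@lebesgue_measure R).
Local Notation RT := (measurableTypeR R).

Lemma pm_boundary_ext (F1 F2 : R[i] -> R[i]) :
  (forall z, 0 < Re z -> F1 z = F2 z) -> pm_boundary F1 -> pm_boundary F2.
Proof.
move=> F12 [a [b [ab [T [limT H]]]]]; exists a, b; split=> //; exists T; split=> // phi tp.
apply: cvg_trans (limT phi tp); apply: near_eq_cvg; near=> s.
have s0 : 0 < s by near: s; exact: nbhs_right_gt.
by apply: eq_cint => t; rewrite F12.
Unshelve. all: by end_near. Qed.

(** On [0, A] the powers of x are at most |A|^n and e^(-x) is at least e^(-|A|), so integrability
    against e^(-x) gives all moments. *)
Lemma laplace_integrable_itv (u : R -> R[i]) (A : R) : laplace_integrable u ->
  rapid (fun x => (\1_(`[0, A]%classic) x : R)%:C * u x).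
Proof.
move=> [mu_ u0 iu]; split.
  by apply: cmeasurableM mu_; apply: cmeasurable_real; exact: measurable_indic_itv.
move=> n; have i1 := cintegrable_normc (iu 1 ltr01).
have mI : @cmeasurable R _ RT (fun x => (\1_(`[0, A]%classic) x : R)%:C).
  by apply: cmeasurable_real; exact: measurable_indic_itv.
apply: (rintegrable_le _ (rintegrableZ (`|A| ^+ n * expR `|A|) i1)).
  apply: measurable_funM.
    by apply: continuous_measurable_fun => x; apply: (@continuous_comp _ _ _ (fun x : R => `|x|) (fun z : R => z ^+ n));
      [exact: norm_continuous|exact: exprn_continuous].
  by apply: measurable_normc; exact: cmeasurableM.
move=> x; rewrite ger0_norm ?mulr_ge0 ?exprn_ge0 ?normc_ge0//.
rewrite !normcM !normc_real (ger0_norm (expR_ge0 _)) indicE.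
have [|_] := boolP (_ \in _); last first.
  by rewrite normr0 mul0r mulr0 !mulr_ge0 ?exprn_ge0 ?expR_ge0 ?normc_ge0.
rewrite inE/= in_itv/= normr1 mul1r mul1r => /andP[x0 xA].
have A0 : 0 <= A := le_trans x0 xA.
rewrite mulrA -[leRHS]mulrA -[X in _ <= X]mulrA; apply: ler_pM; rewrite ?exprn_ge0 ?normc_ge0//.
  by rewrite lerXn2r ?nnegrE ?normr_ge0// !ger0_norm.
rewrite mulrA -expRD ler_peMl ?normc_ge0// -expR0 ler_expR subr_ge0.
by rewrite ger0_norm.
Qed.

(** [u] splits into a bounded part [b] and an integrable part [p] carried by [0, A]. The transform
    of [b] is a pseudomeasure, and that of [p] is a smooth function, which a cut-off makes into one.
    The boundary distribution is integration of [u] against the transform of the test function. *)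
Lemma laplace_pm_boundary (u : R -> R[i]) (A M : R) : laplace_integrable u ->
  0 <= M -> (forall x, A < x -> normc (u x) <= M) -> pm_boundary (laplace u).
Proof.
move=> lu M0 uM; have [mu_ u0 iu] := lu.
pose p x := (\1_(`[0, A]%classic) x : R)%:C * u x.
pose b x := if x <= A then 0 else u x.
have rp : rapid p := laplace_integrable_itv A lu.
have ip := rapid_cintegrable rp.
have E x : u x = b x + p x.
  rewrite /b /p indicE; case: ifP => [xA|/negbT].
    rewrite add0r; have [x0|x0] := ltP x 0; first by rewrite u0// mulr0.
    by rewrite mem_set ?mul1r//= in_itv/= x0.
  rewrite -ltNge => Ax; rewrite (_ : x \in _ = false) ?mul0r ?addr0//.
  by apply/negbTE; rewrite notin_setE/= in_itv/= => /andP[_]; rewrite leNgt Ax.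
have bM x : normc (b x) <= M.
  rewrite /b; case: ifP => [_|/negbT]; first by rewrite normc_real normr0.
  by rewrite -ltNge; exact: uM.
have mb : @cmeasurable R _ RT b.
  apply: (@cmeasurable_if _ _ RT (fun x => x <= A) (fun=> 0) u).
  - by apply: measurable_fun_ler; [exact: measurable_id|exact: measurable_cst].
  - by split; exact: measurable_cst.
  - exact: mu_.
(* p^ need not decay, but only its restriction to the support of the test functions matters. *)
pose k x := (\1_(`[- 1, 1]%classic) x : R)%:C * fourier p x.
have rk : rapid k.
  have [mI rI] := rapid_indic (- 1 : R) 1.
  have mf : @cmeasurable R _ RT (fourier p) by apply: smooth_cmeasurable; exact: smooth_fourier.
  split; first exact: cmeasurableM.
  move=> n; apply: (rintegrable_le _ (rintegrableZ (2 * \int[mu]_x normc (p x)) (rI n))).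
    apply: measurable_funM; last by apply: measurable_normc; exact: cmeasurableM.
    by apply: continuous_measurable_fun => x; apply: (@continuous_comp _ _ _ (fun x : R => `|x|) (fun z : R => z ^+ n));
      [exact: norm_continuous|exact: exprn_continuous].
  move=> x; rewrite ger0_norm ?mulr_ge0 ?exprn_ge0 ?normc_ge0// normcM.
  rewrite mulrA [leRHS]mulrC; apply: ler_wpM2l; first by rewrite mulr_ge0 ?exprn_ge0 ?normc_ge0.
  apply: normc_fourier_le; [exact: rp.1|exact: cintegrable_normc|by []].
pose q x := normc (p x).
have growth x : normc (u x) <= q x + M * (1 + `|x|).
  rewrite E addrC; apply: (le_trans (ler_normcD _ _)); rewrite lerD2l.
  by apply: (le_trans (bM x)); rewrite ler_peMr// lerDl.
have iup f : schwartz f -> cintegrable (fun x => u x * f x).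
  by apply: (growth_cintegrable mu_ (cintegrable_normc ip) _ growth) => x; exact: normc_ge0.
exists (- 1), 1; split; first by rewrite ltrN10 ltr01.
exists (fun phi => cint setT (fun x => u x * fourier phi x)); split.
  move=> phi tp; have sp := test_fun_fourier_schwartz tp.
  have [I L] := abel_limit mu_ (smooth_cmeasurable sp.1) u0 (iup _ sp).
  apply: cvg_trans L; apply: near_eq_cvg; near=> s.
  have s0 : 0 < s by near: s; exact: nbhs_right_gt.
  by have [_ _ ->] := laplace_test lu s0 (schwartz_cintegrable (test_fun_schwartz tp)).
move=> t0 /andP[t1 t2]; exists (- 1), 1; split; first by split.
exists (fun phi => cint setT (fun x => b x * fourier phi x) + cint setT (fun x => k x * phi x)).
split.
  apply: bounded_pm_pseudomeasure; apply: bounded_pmD; first exact: bounded_pm_fourier mb bM.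
  exact: bounded_pm_rapid.
move=> phi tp; have sp := test_fun_fourier_schwartz tp.
have ib : cintegrable (fun x => b x * fourier phi x).
  by apply: (cintegrable_bddM mb bM); exact: schwartz_cintegrable sp.
have [ipf E2] := fourier_swap ip (schwartz_cintegrable (test_fun_schwartz tp)).
have -> : cint setT (fun x => k x * phi x) = cint setT (fun x => p x * fourier phi x).
  rewrite E2; apply: eq_cint => x; rewrite /k mulrAC mulrC mulrA.
  rewrite indicE; have [_|] := boolP (_ \in _); first by rewrite mulr1.
  have [_ [c [d [c1 d1 p0]]]] := tp; rewrite notin_setE/= in_itv/= => /negP; rewrite negb_and -!ltNge => xn.
  rewrite p0 ?mulr0 ?mul0r//.
  by case/orP: xn => [xn|xn]; [left; exact: lt_trans xn c1|right; exact: lt_trans d1 xn].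
rewrite -(cintD ib ipf); apply: eq_cint => x.
by rewrite -mulrDl -E.
Unshelve. all: by end_near. Qed.

Lemma normc_cexp_le (w : R[i]) : normc (cexp w) <= expR (normc w).
Proof.
by rewrite normc_cexp ler_expR (le_trans (ler_norm _))// Re_le_normc.
Qed.

(** In product form the identity includes s = 0, so the Taylor bounds drawn from it need no case
    distinction. *)
Lemma cexp_integral (s : R[i]) : cint `[0, 1] (fun v => cexp (- (s * v%:C))) * s = 1 - cexp (- s).
Proof.
have [->|s0] := eqVneq s 0; first by rewrite mulr0 oppr0 cexp0 subrr.
by rewrite cint_itv_cexp// mulfVK// mulr0 oppr0 cexp0 mulr1.
Qed.

Lemma normc_cint01_le (f : R -> R[i]) (K : R) : @cmeasurable R _ RT f ->
  (forall v, 0 <= v <= 1 -> normc (f v) <= K) -> normc (cint `[0, 1] f) <= 2 * K.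
Proof.
move=> mf fK; rewrite cint_indic.
have -> : 2 * K = 2 * \int[mu]_x (K * \1_(`[0, 1]%classic) x).
  by rewrite (rintZ _ (rintegrable_itv 0 1)) integral_itv_indic// subr0 mulr1.
apply: normc_cint_le.
- by apply: cmeasurableM mf; apply: cmeasurable_real; exact: measurable_indic_itv.
- exact: rintegrableZ (rintegrable_itv 0 1).
- move=> v; rewrite normcM normc_real indicE; have [|_] := boolP (_ \in _).
    by rewrite inE/= in_itv/= normr1 mul1r mulr1; exact: fK.
  by rewrite normr0 mul0r mulr0.
Qed.

Lemma cexp_taylor1 (s : R[i]) : normc (1 - cexp (- s)) <= 2 * normc s * expR (normc s).
Proof.
rewrite -cexp_integral normcM mulrAC; apply: ler_wpM2r; first exact: normc_ge0.
apply: normc_cint01_le; first exact: cmeasurable_laplace_kernel.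
move=> v /andP[v0 v1]; apply: (le_trans (normc_cexp_le _)); rewrite ler_expR normcN normcM.
by rewrite normc_real ger0_norm// ler_piMr// normc_ge0.
Qed.

(** The remainder is s times the integral over [0, 1] of 1 - e^(-s v), to which the first-order
    bound applies; each of the two integrations contributes a factor 2. *)
Lemma cexp_taylor2 (s : R[i]) :
  normc (cexp (- s) - 1 + s) <= 4 * normc s ^+ 2 * expR (normc s).
Proof.
have i1 : cintegrable (fun v => (\1_(`[0, 1]%classic) v : R)%:C * cexp (- (s * v%:C))).
  apply: (cintegrable_le (u := fun v => expR (normc s) * \1_(`[0, 1]%classic) v)).
  - apply: cmeasurableM; last exact: cmeasurable_laplace_kernel.
    by apply: cmeasurable_real; exact: measurable_indic_itv.
  - exact: rintegrableZ (rintegrable_itv 0 1).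
  - move=> v; rewrite normcM normc_real indicE; have [|_] := boolP (_ \in _).
      rewrite inE/= in_itv/= normr1 mul1r mulr1 => /andP[v0 v1].
      apply: (le_trans (normc_cexp_le _)); rewrite ler_expR normcN normcM.
      by rewrite normc_real ger0_norm// ler_piMr// normc_ge0.
    by rewrite normr0 mul0r mulr0.
have i2 : cintegrable (fun v => (\1_(`[0, 1]%classic) v : R)%:C).
  exact: cintegrable_real (rintegrable_itv 0 1).
have -> : cexp (- s) - 1 + s = cint `[0, 1] (fun v => 1 - cexp (- (s * v%:C))) * s.
  have -> : cint `[0, 1] (fun v => 1 - cexp (- (s * v%:C))) =
      1 - cint `[0, 1] (fun v => cexp (- (s * v%:C))).
    have e1 : cint setT (fun v => (\1_(`[0, 1]%classic) v : R)%:C) = 1.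
      by rewrite cint_real integral_itv_indic ?ler01// subr0.
    rewrite !(cint_indic `[0, 1]%classic).
    transitivity (cint setT (fun v => (\1_(`[0, 1]%classic) v : R)%:C) -
      cint setT (fun v => (\1_(`[0, 1]%classic) v : R)%:C * cexp (- (s * v%:C)))).
      by rewrite -(cintB i2 i1); apply: eq_cint => v; rewrite mulrBr mulr1.
    by rewrite e1.
  by rewrite mulrBl mul1r cexp_integral; ring.
rewrite normcM (_ : 4 * _ * _ = 2 * (2 * normc s * expR (normc s)) * normc s); last by ring.
apply: ler_wpM2r; first exact: normc_ge0.
apply: normc_cint01_le.
  by apply: cmeasurableB; [exact: cmeasurable_cst|exact: cmeasurable_laplace_kernel].
move=> v /andP[v0 v1]; apply: (le_trans (cexp_taylor1 _)).
have sv : normc (s * v%:C) <= normc s.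
  by rewrite normcM normc_real ger0_norm// ler_piMr// normc_ge0.
apply: ler_pM; rewrite ?mulr_ge0 ?normc_ge0 ?expR_ge0//; last by rewrite ler_expR.
by rewrite ler_wpM2l.
Qed.

(** The derivative is the integral of -x u(x) e^(-z x). With s = Re z and |h| <= s/2, the
    second-order remainder costs |h|^2 x^2 e^(|h| x), which leaves e^(-s x/2); half of this absorbs
    x^2 and the rest, e^(-s x/4), makes [u] integrable. *)
Lemma laplace_derivable (u : R -> R[i]) (z : R[i]) : laplace_integrable u -> 0 < Re z ->
  derivable (laplace u : R[i]^o -> R[i]^o) z 1.
Proof.
move=> lu z0; have [mu_ u0 iu] := lu; set s := Re z in z0 *.
have s4 : 0 < s / 4 by rewrite divr_gt0.
have s2 : 0 < s / 2 by rewrite divr_gt0.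
pose K := 1 + 4 / (s / 4) ^+ 2.
have K0 : 0 <= K by rewrite addr_ge0// divr_ge0// exprn_ge0// ltW.
have i4 := cintegrable_normc (iu _ s4).
have mx : @cmeasurable R _ RT (fun x => x%:C) by apply: cmeasurable_real; exact: measurable_id.
have x2 x : 0 <= x -> x ^+ 2 * expR (- (s / 2 * x)) <= K * expR (- (s / 4 * x)).
  move=> x0; have -> : - (s / 2 * x) = - (s / 4 * x) + - (s / 4 * x) by field.
  rewrite expRD mulrA ler_wpM2r ?expR_ge0//.
  apply: (le_trans (ler_wpM2l (sqr_ge0 x) (expRN_le s4 x0))).
  rewrite -/K mulrCA -[leRHS]mulr1 ler_wpM2l// ler_pdivrMr ?ltr_pwDl ?sqr_ge0//.
  by rewrite mul1r lerDr.
pose L x := - (x%:C * (u x * cexp (- (z * x%:C)))).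
have mz : @cmeasurable R _ RT (fun x => u x * cexp (- (z * x%:C))).
  by apply: cmeasurableM mu_ _; exact: cmeasurable_laplace_kernel.
have mL : @cmeasurable R _ RT L by apply: cmeasurableN; exact: cmeasurableM.
have iL : cintegrable L.
  apply: (cintegrable_le mL (rintegrableZ (1 + K) i4)) => x.
  have [x0|x0] := ltP x 0.
    by rewrite /L u0// mul0r !mulr0 oppr0 normc_real normr0 mulr0.
  rewrite /L normcN !normcM normc_laplace_kernel !normc_real !ger0_norm ?expR_ge0//.
  rewrite mulrCA [leRHS]mulrA [leRHS]mulrC; apply: ler_wpM2l; first exact: normc_ge0.
  have h1 : x * expR (- (s * x)) <= (1 + x ^+ 2) * expR (- (s / 2 * x)).
    apply: ler_pM; rewrite ?expR_ge0//.
      by have := sqr_ge0 (x - 1); rewrite sqrrB1; have := sqr_ge0 x; nra.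
    by rewrite ler_expR lerN2 ler_wpM2r//; have := z0; lra.
  apply: (le_trans h1); rewrite mulrDl mulrDl !mul1r; apply: lerD; last exact: x2.
  rewrite ler_expR lerN2 ler_wpM2r//; have := z0; lra.
pose I := \int[mu]_x normc ((expR (- (s / 4 * x)))%:C * u x).
have main h : h != 0 -> normc h <= s / 2 ->
    normc (cint setT L - h^-1 * (laplace u (z + h) - laplace u z)) <= 8 * K * I * normc h.
  move=> h0 hs.
  have zh0 : 0 < Re (z + h).
    rewrite ReD -/s; have := Re_le_normc h; rewrite ler_norml => /andP[hh _].
    by have := z0; lra.
  have iz := laplace_cintegrable lu z0; have izh := laplace_cintegrable lu zh0.
  have iD := cintegrableZ h^-1 (cintegrableB izh iz).
  rewrite !laplaceE// -(cintB izh iz) -(cintZ h^-1 (cintegrableB izh iz)) -(cintB iL iD).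
  have -> : 8 * K * I * normc h = 2 * \int[mu]_x (4 * K * normc h * normc ((expR (- (s / 4 * x)))%:C * u x)).
    by rewrite (rintZ _ i4) /I; ring.
  apply: normc_cint_le.
  - by apply: cintegrable_measurable; exact: cintegrableB.
  - exact: rintegrableZ.
  move=> x; have [x0|x0] := ltP x 0.
    rewrite /L u0// !mul0r !mulr0 oppr0 !addr0 mulr0 oppr0 addr0 !normc0.
    by rewrite mulr0.
  have hi : h * h^-1 = 1 by rewrite mulfV.
  have E : L x - h^-1 * (u x * cexp (- ((z + h) * x%:C)) - u x * cexp (- (z * x%:C))) =
     - (h^-1 * (u x * cexp (- (z * x%:C)) * (cexp (- (h * x%:C)) - 1 + h * x%:C))).
    rewrite (_ : - ((z + h) * x%:C) = - (z * x%:C) + - (h * x%:C)); last by ring.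
    rewrite cexpD /L.
    transitivity (- (x%:C * (u x * cexp (- (z * x%:C)))) * (h * h^-1) -
      h^-1 * (u x * (cexp (- (z * x%:C)) * cexp (- (h * x%:C))) - u x * cexp (- (z * x%:C)))).
      by rewrite hi mulr1.
    by ring.
  rewrite E normcN !normcM normc_laplace_kernel normcV.
  have hn0 : 0 < normc h by rewrite lt_neqAle normc_ge0 andbT eq_sym; apply: contra h0 => /eqP/eq0_normc ->.
  rewrite mulrC ler_pdivrMr//.
  have T := cexp_taylor2 (h * x%:C); rewrite normcM normc_real (ger0_norm x0) in T.
  rewrite normc_real (ger0_norm (expR_ge0 _)).
  have e1 : expR (- (s * x)) * expR (normc h * x) <= expR (- (s / 2 * x)).
    rewrite -expRD ler_expR; have := ler_wpM2r x0 hs; lra.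
  have h2 := sqr_ge0 (normc h).
  have un := normc_ge0 (u x).
  apply: (@le_trans _ _ (normc (u x) * (4 * normc h ^+ 2) * (x ^+ 2 * expR (- (s / 2 * x))))).
    rewrite -mulrA -[leRHS]mulrA; apply: ler_wpM2l => //.
    apply: (le_trans (ler_wpM2l (expR_ge0 _) T)).
    have -> : expR (- (Re z * x)) * (4 * (normc h * x) ^+ 2 * expR (normc h * x)) =
        4 * normc h ^+ 2 * x ^+ 2 * (expR (- (s * x)) * expR (normc h * x)).
      by rewrite /s; ring.
    rewrite [leRHS]mulrA; apply: (ler_wpM2l _ e1).
    by apply: mulr_ge0; [apply: mulr_ge0|exact: sqr_ge0].
  apply: (le_trans (ler_wpM2l _ (x2 x x0))).
    by apply: mulr_ge0 => //; apply: mulr_ge0.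
  by rewrite le_eqVlt; apply/orP; left; apply/eqP; ring.
have I0 : 0 <= I by apply: rint_ge0 => x; exact: normc_ge0.
apply/cvg_ex; exists (cint setT L : R[i]^o); apply/cvgrPdist_le => /= eps eps0.
(* A positive element of [R[i]] is real. *)
have [e epsE e0] : exists2 e : R, eps = e%:C & 0 < e.
  have := eps0; case: eps {eps0} => er ei; rewrite ltcE/= => /andP[/eqP ei0 er0].
  by exists er => //; rewrite ei0.
have KI : 0 < 8 * K * I + 1 by rewrite ltr_wpDl// !mulr_ge0.
have s2C : 0 < (s / 2)%:C :> R[i] by rewrite ltcR.
have eC : 0 < (e / (8 * K * I + 1))%:C :> R[i] by rewrite ltcR divr_gt0.
have n1 := @dnbhs0_lt _ (R[i]^o) _ s2C; have n2 := @dnbhs0_lt _ (R[i]^o) _ eC.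
near=> h.
have h0 : h != 0 by near: h; exact: withinT.
have hs : normc h <= s / 2.
  by rewrite -lecR -norm_normc; apply/ltW; near: h; exact: n1.
have he : normc h <= e / (8 * K * I + 1).
  by rewrite -lecR -norm_normc; apply/ltW; near: h; exact: n2.
rewrite norm_normc epsE lecR.
have := main h h0 hs; rewrite /= -[h *: 1]/(h * 1) mulr1 (addrC h) => /le_trans; apply.
apply: (@le_trans _ _ ((8 * K * I + 1) * normc h)).
  by rewrite ler_wpM2r ?normc_ge0// lerDl.
by rewrite mulrC -ler_pdivlMr.
Unshelve. all: by end_near. Qed.

End LaplaceBoundary.

(** * Transforms of translates and primitives, and both directions of the equivalence *)

Section OscillationTransform.
Variable R : realType.
Local Notation mu := (@lebesgue_measure R).
Local Notation RT := (measurableTypeR R).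

Lemma laplace_integrableZ (c : R[i]) (u : R -> R[i]) : laplace_integrable u -> laplace_integrable (fun x => c * u x).
Proof.
move=> [mu_ u0 iu]; split.
- by apply: cmeasurableM mu_; exact: cmeasurable_cst.
- by move=> x x0; rewrite u0// mulr0.
- by move=> s s0; apply: (cintegrable_eq _ (cintegrableZ c (iu s s0))) => x; rewrite mulrCA.
Qed.

Lemma laplace_integrableB (u v : R -> R[i]) : laplace_integrable u -> laplace_integrable v ->
  laplace_integrable (fun x => u x - v x).
Proof.
move=> [mu_ u0 iu] [mv v0 iv]; split.
- exact: cmeasurableB.
- by move=> x x0; rewrite u0// v0// subrr.
- by move=> s s0; apply: (cintegrable_eq _ (cintegrableB (iu s s0) (iv s s0))) => x; rewrite mulrBr.
Qed.

Lemma laplaceZ (c : R[i]) (u : R -> R[i]) z : laplace_integrable u -> 0 < Re z ->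
  laplace (fun x => c * u x) z = c * laplace u z.
Proof.
move=> lu z0; rewrite (laplaceE (laplace_integrableZ c lu) z0) (laplaceE lu z0).
by rewrite -(cintZ c (laplace_cintegrable lu z0)); apply: eq_cint => x; rewrite mulrA.
Qed.

Lemma laplaceB (u v : R -> R[i]) z : laplace_integrable u -> laplace_integrable v -> 0 < Re z ->
  laplace (fun x => u x - v x) z = laplace u z - laplace v z.
Proof.
move=> lu lv z0; rewrite (laplaceE (laplace_integrableB lu lv) z0) (laplaceE lu z0) (laplaceE lv z0).
rewrite -(cintB (laplace_cintegrable lu z0) (laplace_cintegrable lv z0)).
by apply: eq_cint => x; rewrite mulrBl.
Qed.

Lemma laplace_integrable_shift (u : R -> R[i]) (d : R) : 0 <= d -> laplace_integrable u ->
  laplace_integrable (fun x => u (x - d)).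
Proof.
move=> d0 [mu_ u0 iu]; split.
- exact: (cmeasurable_comp mu_ (shift_measurable (- d))).
- by move=> x x0; apply: u0; rewrite subr_lt0 (lt_le_trans x0).
move=> s s0; apply: (cintegrable_eq _ (cintegrableZ (expR (- (s * d)))%:C (cintegrable_shift (- d) (iu s s0)))) => x.
rewrite mulrA -rmorphM -expRD; congr ((expR _)%:C * _); ring.
Qed.

Lemma laplace_shift (u : R -> R[i]) (d : R) z : 0 <= d -> laplace_integrable u -> 0 < Re z ->
  laplace (fun x => u (x - d)) z = cexp (- (z * d%:C)) * laplace u z.
Proof.
move=> d0 lu z0; rewrite (laplaceE (laplace_integrable_shift d0 lu) z0) (laplaceE lu z0).
have iz := laplace_cintegrable lu z0.
rewrite -(cint_shift (- d) iz) -(cintZ _ (cintegrable_shift (- d) iz)); apply: eq_cint => x.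
rewrite [RHS]mulrCA -cexpD; congr (_ * cexp _).
by rewrite rmorphD rmorphN; ring.
Qed.

Section Primitive.
Variable u : R -> R[i].
Hypothesis lu : laplace_integrable u.
Let T x := cint `[0, x] u.

Let indic_halfline (x v : R) : (\1_(`[0, x]%classic) v : R)%:C * u v = (halfline (x - v))%:C * u v.
Proof.
have [_ u0 _] := lu; have [v0|v0] := ltP v 0; first by rewrite u0// !mulr0.
congr (_%:C * _); rewrite halflineE subr_ge0 indicE.
have -> : (v \in (`[0, x]%classic : set R)) = (v <= x).
  by apply/idP/idP; rewrite inE/= in_itv/= v0.
by case: ifP.
Qed.

Let iT x : cintegrable (fun v => (halfline (x - v))%:C * u v).
Proof.
by apply: (cintegrable_eq _ (rapid_cintegrable (laplace_integrable_itv x lu))) => v; rewrite indic_halfline.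
Qed.

Let TE x : T x = cint setT (fun v => (halfline (x - v))%:C * u v).
Proof. by rewrite /T cint_indic; apply: eq_cint => v; rewrite indic_halfline. Qed.

(** The double integral behind the transform of the primitive: integration in v returns T(x) e^(-z
    x), integration in x returns u(v) e^(-z v)/z. *)
Let F (z : R[i]) (x v : R) := (halfline (x - v))%:C * cexp (- (z * x%:C)) * u v.

Let FE z x : cint setT (F z x) = cexp (- (z * x%:C)) * T x.
Proof.
by rewrite TE -(cintZ _ (iT x)); apply: eq_cint => v; rewrite /F mulrA (mulrC (cexp _)).
Qed.

Let transform z : 0 < Re z -> cintegrable (fun x => T x * cexp (- (z * x%:C))) /\
  cint setT (fun x => T x * cexp (- (z * x%:C))) =
  z^-1 * cint setT (fun x => u x * cexp (- (z * x%:C))).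
Proof.
move=> z0; have [mu_ u0 iu] := lu; set s := Re z in z0 *.
have s2 : 0 < s / 2 by rewrite divr_gt0.
have ia : rintegrable (fun x : R => halfline x * expR (- (s / 2 * x))).
  apply: (rintegrable_eq _ (rintegrable_affine_exp ler01 (lexx 0) s2)) => x.
  by rewrite mul0r addr0 mul1r.
have ib := cintegrable_normc (iu _ s2).
have mF : @cmeasurable R _ (RT * RT)%type (fun p => F z p.1 p.2).
  apply: cmeasurableM; last exact: (cmeasurable_comp mu_ measurable_snd).
  apply: cmeasurableM; last first.
    exact: (cmeasurable_comp (cmeasurable_laplace_kernel z) measurable_fst).
  apply: cmeasurable_real.
  have md : measurable_fun setT (fun p : RT * RT => (p.1 - p.2 : RT)).
    by apply: measurable_funB; [exact: measurable_fst|exact: measurable_snd].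
  exact: (measurableT_comp (@measurable_halfline R) md).
(* For 0 <= v <= x, e^(-s x) <= e^(-s x/2) e^(-s v/2), a product bound as Fubini requires. *)
have F_le x v : normc (F z x v) <=
    (halfline x * expR (- (s / 2 * x))) * normc ((expR (- (s / 2 * v)))%:C * u v).
  have [v0|v0] := ltP v 0; first by rewrite /F u0// !mulr0 normc0 mulr0.
  have p : 0 <= halfline x * expR (- (s / 2 * x)) * normc ((expR (- (s / 2 * v)))%:C * u v).
    by rewrite mulr_ge0 ?normc_ge0// mulr_ge0 ?expR_ge0// halflineE; case: ifP.
  have [vx|xv] := leP v x; last first.
    by rewrite /F halflineE subr_ge0 (leNgt v) xv/= !mul0r normc0.
  have x0 : 0 <= x := le_trans v0 vx.
  rewrite /F !normcM normc_laplace_kernel !normc_real -/s !(ger0_norm (expR_ge0 _)) !halflineE.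
  rewrite subr_ge0 vx x0 normr1 !mul1r mulrA; apply: ler_wpM2r; first exact: normc_ge0.
  by rewrite -expRD ler_expR; have := ler_wpM2l (ltW s2) vx; lra.
have [i1 E1] := cint_fubini mF ia ib F_le.
have E2 v : cint setT (F z ^~ v) = z^-1 * (u v * cexp (- (z * v%:C))).
  have [ih Eh] := laplace_one z0.
  transitivity (u v * cexp (- (z * v%:C)) *
      cint setT (fun x => (\1_(`[0, +oo[%classic) (x - v))%:C * cexp (- (z * (x - v)%:C)))).
    rewrite -(cintZ _ (cintegrable_shift (- v) ih)); apply: eq_cint => x.
    rewrite /F (_ : - (z * x%:C) = - (z * v%:C) + - (z * (x - v)%:C)).
      by rewrite cexpD /halfline; ring.
    by rewrite rmorphB; ring.
  by rewrite (cint_shift (- v) ih) Eh mulrC.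
split.
  by apply: (cintegrable_eq _ i1) => x; rewrite FE mulrC.
transitivity (cint setT (fun x => cint setT (F z x))).
  by apply: eq_cint => x; rewrite FE mulrC.
rewrite E1 -(cintZ _ (laplace_cintegrable lu z0)).
by apply: eq_cint => v; rewrite E2.
Qed.

Lemma laplace_integrable_primitive : laplace_integrable T.
Proof.
have E (s x : R) : cexp (- (s%:C * x%:C)) = (expR (- (s * x)))%:C.
  by rewrite -rmorphM -rmorphN cexp_real.
split.
- have [i1 _] := @transform 1 ltr01.
  have m1 := cintegrable_measurable i1.
  have m2 : @cmeasurable R _ RT (fun x => (expR x)%:C).
    by apply: cmeasurable_real; apply: continuous_measurable_fun; exact: continuous_expR.
  have := cmeasurableM m2 m1; congr cmeasurable; apply/funext => x.
  rewrite (E 1) mulrCA -rmorphM -expRD mul1r subrr expR0 mulr1//.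
- move=> x x0; rewrite TE (eq_cint (g := fun=> 0)).
    by rewrite /cint /= /Rintegral integral0.
  move=> v; rewrite -indic_halfline indicE (_ : v \in _ = false) ?mul0r//.
  apply/negbTE; rewrite notin_setE/= in_itv/= => /andP[v0 vx].
  by have := lt_le_trans x0 v0; rewrite ltNge vx.
- move=> s s0; have z0 : 0 < Re s%:C by [].
  have [i1 _] := transform z0.
  by apply: (cintegrable_eq _ i1) => x; rewrite E mulrC.
Qed.

Lemma laplace_primitive z : 0 < Re z -> laplace T z = laplace u z / z.
Proof.
move=> z0; rewrite (laplaceE laplace_integrable_primitive z0) (laplaceE lu z0).
by have [_ ->] := transform z0; rewrite mulrC.
Qed.

(** Multiplied by d, the quantity is the integral of u(x) - u(v) over v in [x - d, x], where v >= X
    and x = v + h with 0 <= h <= d. *)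
Lemma primitive_mean_close (d M X : R) : 0 < d -> 0 <= X ->
  (forall x h, X <= x -> 0 <= h <= d -> normc (u (x + h) - u x) <= M) ->
  forall x, X + d <= x -> normc (u x - d^-1%:C * (T x - T (x - d))) <= 2 * M.
Proof.
move=> d0 X0 osc x xX; have x0 : 0 <= x - d by lra.
have xd : x - d <= x by rewrite gerBl ltW.
pose I (t v : R) : R := \1_(`[0, t]%classic) v.
have iI t : cintegrable (fun v => (I t v)%:C) by exact: cintegrable_real (rintegrable_itv 0 t).
have iIu t : cintegrable (fun v => (I t v)%:C * u v).
  exact: rapid_cintegrable (laplace_integrable_itv t lu).
have M0 : 0 <= M by apply: le_trans (osc X 0 (lexx _) _); [exact: normc_ge0|rewrite lexx ltW].
have E1 : T x - T (x - d) = cint setT (fun v => (I x v)%:C * u v - (I (x - d) v)%:C * u v).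
  by rewrite (cintB (iIu x) (iIu (x - d))) /T !(cint_indic (`[0, _]%classic)).
have E2 : d%:C * u x = cint setT (fun v => u x * ((I x v)%:C - (I (x - d) v)%:C)).
  rewrite (cintZ _ (cintegrableB (iI x) (iI (x - d)))) (cintB (iI x) (iI (x - d))).
  rewrite !cint_real !integral_itv_indic// ?(le_trans x0)// -rmorphB mulrC; congr (_ * _%:C); ring.
have ix := cintegrableZ (u x) (cintegrableB (iI x) (iI (x - d))).
have iu := cintegrableB (iIu x) (iIu (x - d)).
have -> : u x - d^-1%:C * (T x - T (x - d)) = d^-1%:C * (d%:C * u x - (T x - T (x - d))).
  by rewrite [RHS]mulrBr [in RHS]mulrA -rmorphM mulVf ?gt_eqF// mul1r.
rewrite normcM normc_real gtr0_norm ?invr_gt0// mulrC ler_pdivrMr// E2 E1 -(cintB ix iu).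
have -> : 2 * M * d = 2 * \int[mu]_v (M * \1_(`[x - d, x]%classic) v).
  by rewrite (rintZ _ (rintegrable_itv _ _)) integral_itv_indic//; ring.
apply: normc_cint_le.
- by apply: cintegrable_measurable; exact: cintegrableB.
- exact: rintegrableZ (rintegrable_itv _ _).
move=> v; rewrite (_ : _ - _ = (I x v - I (x - d) v)%:C * (u x - u v)); last by rewrite rmorphB; ring.
rewrite normcM normc_real /I !indicE.
have Ein (a b : R) : (v \in (`[a, b]%classic : set R)) = (a <= v <= b).
  by apply/idP/idP; rewrite inE/= in_itv.
rewrite !Ein; have [v1|v1] := leP v (x - d).
  have -> : (v <= x) by exact: le_trans xd.
  by rewrite subrr normr0 mul0r mulr_ge0.
rewrite andbF subr0 (ltW v1)/= (_ : 0 <= v)/=; last by lra.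
have [v2|v2] := leP v x; last by rewrite normr0 mul0r mulr0.
rewrite normr1 mul1r mulr1.
have := osc v (x - v); rewrite (addrC v) subrK; apply; first by lra.
by apply/andP; split; lra.
Qed.

End Primitive.

Lemma bdd_oscillating_window (tau : R -> R[i]) : bdd_oscillating tau ->
  exists d M X : R, [/\ 0 < d, 0 <= X &
    forall x h, X <= x -> 0 <= h <= d -> normc (tau (x + h) - tau x) <= M].
Proof.
move=> [d d0 [M [X0 [_ HX]]]]; exists d, M, (Num.max (X0 + 1) 0); split => //.
  by rewrite le_max lexx orbT.
move=> x h; rewrite ge_max => /andP[xX x0] hd.
have := HX x _ h hd; rewrite norm_normc lecR; apply.
by apply: lt_le_trans xX; rewrite ltrDl.
Qed.

Lemma oscillating_boundary (tau : R -> R[i]) : laplace_integrable tau -> bdd_oscillating tau ->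
  exists (G : R[i] -> R[i]) (r : R), 0 < r /\ analytic_near0 G r /\
    pm_boundary (fun s => laplace tau s - G s / s) /\ pm_boundary G.
Proof.
move=> lt /bdd_oscillating_window[d [M [X [d0 X0 osc]]]].
have d0' := ltW d0.
have M0 : 0 <= M by apply: le_trans (osc X 0 (lexx _) _); [exact: normc_ge0|rewrite lexx ltW].
pose T x := cint `[0, x] tau.
have lT : laplace_integrable T := laplace_integrable_primitive lt.
pose g x := d^-1%:C * (tau x - tau (x - d)).
pose u x := tau x - d^-1%:C * (T x - T (x - d)).
have ltd := laplace_integrable_shift d0' lt; have lTd := laplace_integrable_shift d0' lT.
have lg : laplace_integrable g by apply: laplace_integrableZ; exact: laplace_integrableB.
have lTT := laplace_integrableB lT lTd.
have lu : laplace_integrable u by apply: laplace_integrableB => //; exact: laplace_integrableZ.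
(* The radius is arbitrary, as this transform is analytic on the whole half-plane. *)
exists (laplace g), 1; split; first exact: ltr01.
split; first by move=> z z0 _; exact: laplace_derivable.
split.
  (* The transform of [T] is that of [tau] divided by z, so G(z)/z is the transform of the mean
     (T(x) - T(x - d))/d, and the difference is the transform of [u]. *)
  apply: (pm_boundary_ext (F1 := laplace u)).
    move=> z z0.
    rewrite (laplaceB lt (laplace_integrableZ _ lTT) z0) (laplaceZ _ lTT z0) (laplaceB lT lTd z0).
    rewrite (laplace_shift d0' lT z0) (laplace_primitive lt z0).
    rewrite (laplaceZ _ (laplace_integrableB lt ltd) z0) (laplaceB lt ltd z0) (laplace_shift d0' lt z0).
    congr (_ - _); rewrite -mulrA; congr (_ * _).
    by rewrite mulrBl mulrA.
  apply: (@laplace_pm_boundary _ u (X + d) (2 * M) lu); first by rewrite mulr_ge0.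
  by move=> x xX; apply: (primitive_mean_close lt d0 X0 osc); exact: ltW.
apply: (@laplace_pm_boundary _ g (X + d) (d^-1 * M) lg).
  by rewrite mulr_ge0// invr_ge0.
move=> x xX; rewrite /g normcM normc_real gtr0_norm ?invr_gt0//.
rewrite ler_wpM2l ?invr_ge0//.
have := osc (x - d) d; rewrite subrK; apply; last by rewrite lexx d0'.
lra.
Qed.

Lemma boundary_tauberian (tau : R -> R[i]) (G : R[i] -> R[i]) (r : R) :
  laplace_integrable tau -> loc_integrable tau -> bdd_decreasing tau ->
  0 < r -> analytic_near0 G r ->
  pm_boundary (fun s => laplace tau s - G s / s) -> pm_boundary G ->
  bdd_oscillating tau /\
  exists (l : R) (g : R -> R[i]), [/\ 0 < l, Linfty g,
    bdry_limit G (- l) l (fun phi => cint setT (fun x => g x * fourier phi x)) &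
    exists M : R, \forall x \near +oo, `|tau x - cint `[0, x] g| <= M%:C].
Proof.
move=> lt li dt r0 aG bQ bG.
have [lQ [q [Mq [lQ0 mq qM limQ]]]] := pm_boundary_test bQ.
have [lG [g [Mg [lG0 mg gM limG]]]] := pm_boundary_test bG.
(* One interval for both limits, within r/2 so that s + it stays in the half-disc where [G] is
   analytic. *)
pose l := Num.min (Num.min lQ lG) (r / 2).
have l0 : 0 < l by rewrite !lt_min lQ0 lG0 divr_gt0.
have [lQl lGl lr] : [/\ l <= lQ, l <= lG & l <= r / 2] by rewrite /l !ge_min !lexx ?orbT.
have limQ' : bdry_limit (fun s => laplace tau s - G s / s) (- l) l
    (fun chi => cint setT (fun x => q x * fourier chi x)).
  by move=> phi tp; apply: limQ; apply: test_fun_W tp => //; rewrite lerN2.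
have limG' : bdry_limit G (- l) l (fun chi => cint setT (fun x => g x * fourier chi x)).
  by move=> phi tp; apply: limG; apply: test_fun_W tp => //; rewrite lerN2.
have [chi [kappa [tchi chiE k0 [a [c [a0 c0 kc]]]]]] := positive_kernel l0.
have [A [X [A0 X0 osc]]] := tauberian_oscillation lt li dt aG r0 lr tchi chiE k0 a0 c0 kc
  mq qM mg gM limQ' limG'.
have [K [Y HY]] := tauberian_primitive lt li dt aG r0 lr tchi chiE k0 a0 c0 kc
  mq qM mg gM limQ' limG'.
split.
  exists 1; first exact: ltr01.
  (* For 0 <= h <= 1 the bound A (1 + h) is at most 2 A. *)
  exists (A * 2); near=> x => h /andP[h0 h1].
  have Xx : X <= x by near: x; apply: nbhs_pinfty_ge; exact: num_real.
  rewrite norm_normc lecR; apply: (le_trans (osc _ _ _ Xx)); first by rewrite (le_trans Xx)// lerDl.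
  by rewrite ler_wpM2l// (addrC x) addrK ger0_norm// lerD2l.
exists l, g; split => //; first exact: (Linfty_bounded mg gM).
exists K; near=> x.
rewrite norm_normc lecR; apply: HY.
by near: x; apply: nbhs_pinfty_ge; exact: num_real.
Unshelve. all: by end_near. Qed.

End OscillationTransform.

Theorem theorem3p6 (R : realType) (tau : R -> R[i]) :
  loc_integrable tau ->
  (forall x : R, x < 0 -> tau x = 0) ->
  laplace_converges tau ->
  bdd_decreasing tau ->
  (bdd_oscillating tau <->
     exists (G : R[i] -> R[i]) (r : R), 0 < r /\ analytic_near0 G r /\
       pm_boundary (fun s => laplace tau s - G s / s) /\ pm_boundary G)
  /\
  (forall (G : R[i] -> R[i]) (r : R), 0 < r -> analytic_near0 G r ->
     pm_boundary (fun s => laplace tau s - G s / s) -> pm_boundary G ->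
     exists2 lambda0 : R, 0 < lambda0 &
       forall lambda : R, 0 < lambda < lambda0 ->
         exists g : R -> R[i], [/\ Linfty g,
           (forall phi, test_fun (- lambda) lambda phi ->
              ((fun sigma : R =>
                  cint setT (fun t => G (sigma +i* t) * phi t)) : R -> R[i]^o)
                @ 0^'+ --> (cint setT (fun x => g x * fourier phi x) : R[i]^o)) &
           exists M : R, \forall x \near +oo,
             `|tau x - cint `[0, x] g| <= M%:C]).
Proof.
move=> li t0 lc dt; have lt := laplace_integrableP li t0 lc dt.
split; first split.
- exact: oscillating_boundary.
- by move=> [G [r [r0 [aG [bQ bG]]]]]; have [] := boundary_tauberian lt li dt r0 aG bQ bG.
move=> G r r0 aG bQ bG.
have [_ [l [g [l0 gL limG HM]]]] := boundary_tauberian lt li dt r0 aG bQ bG.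
(* One g serves every smaller interval, since test functions on (-lambda, lambda) are test functions
   on (-l, l). *)
exists l => // lambda /andP[_ ll]; exists g; split => // phi tp.
by apply: limG; apply: test_fun_W tp; [rewrite lerN2|]; exact: ltW.
Qed.
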